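(* Let $K$ be a field, $s\ge1$, and let $S_1,\dots,S_s$ be standard graded polynomial rings over $K$ on pairwise disjoint finite sets of variables. For each $i=1,\dots,s$ let $M_i$ be a finitely generated graded Cohen-Macaulay $S_i$-module with $\dim M_i\ge1$. Let $d_i=\dim M_i$, $b_i=d_i-1$ and $\alpha_i=d_i-\mathrm{reg}(M_i)$, where $\mathrm{reg}(M_i)$ is the Castelnuovo-Mumford regularity of $M_i$. Then: (1) $$\mathrm{reg}(M_1\underline{\otimes}\cdots\underline{\otimes}M_s)=\max_{u\in C_2}\Bigl\{1+\sum_{l\in\mathrm{Supp}\,u}b_l-\max_{l\in\mathrm{Supp}\,u}\{\alpha_l\}\Bigr\}.$$ (2) For positive integers $n_i$ and integers $\tau_i$ ($i=1,\dots,s$), let $M_i[\tau_i]^{<n_i>}$ be the shifted $n_i$-Veronese transform of $M_i$. Then $$\mathrm{reg}\bigl(M_1[\tau_1]^{<n_1>}\underline{\otimes}\cdots\underline{\otimes}M_s[\tau_s]^{<n_s>}\bigr)=\max_{u\in C_2}\Bigl\{1+\sum_{l\in\mathrm{Supp}\,u}b_l-\max_{l\in\mathrm{Supp}\,u}\Bigl\{\Bigl\lceil\frac{\alpha_l+\tau_l}{n_l}\Bigr\rceil\Bigr\}\Bigr\}.$$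
   Context: The Segre product of graded modules $N_i$ over graded $K$-algebras $R_i$ is $\underline{\bigotimes}_{i}N_i=\bigoplus_{n\in\mathbb Z}\bigotimes_{i}(N_i)_n$ (tensor products over $K$), a graded module over the Segre product of the rings $R_i$. For a graded $S$-module $M$, $\tau\in\mathbb Z$ and $n\ge1$, the shifted Veronese transform is $M[\tau]^{<n>}=\bigoplus_{k\in\mathbb Z}M_{nk+\tau}$, where $M_{nk+\tau}$ sits in degree $k$; it is a graded module over the Veronese ring $S^{<n>}=\bigoplus_{k\ge0}S_{nk}$. For a graded module $N$, $\mathrm{End}(N)=\max\{\beta\in\mathbb Z:N_\beta\ne0\}$ ($-\infty$ if $N=0$). The Castelnuovo-Mumford regularity of a finitely generated graded module $M$ over a standard graded $K$-algebra with irrelevant maximal ideal $\mathfrak m$ (elements of positive degree) is $\mathrm{reg}(M)=\max_j\{\mathrm{End}(H^j_{\mathfrak m}(M))+j\}$. Let $\mathfrak m_i$ be the irrelevant maximal ideal of $S_i$, $C=\{0,\dots,d_1\}\times\cdots\times\{0,\dots,d_s\}$, and for $u\in C$ let $\mathrm{Supp}\,u=\{i:u_i\ne0\}$. Then $C_2=\{u\in C: u\neq0,\ \tilde E_u\ne0\}$, where $\tilde E_u=\underline{\bigotimes}_{i\in\mathrm{Supp}\,u}H^{u_i}_{\mathfrak m_i}(M_i)$. *)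

(* Defs.v *)
From HB Require Import structures.
From mathcomp Require Import all_boot all_order all_algebra.
From mathcomp Require Import boolp.
From mathcomp Require Import freeg mpoly.

Set Implicit Arguments.
Unset Strict Implicit.
Unset Printing Implicit Defensive.

Import Order.TTheory GRing.Theory Num.Theory.

Local Open Scope ring_scope.
Local Open Scope quotient_scope.

Definition is_max (disp : Order.disp_t) (T : porderType disp)
    (P : T -> Prop) (m : T) : Prop :=
  P m /\ forall k, P k -> (k <= m)%O.

Section Span.
Variables (R : pzRingType) (V : lmodType R) (P : V -> Prop).

Definition span : {pred V} := fun x =>
  `[< forall W : {pred V}, submod_closed W ->
      (forall y, P y -> y \in W) -> x \in W >].

Lemma span_closed : submod_closed span.
Proof.
split=> [|c x y /asboolP hx /asboolP hy]; apply/asboolP=> W hW hP.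
  by case: hW.
by case: (hW) => _; apply; [apply: hx | apply: hy].
Qed.

Lemma mem_span y : P y -> y \in span.
Proof. by move=> Py; apply/asboolP=> W _; apply. Qed.

HB.instance Definition _ :=
  GRing.isSubmodClosed.Build R V span (GRing.submod_closed_semi span_closed).

End Span.

Section LmodQuotient.
Variables (R : pzRingType) (V : lmodType R) (P : V -> Prop).

Definition lquot : Type := @Quotient.quot V (span P).

HB.instance Definition _ := GRing.Zmodule.on lquot.

Definition lquot_pi (x : V) : lquot := \pi_(@Quotient.quot V (span P)) x.
Definition lquot_repr (x : lquot) : V := repr (x : @Quotient.quot V (span P)).

Lemma lquot_reprK : cancel lquot_repr lquot_pi.
Proof. exact: reprK. Qed.

Lemma lquot_eq x y : (lquot_pi x == lquot_pi y) = (x - y \in span P).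
Proof. by rewrite /lquot_pi -Quotient.idealrBE. Qed.

Lemma lquot_piD x y : lquot_pi (x + y) = lquot_pi x + lquot_pi y.
Proof. by rewrite /lquot_pi !piE. Qed.

Definition lquot_scale c x := lquot_pi (c *: lquot_repr x).

Lemma lquot_scale_pi c x : lquot_scale c (lquot_pi x) = lquot_pi (c *: x).
Proof.
apply/eqP; rewrite /lquot_scale lquot_eq -scalerBr rpredZ //.
by rewrite -lquot_eq lquot_reprK.
Qed.

Lemma lquot_scaleA a b v :
  lquot_scale a (lquot_scale b v) = lquot_scale (a * b) v.
Proof. by rewrite -[v]lquot_reprK !lquot_scale_pi scalerA. Qed.

Lemma lquot_scale1 : left_id 1 lquot_scale.
Proof. by move=> v; rewrite -[v]lquot_reprK lquot_scale_pi scale1r. Qed.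

Lemma lquot_scaleDr : right_distributive lquot_scale +%R.
Proof.
move=> c x y; rewrite -[x]lquot_reprK -[y]lquot_reprK.
by rewrite -lquot_piD !lquot_scale_pi scalerDr lquot_piD.
Qed.

Lemma lquot_scaleDl v : {morph lquot_scale^~ v : a b / a + b}.
Proof.
move=> a b; rewrite -[v]lquot_reprK.
by rewrite !lquot_scale_pi scalerDl lquot_piD.
Qed.

HB.instance Definition _ := GRing.Zmodule_isLmodule.Build R lquot
  lquot_scaleA lquot_scale1 lquot_scaleDr lquot_scaleDl.

Lemma lquot_pi_is_linear : linear lquot_pi.
Proof. by move=> c x y; rewrite lquot_piD -lquot_scale_pi. Qed.

Lemma lquot_piZ c x : lquot_pi (c *: x) = c *: lquot_pi x.
Proof. exact: esym (lquot_scale_pi c x). Qed.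

HB.instance Definition _ :=
  GRing.isLinear.Build R V lquot _ lquot_pi lquot_pi_is_linear.

End LmodQuotient.

Section Tensor.
Variables (K : fieldType) (I : finType).

Definition multilinear (V : I -> lmodType K) (W : lmodType K)
    (g : (forall i, V i) -> W) : Prop :=
  forall (v : forall i, V i) (i : I) (c : K) (x y : V i),
    g (dfwith v (c *: x + y)) = c *: g (dfwith v x) + g (dfwith v y).

(* The tensor product over K of the V i: the free K-module on the product of  *)
(* the V i, modulo the relations of multilinearity.                           *)
Definition tensor_rel (V : I -> lmodType K) (t : {freeg (forall i, V i) / K})
    : Prop :=
  exists (v : forall i, V i) (i : I) (c : K) (x y : V i),
    t = << dfwith v (c *: x + y) >>
        - (c *: << dfwith v x >> + << dfwith v y >>).

Definition tensor (V : I -> lmodType K) : lmodType K :=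
  lquot (@tensor_rel V).

Definition pure (V : I -> lmodType K) (v : forall i, V i) : tensor V :=
  lquot_pi (@tensor_rel V) << v >>.

Lemma pure_multilinear V : multilinear (@pure V).
Proof.
move=> v i c x y; rewrite /pure -linearP; apply/eqP; rewrite lquot_eq.
by apply: mem_span; exists v, i, c, x, y.
Qed.

(* The linear map induced by g when g is multilinear.                         *)
Definition tlift (V : I -> lmodType K) (W : lmodType K) (g : (forall i, V i) -> W)
    (t : tensor V) : W :=
  fglift g (lquot_repr t).


Lemma fglift_linear (T : choiceType) (W : lmodType K) (g : T -> W) :
  linear (fglift g : {freeg T / K} -> W).
Proof.
have gB := lift_is_additive g.
have gN D : fglift g (- D) = - fglift g D.
  have g0 : fglift g 0 = 0 by have := gB 0 0; rewrite !subrr.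
  by rewrite -sub0r gB g0 sub0r.
have gD D1 D2 : fglift g (D1 + D2) = fglift g D1 + fglift g D2.
  by rewrite -[D2 in LHS]opprK gB gN opprK.
have g0 : fglift g 0 = 0 by rewrite -(subrr 0) gB subrr.
have gsum (J : Type) (r : seq J) (F : J -> {freeg T / K}) :
    fglift g (\sum_(j <- r) F j) = \sum_(j <- r) fglift g (F j).
  by elim/big_rec2: _ => // j y1 y2 _ <-.
move=> c x y; rewrite gD; congr (_ + _).
have -> : c *: x = \sum_(z <- dom x) << c * coeff z x *g z >> by [].
rewrite -[x in RHS]freeg_sumE !gsum scaler_sumr; apply: eq_bigr => z _.
by rewrite !liftU scalerA.
Qed.


Lemma tlift_pi (V : I -> lmodType K) (W : lmodType K)
    (g : (forall i, V i) -> W) : multilinear g ->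
  forall t, tlift g (lquot_pi (@tensor_rel V) t) = fglift g t.
Proof.
move=> gml t; have glin := fglift_linear g.
have g0 : fglift g 0 = 0 :> W by rewrite -(subrr 0) lift_is_additive subrr.
apply/eqP; rewrite -subr_eq0 -lift_is_additive /tlift; apply/eqP.
have : lquot_repr (lquot_pi (@tensor_rel V) t) - t \in span (@tensor_rel V).
  by rewrite -lquot_eq lquot_reprK.
move/asboolP=> /(_ (fun x => fglift g x == 0)) H; apply/eqP; apply: H.
  split=> [|c x y /eqP gx /eqP gy]; first by rewrite unfold_in g0.
  by rewrite unfold_in glin gx gy scaler0 addr0.
move=> _ [v [i [c [x [y ->]]]]]; rewrite unfold_in lift_is_additive glin.
by rewrite !liftU !scale1r gml subrr.
Qed.

Lemma tlift_pure (V : I -> lmodType K) (W : lmodType K)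
    (g : (forall i, V i) -> W) : multilinear g ->
  forall v, tlift g (pure v) = g v.
Proof. by move=> gml v; rewrite /pure tlift_pi // liftU scale1r. Qed.

Lemma tlift_linear (V : I -> lmodType K) (W : lmodType K)
    (g : (forall i, V i) -> W) : multilinear g -> linear (tlift g).
Proof.
move=> gml c t u; rewrite -[t]lquot_reprK -[u]lquot_reprK -linearP.
by rewrite !tlift_pi // fglift_linear.
Qed.

Lemma tensor_ind (V : I -> lmodType K) (P : tensor V -> Prop) :
    (forall c t u, P t -> P u -> P (c *: t + u)) ->
    (forall v, P (pure v)) -> inhabited (forall i, V i) -> forall t, P t.
Proof.
move=> PL Pv [v0] t; rewrite -[t]lquot_reprK -[lquot_repr t]freeg_sumE.
have P0 : P 0 by have := PL (-1) _ _ (Pv v0) (Pv v0); rewrite scaleN1r addNr.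
rewrite raddf_sum; elim/big_ind: _ => // [x y Px Py|v _].
  by have := PL 1 _ _ Px Py; rewrite scale1r.
have -> : << coeff v (lquot_repr t) *g v >>
    = coeff v (lquot_repr t) *: (<< v >> : {freeg (forall i, V i) / K}).
  by apply/eqP/freeg_eqP=> w; rewrite coeffZ !coeffU mul1r.
rewrite /= lquot_piZ.
by rewrite -[_ *: _]addr0; apply: PL; [exact: Pv | exact: P0].
Qed.

Lemma tensor_ext (V : I -> lmodType K) (W : lmodType K)
    (f g : tensor V -> W) : linear f -> linear g ->
  (forall v, f (pure v) = g (pure v)) -> f =1 g.
Proof.
move=> fl gl fg; apply: (tensor_ind (P := fun t => f t = g t)) => //.
  by move=> c t u ft gt; rewrite fl gl ft gt.
by constructor; move=> i; exact: 0.
Qed.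

Lemma comp_dfwith (V W : I -> Type) (f : forall i, V i -> W i)
    (v : forall i, V i) i (x : V i) :
  (fun j => f j (dfwith v x j)) = dfwith (fun j => f j (v j)) (f i x).
Proof.
apply: functional_extensionality_dep => j.
have [->|ji] := eqVneq j i; first by rewrite !dfwith_in.
by rewrite !dfwith_out // eq_sym.
Qed.

Definition tmap2 (U V W : I -> lmodType K) (f : forall i, U i -> V i -> W i)
    (t : tensor U) (u : tensor V) : tensor W :=
  tlift (fun a => tlift (fun b => pure (fun i => f i (a i) (b i))) u) t.

Section Tmap2.
Variables (U V W : I -> lmodType K) (f : forall i, U i -> V i -> W i).
Hypothesis fl : forall i b, linear ((@f i)^~ b).
Hypothesis fr : forall i a, linear (@f i a).

Let inner_ml a : multilinear (fun b => pure (fun i => @f i (a i) (b i))).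
Proof.
move=> v i c x y.
by rewrite !(comp_dfwith (fun j => @f j (a j))) fr pure_multilinear.
Qed.

Let outer_ml u :
  multilinear (fun a => tlift (fun b => pure (fun i => @f i (a i) (b i))) u).
Proof.
move=> v i c x y; move: u; apply: tensor_ext.
- exact: tlift_linear.
- move=> k t u; rewrite !(tlift_linear (inner_ml _)) [k *: (_ + _)]scalerDr !scalerDr.
  rewrite !scalerA addrACA; congr (_ + _ + _).
  by rewrite [c * k]mulrC.
move=> b; rewrite !tlift_pure //.
rewrite !(comp_dfwith (fun j (z : U j) => @f j z (b j))) fl.
exact: pure_multilinear.
Qed.

Lemma tmap2_linearl u : linear (fun t => tmap2 f t u).
Proof. exact: tlift_linear. Qed.

Lemma tmap2_linearr t : linear (tmap2 f t).
Proof.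
move=> k x y; move: t; apply: tensor_ext => [||a].
- exact: tmap2_linearl.
- move=> c t u; rewrite !tmap2_linearl !scalerDr !scalerA addrACA.
  by rewrite [c * k]mulrC.
- by rewrite /tmap2 !tlift_pure // tlift_linear.
Qed.

Lemma tmap2_pure a b :
  tmap2 f (pure a) (pure b) = pure (fun i => @f i (a i) (b i)).
Proof. by rewrite /tmap2 !tlift_pure. Qed.

End Tmap2.

End Tensor.

(* Commutative N-graded K-algebras and Z-graded modules over them, given by    *)
(* their homogeneous components. Products carry a proof that the degrees add   *)
(* up, so that no transport between components is needed.                      *)
Record galg (K : fieldType) := GAlg {
  acomp :> nat -> lmodType K;
  amul : forall i j k, (i + j)%N = k -> acomp i -> acomp j -> acomp k;
  aone : acomp 0;
  amul_linearl : forall i j k (e : (i + j)%N = k) b,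
    linear (fun a => amul e a b);
  amulC : forall i j k (e : (i + j)%N = k) (e' : (j + i)%N = k) a b,
    amul e a b = amul e' b a;
  amulA : forall i j l ij jl k (e1 : (i + j)%N = ij) (e2 : (ij + l)%N = k)
      (e3 : (j + l)%N = jl) (e4 : (i + jl)%N = k) a b c,
    amul e2 (amul e1 a b) c = amul e4 a (amul e3 b c);
  amul1 : forall i (e : (0 + i)%N = i) a, amul e aone a = a
}.

Record gmod (K : fieldType) (A : galg K) := GMod {
  gcomp :> int -> lmodType K;
  gact : forall (i : nat) (n m : int), n + i%:Z = m ->
    A i -> gcomp n -> gcomp m;
  gact_linearl : forall i n m (e : n + i%:Z = m) x,
    linear (fun a => gact e a x);
  gact_linearr : forall i n m (e : n + i%:Z = m) a, linear (gact e a);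
  gactA : forall i j k n m l (e : (i + j)%N = k) (e1 : n + j%:Z = m)
      (e2 : m + i%:Z = l) (e3 : n + k%:Z = l) a b x,
    gact e2 a (gact e1 b x) = gact e3 (amul e a b) x;
  gact1 : forall n (e : n + 0%:Z = n) x, gact e (aone A) x = x
}.

Lemma amul_linearr (K : fieldType) (A : galg K) i j k (e : (i + j)%N = k)
  (a : A i) : linear (amul e a).
Proof.
have e' : (j + i)%N = k by rewrite addnC.
by move=> c x y; rewrite !(amulC e e') amul_linearl.
Qed.

Section PolyAlg.
Variables (K : fieldType) (r : nat).

Lemma dhomog_mul_subproof i j k (e : (i + j)%N = k) (p : dhomog r K i)
    (q : dhomog r K j) :
  (mpoly_of_dhomog p * mpoly_of_dhomog q) \is k.-homog.
Proof. by rewrite -e; apply: dhomogM; apply: dhomog_is_dhomog. Qed.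

Definition dhomog_mul i j k (e : (i + j)%N = k) (p : dhomog r K i)
    (q : dhomog r K j) : dhomog r K k :=
  DHomog (dhomog_mul_subproof e p q).

Definition dhomog_one : dhomog r K 0 := DHomog (@dhomog1 r K mdeg).

Lemma dhomog_mul_linearl i j k (e : (i + j)%N = k) q :
  linear (fun p => dhomog_mul e p q).
Proof.
by move=> c x y; apply: val_inj; rewrite /= mulrDl scalerAl.
Qed.

Lemma dhomog_mulC i j k (e : (i + j)%N = k) (e' : (j + i)%N = k) p q :
  dhomog_mul e p q = dhomog_mul e' q p.
Proof. by apply: val_inj; rewrite /= mulrC. Qed.

Lemma dhomog_mulA i j l ij jl k (e1 : (i + j)%N = ij) (e2 : (ij + l)%N = k)
    (e3 : (j + l)%N = jl) (e4 : (i + jl)%N = k) p q t :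
  dhomog_mul e2 (dhomog_mul e1 p q) t = dhomog_mul e4 p (dhomog_mul e3 q t).
Proof. by apply: val_inj; rewrite /= mulrA. Qed.

Lemma dhomog_mul1 i (e : (0 + i)%N = i) p : dhomog_mul e dhomog_one p = p.
Proof. by apply: val_inj; rewrite /= mul1r. Qed.

Definition polyAlg : galg K :=
  GAlg dhomog_mul_linearl dhomog_mulC dhomog_mulA dhomog_mul1.

End PolyAlg.

Section Veronese.
Variables (K : fieldType) (A : galg K) (n : nat).

Lemma veronese_deg (i j k : nat) :
  (i + j)%N = k -> (i * n + j * n)%N = (k * n)%N.
Proof. by move<-; rewrite mulnDl. Qed.

Definition veronese_mul i j k (e : (i + j)%N = k) :
    A (i * n)%N -> A (j * n)%N -> A (k * n)%N :=
  amul (veronese_deg e).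

Lemma veronese_mul_linearl i j k (e : (i + j)%N = k) b :
  linear (fun a => veronese_mul e a b).
Proof. exact: amul_linearl. Qed.

Lemma veronese_mulC i j k (e : (i + j)%N = k) (e' : (j + i)%N = k) a b :
  veronese_mul e a b = veronese_mul e' b a.
Proof. exact: amulC. Qed.

Lemma veronese_mulA i j l ij jl k (e1 : (i + j)%N = ij) (e2 : (ij + l)%N = k)
    (e3 : (j + l)%N = jl) (e4 : (i + jl)%N = k) a b c :
  veronese_mul e2 (veronese_mul e1 a b) c
    = veronese_mul e4 a (veronese_mul e3 b c).
Proof. exact: amulA. Qed.

Lemma veronese_mul1 i (e : (0 + i)%N = i) a :
  veronese_mul e (aone A : A (0 * n)%N) a = a.
Proof. exact: amul1. Qed.

Definition veroneseAlg : galg K :=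
  @GAlg K (fun k => A (k * n)%N) veronese_mul (aone A)
    veronese_mul_linearl veronese_mulC veronese_mulA veronese_mul1.

Variables (M : gmod A) (tau : int).

Lemma veronese_mdeg (i : nat) (k m : int) :
  k + i%:Z = m -> n%:Z * k + tau + (i * n)%N%:Z = n%:Z * m + tau.
Proof. by move<-; rewrite mulrDr PoszM [i%:Z * _]mulrC addrAC. Qed.

Definition veronese_act i k m (e : k + i%:Z = m) :
    veroneseAlg i -> M (n%:Z * k + tau) -> M (n%:Z * m + tau) :=
  gact (veronese_mdeg e).

Lemma veronese_act_linearl i k m (e : k + i%:Z = m) x :
  linear (fun a => veronese_act e a x).
Proof. exact: (gact_linearl (veronese_mdeg e) x). Qed.

Lemma veronese_act_linearr i k m (e : k + i%:Z = m) a :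
  linear (veronese_act e a).
Proof. exact: (gact_linearr (veronese_mdeg e) a). Qed.

Lemma veronese_actA i j k p m l (e : (i + j)%N = k) (e1 : p + j%:Z = m)
    (e2 : m + i%:Z = l) (e3 : p + k%:Z = l) a b x :
  veronese_act e2 a (veronese_act e1 b x)
    = veronese_act e3 (amul (g := veroneseAlg) e a b) x.
Proof.
exact: (gactA (veronese_deg e) (veronese_mdeg e1) (veronese_mdeg e2)
  (veronese_mdeg e3) a b x).
Qed.

Lemma veronese_act1 k (e : k + 0%:Z = k) x :
  veronese_act e (aone veroneseAlg) x = x.
Proof.
have e' : n%:Z * k + tau + 0%:Z = n%:Z * k + tau by rewrite addr0.
by rewrite /veronese_act (eq_irrelevance (veronese_mdeg e) e'); exact: gact1.
Qed.

Definition veronese : gmod veroneseAlg :=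
  @GMod K veroneseAlg (fun k => M (n%:Z * k + tau)) veronese_act
    veronese_act_linearl veronese_act_linearr veronese_actA veronese_act1.

End Veronese.

Lemma comp_linear (K : fieldType) (U V W : lmodType K) (g : V -> W)
  (f : U -> V) : linear g -> linear f -> linear (fun x => g (f x)).
Proof. by move=> gl fl c x y; rewrite fl gl. Qed.

Definition segre_space (K : fieldType) (I : finType)
    (V : I -> int -> lmodType K) (n : int) : lmodType K :=
  tensor (fun l => V l n).

Section Segre.
Variables (K : fieldType) (I : finType) (A : I -> galg K).

Local Notation comp n := (tensor (fun l => A l n)).

Definition segre_mul i j k (e : (i + j)%N = k) : comp i -> comp j -> comp k :=
  tmap2 (fun l => amul (g := A l) e).

Definition segre_one : comp 0 := pure (fun l => aone (A l)).

Lemma segre_mul_linearl i j k (e : (i + j)%N = k) b :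
  linear (fun a => segre_mul e a b).
Proof.
by apply: tmap2_linearl => *; [exact: amul_linearl | exact: amul_linearr].
Qed.

Lemma segre_mul_linearr i j k (e : (i + j)%N = k) a :
  linear (segre_mul e a).
Proof.
by apply: tmap2_linearr => *; [exact: amul_linearl | exact: amul_linearr].
Qed.

Lemma segre_mul_pure i j k (e : (i + j)%N = k) a b :
  segre_mul e (pure a) (pure b) = pure (fun l => amul (g := A l) e (a l) (b l)).
Proof.
by apply: tmap2_pure => *; [exact: amul_linearl | exact: amul_linearr].
Qed.

Lemma segre_mulC i j k (e : (i + j)%N = k) (e' : (j + i)%N = k) t u :
  segre_mul e t u = segre_mul e' u t.
Proof.
move: t; apply: tensor_ext => [||a].
- exact: segre_mul_linearl.
- exact: segre_mul_linearr.
move: u; apply: tensor_ext => [||b].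
- exact: segre_mul_linearr.
- exact: segre_mul_linearl.
rewrite !segre_mul_pure; congr pure.
by apply: functional_extensionality_dep => l; exact: amulC.
Qed.

Lemma segre_mulA i j l ij jl k (e1 : (i + j)%N = ij) (e2 : (ij + l)%N = k)
    (e3 : (j + l)%N = jl) (e4 : (i + jl)%N = k) t u w :
  segre_mul e2 (segre_mul e1 t u) w = segre_mul e4 t (segre_mul e3 u w).
Proof.
have L := segre_mul_linearl; have R := segre_mul_linearr.
move: t; apply: tensor_ext => [||a].
- exact: (comp_linear (L _ _ _ e2 w) (L _ _ _ e1 u)).
- exact: L.
move: u; apply: tensor_ext => [||b].
- exact: (comp_linear (L _ _ _ e2 w) (R _ _ _ e1 (pure a))).
- exact: (comp_linear (R _ _ _ e4 (pure a)) (L _ _ _ e3 w)).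
move: w; apply: tensor_ext => [||c].
- exact: R.
- exact: (comp_linear (R _ _ _ e4 (pure a)) (R _ _ _ e3 (pure b))).
rewrite !segre_mul_pure; congr pure.
by apply: functional_extensionality_dep => z; exact: amulA.
Qed.

Lemma segre_mul1 i (e : (0 + i)%N = i) t : segre_mul e segre_one t = t.
Proof.
move: t; apply: tensor_ext => [||a] //; first exact: segre_mul_linearr.
rewrite segre_mul_pure; congr pure.
by apply: functional_extensionality_dep => z; exact: amul1.
Qed.

Definition segreAlg : galg K :=
  GAlg segre_mul_linearl segre_mulC segre_mulA segre_mul1.

Variable M : forall l, gmod (A l).

Definition segre_act i n m (e : n + i%:Z = m) :
    comp i -> segre_space M n -> segre_space M m :=
  tmap2 (fun l => gact (g := M l) e).

Lemma segre_act_linearl i n m (e : n + i%:Z = m) x :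
  linear (fun a => segre_act e a x).
Proof.
by apply: tmap2_linearl => *; [exact: gact_linearl | exact: gact_linearr].
Qed.

Lemma segre_act_linearr i n m (e : n + i%:Z = m) a :
  linear (segre_act e a).
Proof.
by apply: tmap2_linearr => *; [exact: gact_linearl | exact: gact_linearr].
Qed.

Lemma segre_act_pure i n m (e : n + i%:Z = m) a x :
  segre_act e (pure a) (pure x) = pure (fun l => gact (g := M l) e (a l) (x l)).
Proof.
by apply: tmap2_pure => *; [exact: gact_linearl | exact: gact_linearr].
Qed.

Lemma segre_actA i j k n m l (e : (i + j)%N = k) (e1 : n + j%:Z = m)
    (e2 : m + i%:Z = l) (e3 : n + k%:Z = l) t u w :
  segre_act e2 t (segre_act e1 u w) = segre_act e3 (segre_mul e t u) w.
Proof.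
have L := segre_act_linearl; have R := segre_act_linearr.
move: t; apply: tensor_ext => [||a].
- exact: L.
- exact: (comp_linear (L _ _ _ e3 w) (segre_mul_linearl e u)).
move: u; apply: tensor_ext => [||b].
- exact: (comp_linear (R _ _ _ e2 (pure a)) (L _ _ _ e1 w)).
- exact: (comp_linear (L _ _ _ e3 w) (segre_mul_linearr e (pure a))).
move: w; apply: tensor_ext => [||x].
- exact: (comp_linear (R _ _ _ e2 (pure a)) (R _ _ _ e1 (pure b))).
- exact: R.
rewrite segre_mul_pure !segre_act_pure; congr pure.
by apply: functional_extensionality_dep => z; exact: gactA.
Qed.

Lemma segre_act1 n (e : n + 0%:Z = n) t : segre_act e segre_one t = t.
Proof.
move: t; apply: tensor_ext => [||x] //; first exact: segre_act_linearr.
rewrite segre_act_pure; congr pure.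
by apply: functional_extensionality_dep => z; exact: gact1.
Qed.

Definition segre : gmod segreAlg :=
  @GMod K segreAlg (segre_space M) segre_act
    segre_act_linearl segre_act_linearr segre_actA segre_act1.

End Segre.

Section Modules.
Variables (K : fieldType) (A : galg K).

Definition gsubmodule (M : gmod A) (P : forall n, {pred M n}) : Prop :=
  (forall n, submod_closed (P n)) /\
  (forall i n m (e : n + i%:Z = m) (a : A i) (x : M n),
     x \in P n -> gact e a x \in P m).

Definition finitely_generated (M : gmod A) : Prop :=
  exists g : seq {n : int & M n},
    forall P : forall n, {pred M n}, gsubmodule P ->
      (forall t, t \in g -> tagged t \in P (tag t)) ->
      forall n (x : M n), x \in P n.

Record ghom (M N : gmod A) := GHom {
  ghom_fun :> forall n, {linear M n -> N n};
  ghom_act : forall i n m (e : n + i%:Z = m) (a : A i) (x : M n),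
    ghom_fun m (gact e a x) = gact e a (ghom_fun n x)
}.

Definition ginjective (E : gmod A) : Prop :=
  forall (L N : gmod A) (i : ghom L N) (f : ghom L E),
    (forall n, injective (i n)) ->
    exists g : ghom N E, forall n x, g n (i n x) = f n x.

(* Injectivity is tested on graded modules and maps of degree 0; this category *)
(* has enough injectives, so every M has such a resolution.                    *)
Record injres (M : gmod A) := InjRes {
  res : nat -> gmod A;
  res_d : forall j, ghom (res j) (res j.+1);
  res_aug : ghom M (res 0);
  res_ginjective : forall j, ginjective (res j);
  res_aug_inj : forall n, injective (res_aug n);
  res_exact0 : forall n (x : res 0 n),
    res_d 0 n x = 0 <-> exists y, x = res_aug n y;
  res_exactS : forall j n (x : res j.+1 n),
    res_d j.+1 n x = 0 <-> exists y, x = res_d j n y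
}.

(* m^k x = 0, where m is the ideal of the elements of positive degree.        *)
Fixpoint killed (M : gmod A) (k : nat) (n : int) (x : M n) : Prop :=
  if k is k'.+1 then
    forall i m (e : n + i%:Z = m) (a : A i), (0 < i)%N -> killed k' (gact e a x)
  else x = 0.

(* Membership in Gamma_m(M) = H^0_m(M).                                       *)
Definition torsion (M : gmod A) (n : int) (x : M n) : Prop :=
  exists k, killed k x.

Section LocalCohomology.
Variables (M : gmod A) (E : injres M) (j : nat) (n : int).

Definition cocycle_pred : {pred res E j n} :=
  fun x => `[< torsion x /\ res_d E j n x = 0 >].

Lemma cocycle_pred_closed : submod_closed cocycle_pred.
Proof.
have act0 (N : gmod A) i p q (e : p + i%:Z = q) (a : A i) :
    gact e a (0 : N p) = 0.
  by have := gact_linearr (g := N) e a (-1) 0 0; rewrite !scaleN1r !addNr.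
have kill0 (N : gmod A) k p : killed k (0 : N p).
  by elim: k p => //= k IH p i q e a _; rewrite act0.
have killD (N : gmod A) k p c (x y : N p) :
    killed k x -> killed k y -> killed k (c *: x + y).
  elim: k p x y => /= [|k IH] p x y hx hy.
    by rewrite hx hy scaler0 addr0.
  by move=> i q e a i0; rewrite gact_linearr; apply: IH; [exact: hx|exact: hy].
have kill1 (N : gmod A) k p (x : N p) : killed k x -> killed k.+1 x.
  elim: k p x => [|k IH] p x hx i q e a i0; first by rewrite hx act0.
  by apply: IH; exact: hx.
have killS (N : gmod A) k l p (x : N p) : killed k x -> killed (l + k) x.
  by move=> hx; elim: l => // l /kill1.
split=> [|c x y /asboolP[[k kx] dx] /asboolP[[l ly] dy]]; apply/asboolP.
  by split; [exists 0%N | rewrite linear0].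
split; last by rewrite linearP dx dy scaler0 addr0.
exists (k + l)%N; apply: killD; last exact: killS.
by rewrite addnC; exact: killS.
Qed.

HB.instance Definition _ := GRing.isSubmodClosed.Build K (res E j n)
  cocycle_pred (GRing.submod_closed_semi cocycle_pred_closed).

Definition cocycle : Type := {x : res E j n | cocycle_pred x}.

HB.instance Definition _ := [isSub of cocycle for @sval _ _].
HB.instance Definition _ := [Choice of cocycle by <:].
HB.instance Definition _ := [SubChoice_isSubLmodule of cocycle by <:].

Definition coboundary : res E j n -> Prop :=
  match j return res E j n -> Prop with
  | 0 => fun x => x = 0
  | j'.+1 => fun x => exists2 y, torsion y & x = res_d E j' n y
  end.

(* The degree n component of the local cohomology module H^j_m(M), as the     *)
(* j-th right derived functor of Gamma_m computed with the resolution E.      *)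
Definition local_cohomology : lmodType K :=
  lquot (fun z : cocycle => coboundary (val z)).

End LocalCohomology.

End Modules.

Definition nonzero (K : fieldType) (V : lmodType K) : Prop :=
  exists x : V, x != 0.

(* r is the Castelnuovo-Mumford regularity of M: the maximum over j of        *)
(* End(H^j_m(M)) + j is the largest n + j with H^j_m(M)_n <> 0.               *)
Definition is_reg (K : fieldType) (A : galg K) (M : gmod A) (E : injres M)
    (r : int) : Prop :=
  is_max (fun v : int => exists (j : nat) (n : int),
    nonzero (local_cohomology E j n) /\ v = n + j%:Z) r.

Section PolyModules.
Variables (K : fieldType) (r : nat) (M : gmod (polyAlg K r)).

Definition hcomp (p : {mpoly K[r]}) (d : nat) : polyAlg K r d :=
  DHomog (pihomogP mdeg d p).

(* The annihilator of the direct sum of the M n: p kills M iff all its        *)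
(* homogeneous components do.                                                 *)
Definition annihilates (p : {mpoly K[r]}) : Prop :=
  forall d n m (e : n + d%:Z = m) (x : M n), gact e (hcomp p d) x = 0.

Definition prime_chain (l : nat) (P : nat -> {pred {mpoly K[r]}}) : Prop :=
  (forall i, (i <= l)%N ->
     [/\ idealr_closed (P i), prime_idealr_closed (P i)
       & forall p, annihilates p -> p \in P i]) /\
  (forall i, (i < l)%N ->
     {subset P i <= P i.+1} /\ exists2 p, p \in P i.+1 & p \notin P i).

(* Krull dimension of the polynomial ring modulo the annihilator of M.        *)
Definition is_dim (d : nat) : Prop :=
  is_max (fun l : nat => exists P, prime_chain l P) d.

(* Elements of the direct sum of the M n are families with finite support.    *)
Definition finsupp (x : forall n, M n) : Prop :=
  exists b : nat, forall n : int, (b < `|n|)%N -> x n = 0.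

Definition tact (p : {mpoly K[r]}) (x : forall n, M n) (n : int) : M n :=
  \sum_(d < msize p) gact (subrK (d : nat)%:Z n) (hcomp p d) (x (n - d%:Z)).

(* x belongs to (a_1, ..., a_k) M.                                            *)
Definition in_ideal_mul (a : seq {mpoly K[r]}) (x : forall n, M n) : Prop :=
  exists y : nat -> forall n, M n, (forall k, finsupp (y k)) /\
    forall n, x n = \sum_(k < size a) tact a`_k (y k) n.

Definition regular_seq (a : seq {mpoly K[r]}) : Prop :=
  [/\ forall p, p \in a -> p@_0%MM = 0,
      forall k, (k < size a)%N -> forall x, finsupp x ->
        in_ideal_mul (take k a) (tact a`_k x) -> in_ideal_mul (take k a) x
    & exists2 x, finsupp x & ~ in_ideal_mul a x].

Definition is_depth (t : nat) : Prop :=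
  is_max (fun l : nat => exists2 a, size a = l & regular_seq a) t.

Definition cohen_macaulay : Prop := exists2 d, is_dim d & is_depth d.

End PolyModules.

Section C2.
Variables (K : fieldType) (s : nat) (r : 'I_s -> nat).
Variables (M : forall i, gmod (polyAlg K (r i))) (E : forall i, injres (M i)).
Variables (d : 'I_s -> nat) (u : forall i, 'I_(d i).+1).

Definition supp : {pred 'I_s} := [pred i | u i != 0%N :> nat].

Definition Etilde (n : int) : lmodType K :=
  segre_space
    (fun l : {i : 'I_s | i \in supp} => local_cohomology (E (val l)) (u (val l)))
    n.

Definition C2 : Prop :=
  (exists i, i \in supp) /\ exists n, nonzero (Etilde n).

(* v is the value 1 + \sum_(l in Supp u) b_l - \max_(l in Supp u) c_l at u.   *)
Definition is_value (b c : 'I_s -> int) (v : int) : Prop :=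
  exists2 a, is_max (fun x => exists2 l, l \in supp & x = c l) a
           & v = 1 + \sum_(l in supp) b l - a.

End C2.

(* Main.v *)
(* Localizing repeatedly at the variables gives every module N a complex      *)
(* whose terms have partitions of unity by linear forms. Such terms are       *)
(* acyclic for Gamma_m and torsion free, so the cohomology of the complex is  *)
(* the local cohomology of N, shifted by one. For a Cohen-Macaulay module     *)
(* depth and dimension leave a single nonzero cohomology, in position d - 1;  *)
(* Koszul homology shows that it is nonzero exactly in the degrees n with     *)
(* n <= rho - d. Complexes of this kind are stable under Veronese transforms, *)
(* and their total tensor product, cut down to the diagonal degrees, is one   *)
(* for the Segre product; a tensor product of contracting homotopies computes *)
(* its cohomology. In degree n, with U = {l | n <= e_l} for                   *)
(* e_l = rho_l - d_l, the last nonzero local cohomology is in position        *)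
(* 1 + \sum_(l in U) b_l as soon as U is nonempty and N_l is nonzero in       *)
(* degree n for l outside U. Maximizing over n gives the formula.             *)

Require Import Defs.
From HB Require Import structures.
From mathcomp Require Import all_boot all_order all_algebra.
From mathcomp Require Import boolp classical_sets.
From mathcomp Require Import freeg mpoly zify.

Set Implicit Arguments.
Unset Strict Implicit.
Unset Printing Implicit Defensive.

Import Order.TTheory GRing.Theory Num.Theory.

Local Open Scope ring_scope.

(** * Linear algebra *)

(** A module [X] has a partition of unity when its identity is a finite sum of maps [f_c g_c], with
    [f_c] a linear form and [g_c] a module map of degree -1. Then [X] has no torsion and no higher
    local cohomology, because a torsion class [y] is rebuilt from the elements [f_c y], which die
    under a smaller power of the irrelevant ideal. Hence ([lc_vanish_complex]), if
    [N -> X_0 -> X_1 -> ...] is a complex of such modules, injective at [N], whose cohomology is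
    torsion and bounded above, then the local cohomology [H^{i+1}(N)] vanishes in degree [n] exactly
    when the complex is exact at [X_i] in degree [n].

    Over a polynomial ring such a complex is obtained by iterating [Y |-> D / Y], where [D] is the
    product of the localizations of [Y] at the variables. Starting from [Y_0 = M], the torsion of
    [Y_j] is [H^j(M)]. For a Cohen-Macaulay [M] of dimension [d] only [j = d] survives: a maximal
    regular sequence kills the cohomology below [d] ([koszul_vanish_lt_depth]), Grothendieck
    vanishing kills it above ([koszul_vanish_gt_dim]). Both are proved for colimits of Koszul
    complexes on powers of the variables, and [koszul_vanish_link] carries the vanishing from [Y_j]
    to [Y_{j+1}]. Koszul homology, followed degree by degree, shows that [H^d(M)] is nonzero in
    every degree up to [rho - d] ([torsionless_up]) and that [M] is nonzero in every degree from
    [rho] on ([torsionless_initial]). The predicate [cmres] records all this, with [b = d - 1] and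
    [e = rho - d].

    Veronese transforms preserve [cmres], the bound [e] becoming the ceiling expression
    ([cmres_veronese]). For a Segre product one takes the diagonal degrees of the total tensor
    product of the complexes. Contracting homotopies and product functionals give a Künneth
    computation ([segre_local_cohomology]): in degree [n], with [U] the set of [l] such that
    [n <= e_l], nonzero local cohomology needs [U] nonempty and sits in position at most
    [1 + \sum_(l in U) b_l]. That position is attained if [N_l] is nonzero in degree [n] for every
    [l] outside [U].

    So the regularity is the maximum over [l] of [e_l + 1 + \sum_(e_i >= e_l) b_i] ([score]),
    attained at a best [l] with least [e_l] ([segre_reg]). The maximum over [C_2] is the same
    number, since [u] lies in [C_2] exactly when its support is nonempty and [u_i = d_i] there
    ([C2E], [score_max]). *)

Section LinPack.
Variables (K : fieldType) (U V : lmodType K) (f : U -> V) (fl : linear f).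
Definition lin_fun : U -> V := f.
HB.instance Definition _ := GRing.isLinear.Build K U V _ lin_fun fl.
Definition linpack : {linear U -> V} := lin_fun.
End LinPack.
Arguments lin_fun {K U V} f _ /.

Section LinearFacts.
Variables (K : fieldType) (U V : lmodType K) (f : U -> V).
Hypothesis fl : linear f.

Lemma lin0 : f 0 = 0. Proof. exact: (raddf0 (linpack fl)). Qed.
Lemma linD x y : f (x + y) = f x + f y. Proof. exact: (raddfD (linpack fl)). Qed.
Lemma linB x y : f (x - y) = f x - f y. Proof. exact: (raddfB (linpack fl)). Qed.
Lemma linN x : f (- x) = - f x. Proof. exact: (raddfN (linpack fl)). Qed.
Lemma linS (I : Type) (r : seq I) (P : pred I) (E : I -> U) :
  f (\sum_(i <- r | P i) E i) = \sum_(i <- r | P i) f (E i).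
Proof. exact: (raddf_sum (linpack fl)). Qed.

End LinearFacts.

Section Dprod.
Variables (K : fieldType) (J : Type) (V : J -> lmodType K).

Definition dprod : Type := forall j, V j.
HB.instance Definition _ := Choice.on dprod.

Let add (x y : dprod) : dprod := fun j => x j + y j.
Let opp (x : dprod) : dprod := fun j => - x j.
Let zero : dprod := fun j => 0.
Let scale (c : K) (x : dprod) : dprod := fun j => c *: x j.

Fact dprod_addA : associative add.
Proof. by move=> x y z; apply/functional_extensionality_dep => j; rewrite /add addrA. Qed.
Fact dprod_addC : commutative add.
Proof. by move=> x y; apply/functional_extensionality_dep => j; rewrite /add addrC. Qed.
Fact dprod_add0 : left_id zero add.
Proof. by move=> x; apply/functional_extensionality_dep => j; rewrite /add add0r. Qed.
Fact dprod_addN : left_inverse zero opp add.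
Proof. by move=> x; apply/functional_extensionality_dep => j; rewrite /add addNr. Qed.
HB.instance Definition _ :=
  GRing.isZmodule.Build dprod dprod_addA dprod_addC dprod_add0 dprod_addN.

Fact dprod_scaleA a b x : scale a (scale b x) = scale (a * b) x.
Proof. by apply/functional_extensionality_dep => j; rewrite /scale scalerA. Qed.
Fact dprod_scale1 : left_id 1 scale.
Proof. by move=> x; apply/functional_extensionality_dep => j; rewrite /scale scale1r. Qed.
Fact dprod_scaleDr : right_distributive scale +%R.
Proof. by move=> c x y; apply/functional_extensionality_dep => j; rewrite /scale scalerDr. Qed.
Fact dprod_scaleDl x : {morph scale^~ x : a b / a + b}.
Proof. by move=> a b; apply/functional_extensionality_dep => j; rewrite /scale scalerDl. Qed.
HB.instance Definition _ := GRing.Zmodule_isLmodule.Build K dprod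
  dprod_scaleA dprod_scale1 dprod_scaleDr dprod_scaleDl.

Lemma dprodD (x y : dprod) j : (x + y) j = x j + y j. Proof. by []. Qed.
Lemma dprodN (x : dprod) j : (- x) j = - x j. Proof. by []. Qed.
Lemma dprod0 j : (0 : dprod) j = 0. Proof. by []. Qed.
Lemma dprodZ c (x : dprod) j : (c *: x) j = c *: x j. Proof. by []. Qed.
Definition dprodE := (dprodD, dprodN, dprod0, dprodZ).
End Dprod.

Section Subm.
Variables (K : fieldType) (V : lmodType K) (P : {pred V}).
Hypothesis hP : submod_closed P.

Definition subm_pred of submod_closed P : {pred V} := P.
HB.instance Definition _ := GRing.isSubmodClosed.Build K V
  (subm_pred hP) (GRing.submod_closed_semi hP).

Definition subm : Type := {x : V | subm_pred hP x}.
HB.instance Definition _ := [isSub of subm for @sval _ _].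
HB.instance Definition _ := [Choice of subm by <:].
HB.instance Definition _ := [SubChoice_isSubLmodule of subm by <:].

Definition Subm (x : V) (Px : x \in P) : subm := exist _ x Px.
Lemma subm_val_linear : linear (val : subm -> V).
Proof. by move=> c x y; rewrite linearP. Qed.
Lemma submP (x : subm) : val x \in P. Proof. exact: valP x. Qed.
End Subm.

Section Projection.
Variables (K : fieldType) (V : lmodType K).

Section Complement.
Variables (P : {pred V}) (hP : submod_closed P).

Let good (Q : {pred V}) := submod_closed Q /\ (forall v, v \in P -> v \in Q -> v = 0).
Let T := {Q : {pred V} | `[< good Q >]}.
Let mk (Q : {pred V}) (gQ : good Q) : T :=
  @exist _ (fun Q0 : {pred V} => `[< good Q0 >]) Q (asboolT gQ).
Let R (Q1 Q2 : T) : bool := `[< {subset sval Q1 <= sval Q2} >].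

(** Zorn's lemma on the subspaces that meet [P] trivially: if [v] were outside [P + Q], a maximal
    [Q] could be enlarged by [v]. *)
Lemma subspace_complement : exists Q : {pred V},
  [/\ submod_closed Q, forall v, v \in P -> v \in Q -> v = 0 &
      forall v, exists2 p, p \in P & v - p \in Q].
Proof.
have [Q Qmax] : exists t : T, forall s : T, R t s -> s = t.
  apply: Zorn.
  - by move=> t; apply/asboolP.
  - by move=> r s t /asboolP rs /asboolP st; apply/asboolP => v /rs /st.
  - move=> [s hs] [t ht] /asboolP /= st /asboolP /= ts.
    have E : s = t by apply/funext => v; apply/idP/idP => [/st|/ts].
    by subst t; rewrite (Prop_irrelevance hs ht).
  - move=> A Atot.
    have [[Q0 AQ0]|A0] := pselect (exists t, A t); last first.
      (* The empty chain is bounded by the zero subspace. *)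
      have g0 : good (pred1 0).
        split; last by move=> v _ /eqP.
        by split; [rewrite unfold_in /= | move=> c x y /eqP -> /eqP ->; rewrite scaler0 addr0 unfold_in /=].
      exists (mk g0) => s As; case: A0; by exists s.
    pose U : {pred V} := fun v => `[< exists2 t, A t & v \in sval t >].
    have gU : good U.
      split; last by move=> v Pv /asboolP[t At vt]; have /asboolP[_] := svalP t; exact.
      split; first by apply/asboolP; exists Q0 => //; have /asboolP[[]] := svalP Q0.
      move=> c x y /asboolP[t At xt] /asboolP[s As ys]; apply/asboolP.
      case: (Atot _ _ At As) => /asboolP h.
        exists s => //; have /asboolP[[_ hs] _] := svalP s.
        by apply: hs; [exact: (h _ xt) | exact: ys].
      exists t => //; have /asboolP[[_ hs] _] := svalP t.
      by apply: hs; [exact: xt | exact: (h _ ys)].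
    exists (mk gU) => s As; apply/asboolP => v vs /=.
    by apply/asboolP; exists s.
have /asboolP[[Q0 Qlin] QP] := svalP Q.
exists (sval Q); split=> // v; apply: contrapT => nv.
have [P0 Plin] := hP.
have ZP c x : x \in P -> c *: x \in P by move=> ?; rewrite -[_ *: _]addr0; apply: Plin.
have ZQ c x : x \in sval Q -> c *: x \in sval Q by move=> ?; rewrite -[_ *: _]addr0; apply: Qlin.
(* [Q'] is [Q + K v]. It still meets [P] trivially, as a nonzero coefficient of [v] would put [v] in
   [P + Q]. *)
pose Q' : {pred V} := fun w => `[< exists c, w - c *: v \in sval Q >].
have gQ' : good Q'.
  split.
    split; first by apply/asboolP; exists 0; rewrite scale0r subr0.
    move=> c x y /asboolP[a ha] /asboolP[b hb]; apply/asboolP; exists (c * a + b).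
    rewrite scalerDl opprD addrACA -scalerA -scalerBr; exact: Qlin.
  move=> w Pw /asboolP[c hc].
  have [c0|c0] := eqVneq c 0; first by rewrite c0 scale0r subr0 in hc; exact: QP.
  case: nv; exists (c^-1 *: w); first exact: ZP.
  have := ZQ (- c^-1) _ hc; rewrite scalerBr !scaleNr opprK scalerA mulVf // scale1r.
  by rewrite addrC.
have := Qmax (mk gQ').
have RQ : R Q (mk gQ').
  by apply/asboolP => w /= Qw; apply/asboolP; exists 0; rewrite scale0r subr0.
move/(_ RQ)/(congr1 sval) => /= E; case: nv; exists 0 => //.
rewrite subr0 -E; apply/asboolP; exists 1; by rewrite scale1r subrr.
Qed.

Lemma projection : exists2 p : V -> V, linear p &
  (forall v, p v \in P) /\ (forall v, v \in P -> p v = v).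
Proof.
have [Q [[Q0 Ql] QP PQ]] := subspace_complement; have [P0 Pl] := hP.
pose p v := sval (cid2 (PQ v)).
have p1 v : p v \in P by rewrite /p; case: cid2.
have p2 v : v - p v \in Q by rewrite /p; case: cid2.
have PB x y : x \in P -> y \in P -> x - y \in P.
  by move=> hx hy; rewrite addrC -scaleN1r; exact: Pl.
have QB x y : x \in Q -> y \in Q -> x - y \in Q.
  by move=> hx hy; rewrite addrC -scaleN1r; exact: Ql.
have pu v w : w \in P -> v - w \in Q -> p v = w.
  move=> Pw Qw; apply/eqP; rewrite -subr_eq0; apply/eqP/QP; first exact: PB.
  have := QB _ _ Qw (p2 v); rewrite opprB addrC addrA subrK.
  by [].
exists p.
  move=> c x y; apply: pu; first exact: Pl.
  have := Ql c _ _ (p2 x) (p2 y); rewrite scalerBr addrACA -opprD; by [].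
by split=> // v Pv; apply: pu => //; rewrite subrr.
Qed.
End Complement.

Lemma functional (P : {pred V}) (v : V) : submod_closed P -> v \notin P ->
  exists2 f : V -> K^o, linear f & f v = 1 /\ forall w, w \in P -> f w = 0.
Proof.
move=> hP Pv; have [p pl [p1 p2]] := projection hP.
pose w := v - p v.
have w0 : w != 0.
  by apply: contraNneq Pv => /eqP; rewrite subr_eq0 => /eqP ->.
have hL : submod_closed (fun x => `[< exists c, x = c *: w >]).
  split; first by apply/asboolP; exists 0; rewrite scale0r.
  move=> c x y /asboolP[a ->] /asboolP[b ->]; apply/asboolP; exists (c * a + b).
  by rewrite scalerDl scalerA.
have [q ql [q1 q2]] := projection hL.
have qE x : exists c, q x = c *: w by have /asboolP := q1 x.
pose f x : K^o := sval (cid (qE x)).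
have fE x : q x = f x *: w by rewrite /f; case: cid.
have fu x (c : K) : q x = c *: w -> f x = c.
  by rewrite fE => /eqP; rewrite -subr_eq0 -scalerBl scaler_eq0 (negPf w0) orbF subr_eq0 => /eqP.
have fl : linear f.
  by move=> c x y; apply: fu; rewrite ql !fE scalerDl scalerA.
pose g x := f (x - p x).
exists g.
  move=> c x y; rewrite /g -fl; congr f.
  by rewrite pl scalerBr addrACA opprD.
split; last by move=> x /p2 h; rewrite /g h subrr (lin0 fl).
apply: fu; rewrite -/w scale1r q2 //; apply/asboolP; exists 1; by rewrite scale1r.
Qed.
End Projection.

Section Extension.
Variables (K : fieldType) (U V W : lmodType K).

Lemma lin_image_closed (i : U -> V) : linear i ->
  submod_closed (fun v => `[< exists u, v = i u >]).
Proof.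
move=> il; split; first by apply/asboolP; exists 0; rewrite (lin0 il).
by move=> c x y /asboolP[a ->] /asboolP[b ->]; apply/asboolP; exists (c *: a + b); rewrite il.
Qed.

Lemma lin_ker_closed (i : U -> V) : linear i ->
  submod_closed (fun u => i u == 0).
Proof.
move=> il; split; first by rewrite unfold_in (lin0 il).
by move=> c x y /eqP hx /eqP hy; rewrite unfold_in il hx hy scaler0 addr0.
Qed.

Lemma lin_retract (i : U -> V) : linear i -> injective i ->
  exists2 r : V -> U, linear r & cancel i r.
Proof.
move=> il iinj; have [p pl [p1 p2]] := projection (lin_image_closed il).
have pE v : exists u, p v = i u by have /asboolP := p1 v.
pose r v := sval (cid (pE v)).
have rE v : p v = i (r v) by rewrite /r; case: cid.
exists r; first by move=> c x y; apply: iinj; rewrite il -!rE pl.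
by move=> u; apply: iinj; rewrite -rE p2 //; apply/asboolP; exists u.
Qed.

Lemma lin_section (f : U -> V) : linear f -> (forall v, exists u, f u = v) ->
  exists2 s : V -> U, linear s & cancel s f.
Proof.
move=> fl fs; have [p pl [p1 p2]] := projection (lin_ker_closed fl).
pose s0 v := sval (cid (fs v)).
have s0E v : f (s0 v) = v by rewrite /s0; case: cid.
have kp u : f (p u) = 0 by have /eqP := p1 u.
have pB x y : f x = f y -> x - p x = y - p y.
  move=> h; have k : f (x - y) = 0 by rewrite (linB fl) h subrr.
  have : p (x - y) = x - y by apply: p2; rewrite unfold_in k.
  rewrite (linB pl) => e; have ex : x = p x - p y + y by rewrite e subrK.
  by rewrite {1}ex [p x - p y]addrC -!addrA [p x + _]addrCA subrr addr0 addrC.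
pose s v := s0 v - p (s0 v).
exists s; last by move=> v; rewrite /s (linB fl) kp subr0 s0E.
move=> c x y; rewrite /s (pB _ (c *: s0 x + s0 y)); last by rewrite fl !s0E.
by rewrite pl scalerBr addrACA opprD.
Qed.

Lemma lin_extend (i : U -> V) (f : U -> W) : linear i -> injective i -> linear f ->
  exists2 g : V -> W, linear g & forall u, g (i u) = f u.
Proof.
move=> il iinj fl; have [r rl rK] := lin_retract il iinj.
by exists (f \o r) => [c x y|u] /=; rewrite ?rl ?fl ?rK.
Qed.
End Extension.

(** * Graded modules: kernels, quotients, products, injectives *)

Lemma span_id (R : pzRingType) (V : lmodType R) (P : {pred V}) :
  submod_closed P -> Defs.span (fun x => x \in P) =i P.
Proof.
move=> hP x; apply/idP/idP => [/asboolP h|h]; first exact: h.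
exact: mem_span.
Qed.

Section GmodBasics.
Variables (K : fieldType) (A : galg K).
Implicit Types (M N L : gmod A).

Lemma gact_irr M i n m (e e' : n + i%:Z = m) (a : A i) (x : M n) :
  gact e a x = gact e' a x.
Proof. by rewrite (eq_irrelevance e e'). Qed.

Lemma gact0 M i n m (e : n + i%:Z = m) (a : A i) : gact e a (0 : M n) = 0.
Proof. exact: lin0 (gact_linearr e a). Qed.

Lemma gact0l M i n m (e : n + i%:Z = m) (x : M n) : gact e (0 : A i) x = 0.
Proof. exact: lin0 (gact_linearl e x). Qed.

Lemma ghom_linear M N (f : ghom M N) n : linear (f n).
Proof. exact: linearP. Qed.

Definition mkhom M N (f : forall n, M n -> N n) (fl : forall n, linear (f n))
    (fa : forall i n m (e : n + i%:Z = m) (a : A i) x,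
      f m (gact e a x) = gact e a (f n x)) : ghom M N :=
  @GHom K A M N (fun n => linpack (fl n)) fa.

Definition gid M : ghom M M.
Proof. by refine (@mkhom M M (fun n x => x) _ _). Defined.

Definition gcompo M N L (g : ghom N L) (f : ghom M N) : ghom M L.
Proof.
refine (@mkhom M L (fun n x => g n (f n x)) _ _).
  by move=> n c x y; rewrite !linearP.
by move=> i n m e a x; rewrite !ghom_act.
Defined.

Definition gadd M N (g f : ghom M N) : ghom M N.
Proof.
refine (@mkhom M N (fun n x => g n x + f n x) _ _).
  by move=> n c x y; rewrite !linearP scalerDr addrACA.
by move=> i n m e a x; rewrite !ghom_act (linD (gact_linearr e a)).
Defined.

Definition gopp M N (f : ghom M N) : ghom M N.
Proof.
refine (@mkhom M N (fun n x => - f n x) _ _).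
  by move=> n c x y; rewrite (ghom_linear f) opprD scalerN.
by move=> i n m e a x; rewrite !ghom_act (linN (gact_linearr e a)).
Defined.

Definition gzero M N : ghom M N.
Proof.
refine (@mkhom M N (fun n x => 0) _ _).
  by move=> n c x y; rewrite scaler0 addr0.
by move=> i n m e a x; rewrite gact0.
Defined.

Fact shift_deg (t n : int) (i : nat) m (e : n + i%:Z = m) : n + t + i%:Z = m + t.
Proof. by rewrite -e addrAC. Qed.

Definition shift M (t : int) : gmod A.
Proof.
refine (@GMod K A (fun n => M (n + t)) (fun i n m e => gact (shift_deg t e)) _ _ _ _).
- by move=> i n m e x; exact: gact_linearl.
- by move=> i n m e a; exact: gact_linearr.
- by move=> *; exact: gactA.
- move=> n e x; have e' : n + t + 0%:Z = n + t by rewrite addr0.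
  by rewrite (gact_irr _ e') gact1.
Defined.

Definition gshift M N (f : ghom M N) t : ghom (shift M t) (shift N t).
Proof.
refine (@mkhom (shift M t) (shift N t) (fun n (x : M (n + t)) => f (n + t) x) _ _).
  by move=> n; exact: (ghom_linear f).
by move=> i n m e a x; exact: (ghom_act f).
Defined.

Section Gprod.
Variables (J : Type) (F : J -> gmod A).
Definition gprod : gmod A.
Proof.
refine (@GMod K A (fun n => dprod (fun j => F j n))
  (fun i n m e a x => (fun j => gact e a (x j)) : dprod (fun j => F j m)) _ _ _ _).
- move=> i n m e x c a b; apply/functional_extensionality_dep => j.
  by rewrite !dprodE gact_linearl.
- move=> i n m e a c x y; apply/functional_extensionality_dep => j.
  by rewrite !dprodE gact_linearr.
- move=> *; apply/functional_extensionality_dep => j; exact: gactA.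
- move=> *; apply/functional_extensionality_dep => j; exact: gact1.
Defined.

Definition gproj j : ghom gprod (F j).
Proof. by refine (@mkhom gprod (F j) (fun n x => x j) _ _). Defined.

Definition gtuple M (f : forall j, ghom M (F j)) : ghom M gprod.
Proof.
refine (@mkhom M gprod (fun n x => fun j => f j n x) _ _).
  by move=> n c x y; apply/functional_extensionality_dep => j; rewrite linearP.
by move=> *; apply/functional_extensionality_dep => j; rewrite ghom_act.
Defined.
End Gprod.

Definition gpair M N : gmod A := gprod (fun b : bool => if b then M else N).
Definition mkpair M N n (x : M n) (y : N n) : gpair M N n :=
  fun b => if b as b return (if b then M else N) n then x else y.

Definition gfst M N : ghom (gpair M N) M := gproj (fun b : bool => if b then M else N) true.
Definition gsnd M N : ghom (gpair M N) N := gproj (fun b : bool => if b then M else N) false.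
Definition gpairing L M N (f : ghom L M) (g : ghom L N) : ghom L (gpair M N) :=
  @gtuple bool (fun b => if b then M else N) L
   (fun b => if b as b return ghom L (if b then M else N) then f else g).

Lemma gpair_eq M N n (x y : gpair M N n) :
  gfst M N n x = gfst M N n y -> gsnd M N n x = gsnd M N n y -> x = y.
Proof.
by move=> h1 h2; apply/functional_extensionality_dep => -[].
Qed.

Section Gsub.
Variables (M : gmod A) (P : forall n, {pred M n}) (hP : gsubmodule P).
Arguments P : clear implicits.

Definition gsub : gmod A.
Proof.
refine (@GMod K A (fun n => subm (proj1 hP n))
  (fun i n m e a x => Subm (proj1 hP m) (proj2 hP _ _ _ e a _ (submP x))) _ _ _ _).
- by move=> i n m e x c a b; apply: val_inj; rewrite [RHS]linearP /=; exact: gact_linearl.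
- by move=> i n m e a c x y; apply: val_inj; rewrite [RHS]linearP /= -gact_linearr; congr gact; exact: linearP.
- by move=> *; apply: val_inj; exact: gactA.
- by move=> *; apply: val_inj; exact: gact1.
Defined.

Definition gincl : ghom gsub M.
Proof.
refine (@mkhom gsub M (fun n (x : subm (proj1 hP n)) => val x) _ _).
  by move=> n; exact: subm_val_linear.
by [].
Defined.

Lemma gincl_inj n : injective (gincl n).
Proof. exact: val_inj. Qed.

Lemma gincl_in n x : gincl n x \in P n.
Proof. exact: submP. Qed.

Lemma gincl_surj n y : y \in P n -> exists x, gincl n x = y.
Proof. by move=> Py; exists (Subm (proj1 hP n) Py). Qed.
End Gsub.

Section Gquot.
Variables (M : gmod A) (P : forall n, {pred M n}) (hP : gsubmodule P).
Arguments P : clear implicits.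

Let q n := lquot (fun x : M n => x \in P n).
Let qpi n (x : M n) : q n := lquot_pi (fun x : M n => x \in P n) x.

Fact qpi_eq n (x y : M n) : (qpi x = qpi y) <-> (x - y \in P n).
Proof.
case: (hP) => P1 _; rewrite -(span_id (P1 n)) -lquot_eq; by split=> /eqP.
Qed.
Fact qpi_surj n (y : q n) : exists x, qpi x = y.
Proof. by exists (lquot_repr y); exact: lquot_reprK. Qed.
Fact qpi_lin n : linear (@qpi n). Proof. exact: lquot_pi_is_linear. Qed.

Let qact i n m (e : n + i%:Z = m) (a : A i) (y : q n) : q m :=
  qpi (gact e a (lquot_repr y)).
Let qactE i n m (e : n + i%:Z = m) (a : A i) (x : M n) : qact e a (qpi x) = qpi (gact e a x).
Proof.
apply/qpi_eq; rewrite -(linB (gact_linearr e a)); case: (hP) => _; apply.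
by apply/qpi_eq; exact: lquot_reprK.
Qed.

Definition gquot : gmod A.
Proof.
refine (@GMod K A q qact _ _ _ _).
- by move=> i n m e x c a b; have [y <-] := qpi_surj x; rewrite !qactE gact_linearl qpi_lin.
- move=> i n m e a c x y; have [x' <-] := qpi_surj x; have [y' <-] := qpi_surj y.
  by rewrite -qpi_lin !qactE gact_linearr qpi_lin.
- move=> i j k n m l e e1 e2 e3 a b x; have [x' <-] := qpi_surj x.
  by rewrite !qactE (gactA e e1 e2 e3).
- by move=> n e x; have [x' <-] := qpi_surj x; rewrite qactE gact1.
Defined.

Definition gpi : ghom M gquot.
Proof.
refine (@mkhom M gquot (fun n => @qpi n) _ _); first by move=> n; exact: qpi_lin.
by move=> i n m e a x; rewrite /= qactE.
Defined.

Lemma gpi_eq n x y : (gpi n x = gpi n y) <-> (x - y \in P n).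
Proof. exact: qpi_eq. Qed.
Lemma gpi_eq0 n x : (gpi n x = 0) <-> (x \in P n).
Proof. by rewrite -(linear0 (gpi n)) gpi_eq subr0. Qed.
Lemma gpi_surj n y : exists x, gpi n x = y.
Proof. exact: qpi_surj. Qed.
End Gquot.

Definition gsurj M N (f : ghom M N) := forall n y, exists x, f n x = y.
Definition gmono M N (f : ghom M N) := forall n, injective (f n).

Lemma gmono0 M N (f : ghom M N) : (forall n x, f n x = 0 -> x = 0) -> gmono f.
Proof.
move=> h n x y e; apply/eqP; rewrite -subr_eq0; apply/eqP/h.
by rewrite linearB e subrr.
Qed.

Lemma gmono_eq0 M N (f : ghom M N) : gmono f -> forall n x, f n x = 0 -> x = 0.
Proof. by move=> h n x e; apply: h; rewrite e linear0. Qed.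

Lemma gfactor M N L (p : ghom M N) (g : ghom M L) : gsurj p ->
  (forall n x, p n x = 0 -> g n x = 0) ->
  exists h : ghom N L, forall n x, h n (p n x) = g n x.
Proof.
move=> ps pg; pose s n y := sval (cid (ps n y)).
have sE n y : p n (s n y) = y by rewrite /s; case: cid.
pose h n y := g n (s n y).
have hE n x : h n (p n x) = g n x.
  apply/eqP; rewrite -subr_eq0 -linearB; apply/eqP/pg.
  by rewrite linearB sE subrr.
have hl n : linear (h n).
  by move=> c x y; rewrite -[x]sE -[y]sE -linearP !hE linearP.
have ha i n m (e : n + i%:Z = m) (a : A i) x : h m (gact e a x) = gact e a (h n x).
  by rewrite -[x]sE -ghom_act !hE ghom_act.
by exists (mkhom hl ha).
Qed.

Lemma glift M N L (i : ghom M N) (g : ghom L N) : gmono i ->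
  (forall n x, exists y, g n x = i n y) ->
  exists h : ghom L M, forall n x, i n (h n x) = g n x.
Proof.
move=> im ig; pose h n y := sval (cid (ig n y)).
have hE n y : i n (h n y) = g n y by rewrite /h; case: cid.
have hl n : linear (h n).
  by move=> c x y; apply: im; rewrite linearP !hE linearP.
have ha k n m (e : n + k%:Z = m) (a : A k) x : h m (gact e a x) = gact e a (h n x).
  by apply: im; rewrite ghom_act !hE ghom_act.
by exists (mkhom hl ha).
Qed.

Lemma gker_sub M N (f : ghom M N) :
  gsubmodule (fun n (x : M n) => f n x == 0).
Proof.
split=> [n|i n m e a x /eqP fx]; first exact: (lin_ker_closed (ghom_linear f (n:=n))).
by rewrite unfold_in ghom_act fx gact0.
Qed.

Lemma gim_sub M N (f : ghom M N) :
  gsubmodule (fun n (y : N n) => `[< exists x, y = f n x >]).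
Proof.
split=> [n|i n m e a x /asboolP[y ->]]; first exact: (lin_image_closed (ghom_linear f (n:=n))).
by apply/asboolP; exists (gact e a y); rewrite ghom_act.
Qed.

Record ses L M N (i : ghom L M) (p : ghom M N) : Prop := Ses {
  ses_mono : gmono i;
  ses_surj : gsurj p;
  ses_pi : forall n x, p n (i n x) = 0;
  ses_ex : forall n y, p n y = 0 -> exists x, y = i n x
}.

Lemma ses_coker L M (i : ghom L M) : gmono i ->
  exists N (p : ghom M N), ses i p.
Proof.
move=> im; exists (gquot (gim_sub i)), (gpi (gim_sub i)); split=> //.
- exact: gpi_surj.
- by move=> n x; apply/gpi_eq0/asboolP; exists x.
- by move=> n y /gpi_eq0/asboolP.
Qed.

Lemma ses_ker M N (p : ghom M N) : gsurj p ->
  exists L (i : ghom L M), ses i p.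
Proof.
move=> ps; exists (gsub (gker_sub p)), (gincl (gker_sub p)); split=> //.
- exact: gincl_inj.
- by move=> n x; apply/eqP; have := gincl_in x.
- move=> n y py; have [|x <-] := @gincl_surj _ _ (gker_sub p) n y.
    by rewrite unfold_in py.
  by exists x.
Qed.

(** * Coinduced modules and enough injectives *)

Section Coind.
Variable T : gmod A.

(** Ambient space of the graded module of K-linear maps from [A] to [T]. Targets are indexed by all
    [p] with a proof of [m + k = p], which avoids transport between components. *)
Let V (m : int) : lmodType K := dprod (fun k : nat => dprod (fun p : int =>
  dprod (fun e : m + k%:Z = p => dprod (fun a : A k => T p)))).
Let P m : {pred (V m)} := fun phi => `[< forall k p e, linear (phi k p e : A k -> T p) >].

Arguments P : clear implicits.
Fact coind_closed m : submod_closed (P m).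
Proof.
split; first by apply/asboolP => k p e c x y; rewrite !dprodE scaler0 addr0.
move=> c x y /asboolP hx /asboolP hy; apply/asboolP => k p e d a b.
by rewrite !dprodE hx hy !scalerDr !scalerA [d * c]mulrC addrACA.
Qed.

Fact coind_deg (i k : nat) (n m p : int) :
  n + i%:Z = m -> m + k%:Z = p -> n + (k + i)%N%:Z = p.
Proof. by move=> <- <-; rewrite PoszD addrA addrAC. Qed.

Let act i n m (e : n + i%:Z = m) (a : A i) (phi : V n) : V m :=
  fun k p e' b => phi (k + i)%N p (coind_deg e e') (amul (erefl (k + i)%N) b a).

Fact coind_act i n m (e : n + i%:Z = m) (a : A i) (phi : V n) :
  phi \in P n -> act e a phi \in P m.
Proof.
move=> /asboolP hp; apply/asboolP => k p e' c x y.
by rewrite /act amul_linearl hp.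
Qed.

Fact coind_tr m (phi : V m) k k' p (e : m + k%:Z = p) (e' : m + k'%:Z = p)
  i j (h : (i + j)%N = k) (h' : (i + j)%N = k') u v :
  phi k p e (amul h u v) = phi k' p e' (amul h' u v).
Proof. by subst k k'; rewrite (eq_irrelevance e e'). Qed.

Definition coind : gmod A.
Proof.
refine (@GMod K A (fun m => subm (coind_closed m))
  (fun i n m e a x => Subm (coind_closed m) (coind_act e a (submP x))) _ _ _ _).
- move=> i n m e x c a b; apply: val_inj; rewrite [RHS]linearP /=.
  have /asboolP hx := submP x.
  do 4 (apply/functional_extensionality_dep => ?).
  by rewrite !dprodE /act amul_linearr hx.
- move=> i n m e a c x y; apply: val_inj; rewrite [RHS]linearP /=.
  transitivity (act e a (c *: val x + val y)); first by congr act; exact: linearP.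
  by do 4 (apply/functional_extensionality_dep => ?); rewrite !dprodE.
- move=> i j k n m l e e1 e2 e3 a b x; apply: val_inj => /=.
  apply/functional_extensionality_dep => q; apply/functional_extensionality_dep => p.
  apply/functional_extensionality_dep => e'; apply/functional_extensionality_dep => c.
  rewrite /act; have e4 : (q + k)%N = (q + i + j)%N by rewrite -e addnA.
  rewrite (amulA _ _ e e4); exact: coind_tr.
- move=> n e x; apply: val_inj => /=.
  apply/functional_extensionality_dep => q; apply/functional_extensionality_dep => p.
  apply/functional_extensionality_dep => e'; apply/functional_extensionality_dep => c.
  rewrite /act; transitivity (val x q p e' (amul (addn0 q) c (aone A))).
    exact: coind_tr.
  by rewrite (amulC _ (add0n q)) amul1.
Defined.

Fact coind_unit_in n (x : T n) : ((fun k p e a => gact e a x) : V n) \in P n.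
Proof. by apply/asboolP => k p e; exact: gact_linearl. Qed.

Definition coind_unit : ghom T coind.
Proof.
refine (@mkhom T coind (fun n x => Subm (coind_closed n) (coind_unit_in x)) _ _).
  move=> n c x y; apply: val_inj; rewrite [RHS]linearP /=.
  by do 4 (apply/functional_extensionality_dep => ?); rewrite !dprodE gact_linearr.
move=> i n m e a x; apply: val_inj => /=.
apply/functional_extensionality_dep => q; apply/functional_extensionality_dep => p.
apply/functional_extensionality_dep => e'; apply/functional_extensionality_dep => c.
exact: gactA.
Defined.

Lemma coind_unit_mono : gmono coind_unit.
Proof.
move=> n x y /(congr1 val) /= h.
have := congr1 (fun f : V n => f 0%N n (addr0 n) (aone A)) h.
by rewrite /= !gact1.
Qed.

(** An element of degree [n] takes values in degrees at least [n] of [T]. So a module bounded above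
    embeds in an injective with the same bound. *)
Lemma coind_bounded (c : int) : (forall n, c < n -> forall x : T n, x = 0) ->
  forall n, c < n -> forall x : coind n, x = 0.
Proof.
move=> h n cn x; apply: val_inj => /=.
apply/functional_extensionality_dep => q; apply/functional_extensionality_dep => p.
apply/functional_extensionality_dep => e'; apply/functional_extensionality_dep => a.
by apply: h; rewrite -e'; apply: lt_le_trans cn _; rewrite lerDl.
Qed.

(** Adjunction: a module map into [coind] is determined by the K-linear map [ev] to [T], its
    evaluation at [1], and linear maps extend from subspaces. *)
Lemma coind_inj : ginjective coind.
Proof.
move=> L N i f im.
pose ev p (x : L p) : T p := val (f p x) 0%N p (addr0 p) (aone A).
have evl p : linear (@ev p) by move=> c x y; rewrite /ev linearP.
have ext p : exists g : N p -> T p, linear g /\ forall u, g (i p u) = ev p u.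
  by have [g gl gE] := lin_extend (ghom_linear i (n:=p)) (im p) (evl p); exists g.
pose g p := sval (cid (ext p)).
have gl p : linear (g p) by rewrite /g; case: cid => ? [].
have gE p u : g p (i p u) = ev p u by rewrite /g; case: cid => ? [].
have lin n (x : N n) : ((fun k p e a => g p (gact e a x)) : V n) \in P n.
  by apply/asboolP => k p e c a b; rewrite gact_linearl gl.
have hl n : linear (fun x => Subm (coind_closed n) (lin n x) : coind n).
  move=> c x y; apply: val_inj; rewrite [RHS]linearP /=.
  by do 4 (apply/functional_extensionality_dep => ?); rewrite !dprodE gact_linearr gl.
have ha k n m (e : n + k%:Z = m) (a : A k) (x : N n) :
   (Subm (coind_closed m) (lin m (gact e a x)) : coind m)
     = gact (g := coind) e a (Subm (coind_closed n) (lin n x)).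
  apply: val_inj => /=.
  apply/functional_extensionality_dep => q; apply/functional_extensionality_dep => p.
  apply/functional_extensionality_dep => e'; apply/functional_extensionality_dep => c.
  by congr (g p _); exact: gactA.
exists (mkhom hl ha) => n x; apply: val_inj => /=.
apply/functional_extensionality_dep => q; apply/functional_extensionality_dep => p.
apply/functional_extensionality_dep => e'; apply/functional_extensionality_dep => c.
rewrite -ghom_act gE /ev ghom_act /= /act.
transitivity (val (f n x) q p e' (amul (add0n q) (aone A) c)); first exact: coind_tr.
by rewrite amul1.
Qed.

End Coind.

Lemma enough_injectives M : exists E Q (i : ghom M E) (p : ghom E Q),
  ginjective E /\ ses i p.
Proof.
have [Q [p h]] := ses_coker (@coind_unit_mono M).
by exists (coind M), Q, (coind_unit M), p; split=> //; exact: coind_inj.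
Qed.

Lemma gprod_inj (J : Type) (F : J -> gmod A) :
  (forall j, ginjective (F j)) -> ginjective (gprod F).
Proof.
move=> Fi L N i f im.
have ex j : exists g : ghom N (F j), forall n x, g n (i n x) = f n x j.
  have [g gE] := Fi j _ _ i (gcompo (gproj F j) f) im.
  by exists g.
exists (gtuple (fun j => sval (cid (ex j)))) => n x.
by apply/functional_extensionality_dep => j; exact: (svalP (cid (ex j))).
Qed.

End GmodBasics.

(** * Local cohomology by dimension shifting *)

Section Torsion.
Variables (K : fieldType) (A : galg K).
Implicit Types (M N L : gmod A).

Lemma gactC M i j n m m' l (e1 : n + i%:Z = m) (e2 : m + j%:Z = l)
    (e3 : n + j%:Z = m') (e4 : m' + i%:Z = l) (a : A j) (b : A i) (x : M n) :
  gact e2 a (gact e1 b x) = gact e4 b (gact e3 a x).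
Proof.
have e : n + (j + i)%N%:Z = l by rewrite -e2 -e1 PoszD addrA addrAC.
rewrite (gactA (erefl _) _ _ e) (gactA (addnC i j) _ _ e); congr gact.
exact: amulC.
Qed.

Lemma killed0 M k n : killed k (0 : M n).
Proof. by elim: k n => //= k IH n i q e a _; rewrite gact0. Qed.

Lemma killedD M k n c (x y : M n) :
  killed k x -> killed k y -> killed k (c *: x + y).
Proof.
elim: k n x y => /= [|k IH] n x y hx hy; first by rewrite hx hy scaler0 addr0.
by move=> i q e a i0; rewrite gact_linearr; apply: IH; [exact: hx|exact: hy].
Qed.

Lemma killed_le M k l n (x : M n) : (k <= l)%N -> killed k x -> killed l x.
Proof.
elim: k l n x => [|k IH] l n x; first by move=> _ /= ->; exact: killed0.
case: l => // l kl h i q e a i0; apply: IH => //; exact: h.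
Qed.

Lemma killed_hom M N (f : ghom M N) k n (x : M n) : killed k x -> killed k (f n x).
Proof.
elim: k n x => [|k IH] n x /=; first by move=> ->; rewrite linear0.
by move=> h i m e a i0; rewrite -ghom_act; apply/IH/h.
Qed.

Lemma killed_mono M N (f : ghom M N) k n (x : M n) : gmono f ->
  killed k (f n x) -> killed k x.
Proof.
move=> fm; elim: k n x => [|k IH] n x /=; first exact: (gmono_eq0 fm).
by move=> h i m e a i0; apply: IH; rewrite ghom_act; exact: h.
Qed.

Lemma killed_act M k i n m (e : n + i%:Z = m) (a : A i) (x : M n) :
  killed k x -> killed k (gact e a x).
Proof.
elim: k n m e x => [|k IH] n m e x /=; first by move=> ->; rewrite gact0.
move=> h j l e' b j0; have e3 : n + j%:Z = n + j%:Z by [].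
have e4 : n + j%:Z + i%:Z = l by rewrite -e' -e addrAC.
by rewrite (gactC _ _ e3 e4); apply/IH/h.
Qed.

Lemma tors0 M n : torsion (0 : M n).
Proof. by exists 0%N. Qed.

Lemma torsP M n c (x y : M n) : torsion x -> torsion y -> torsion (c *: x + y).
Proof.
move=> [k hx] [l hy]; exists (maxn k l); apply: killedD.
  exact: killed_le (leq_maxl k l) hx.
exact: killed_le (leq_maxr k l) hy.
Qed.

Lemma torsD M n (x y : M n) : torsion x -> torsion y -> torsion (x + y).
Proof. by move=> hx hy; rewrite -[x]scale1r; exact: torsP. Qed.

Lemma torsN M n (x : M n) : torsion x -> torsion (- x).
Proof. by move=> hx; rewrite -scaleN1r -[_ *: _]addr0; apply: torsP => //; exact: tors0. Qed.

Lemma torsB M n (x y : M n) : torsion x -> torsion y -> torsion (x - y).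
Proof. by move=> hx /torsN; exact: torsD. Qed.

Lemma tors_sum M n (I : Type) (r : seq I) (F : I -> M n) :
  (forall i, torsion (F i)) -> torsion (\sum_(i <- r) F i).
Proof.
move=> h; elim/big_ind: _ => //; [exact: tors0 | exact: torsD].
Qed.

Lemma tors_hom M N (f : ghom M N) n (x : M n) : torsion x -> torsion (f n x).
Proof. by move=> [k h]; exists k; exact: killed_hom. Qed.

Lemma tors_mono M N (f : ghom M N) n (x : M n) : gmono f ->
  torsion (f n x) -> torsion x.
Proof. by move=> fm [k h]; exists k; exact: killed_mono h. Qed.

Lemma tors_act M i n m (e : n + i%:Z = m) (a : A i) (x : M n) :
  torsion x -> torsion (gact e a x).
Proof. by move=> [k h]; exists k; exact: killed_act. Qed.

(* Transport along an equality of degrees, as the action of the unit. *)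
Definition gcast M n m (e : n + 0%N%:Z = m) : M n -> M m := gact e (aone A).

Lemma gcastK M n m (e : n + 0%N%:Z = m) (e' : m + 0%N%:Z = n) (x : M n) :
  gcast e' (gcast e x) = x.
Proof.
rewrite /gcast (gactA (addn0 0) e e' (addr0 n)) amul1; exact: gact1.
Qed.

Lemma gcast_act M i n m m' (e : n + i%:Z = m) (e' : m + 0%N%:Z = m')
  (e2 : n + i%:Z = m') (a : A i) (x : M n) : gcast e' (gact e a x) = gact e2 a x.
Proof. by rewrite /gcast (gactA (add0n i) e e' e2) amul1. Qed.

Lemma gact_cast M i n m m' (e : n + 0%N%:Z = m) (e' : m + i%:Z = m')
  (e2 : n + i%:Z = m') (a : A i) (x : M n) : gact e' a (gcast e x) = gact e2 a x.
Proof.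
by rewrite /gcast (gactA (addn0 i) e e' e2) (amulC _ (add0n i)) amul1.
Qed.

Lemma gcast_hom M N (f : ghom M N) n m (e : n + 0%N%:Z = m) (x : M n) :
  f m (gcast e x) = gcast e (f n x).
Proof. exact: ghom_act. Qed.

Lemma gcast_linear M n m (e : n + 0%N%:Z = m) : linear (@gcast M n m e).
Proof. exact: gact_linearr. Qed.

(** Shifting the extension problem by [-t] gives one for [E]; [gcast] identifies the degrees
    [n - t + t] and [n]. *)
Lemma shift_inj (E : gmod A) t : ginjective E -> ginjective (shift E t).
Proof.
move=> Ei L N i f im.
have c0 n : n - t + t + 0%N%:Z = n by rewrite addr0 subrK.
have c1 n : n + 0%N%:Z = n + t - t by rewrite addr0 addrK.
pose f' n (x : shift L (- t) n) : E n := gcast (c0 n) (f (n - t) x).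
have f'l n : linear (@f' n).
  by move=> c x y; rewrite /f' linearP gcast_linear.
have f'a k n m (e : n + k%:Z = m) (a : A k) x :
   f' m (gact (g := shift L (- t)) e a x) = gact e a (f' n x).
  rewrite /f' (ghom_act f) /=; have e2 : n - t + t + k%:Z = m by rewrite -e subrK.
  by rewrite (gcast_act _ _ e2) (gact_cast _ _ e2).
have [g' g'E] := Ei _ _ (gshift i (- t)) (mkhom f'l f'a) (fun n => im (n - t)).
pose g n (x : N n) : shift E t n := g' (n + t) (gcast (c1 n) x).
have gl n : linear (@g n).
  by move=> c x y; rewrite /g gcast_linear linearP.
have ga k n m (e : n + k%:Z = m) (a : A k) x :
   g m (gact e a x) = gact (g := shift E t) e a (g n x).
  rewrite /g /= -(ghom_act g') /=; congr (g' _ _).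
  have e2 : n + k%:Z = m + t - t by rewrite addrK.
  by rewrite (gcast_act _ _ e2) (gact_cast _ _ e2).
exists (mkhom gl ga) => n x /=.
rewrite /g -(gcast_hom i) (g'E (n + t)) /= /f' (gcast_hom f).
have e' : n + t - t + t + 0%N%:Z = n + t by rewrite addr0 subrK.
have e0 : n + t + 0%N%:Z = n + t - t + t by rewrite subrK addr0.
rewrite /= -[RHS](gcastK e0 e') /gcast /= (gact_irr _ e').
by congr (gact e' _ _); exact: gact_irr.
Qed.

Lemma tors_shift M t n (x : shift M t n) : torsion x -> torsion (x : M (n + t)).
Proof.
move=> [k h]; exists k; elim: k n x h => [|k IH] n x //= h i q e a i0.
have e1 : n + i%:Z = q - t by rewrite -e addrAC addrK.
have e2 : q - t + t + 0%N%:Z = q by rewrite addr0 subrK.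
rewrite -(gcast_act (shift_deg t e1) e2); apply: killed_act.
exact: (IH (q - t) (gact (g := shift M t) e1 a x) (h _ _ e1 a i0)).
Qed.

End Torsion.

(** * Vanishing of higher local cohomology *)

Section HV.
Variables (K : fieldType) (A : galg K).
Implicit Types (M N L Y C B E Q X : gmod A).

Definition tors_onto M N (p : ghom M N) n : Prop :=
  forall y : N n, torsion y -> exists2 x, torsion x & p n x = y.

(* lc_vanish i N n says that the local cohomology H^{i+1}(N) vanishes in degree n. *)
Fixpoint lc_vanish (i : nat) (N : gmod A) (n : int) : Prop :=
  exists E Q (j : ghom N E) (p : ghom E Q), [/\ ginjective E, ses j p &
    if i is i'.+1 then lc_vanish i' Q n else tors_onto p n].

(** [N] is a retract of [N'] modulo maps that factor through an injective. This relation passes to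
    cosyzygies, which makes [lc_vanish] independent of the injectives chosen. *)
Definition retr N N' : Prop := exists (u : ghom N N') (v : ghom N' N)
  J (k : ghom N J) (l : ghom J N), ginjective J /\
  forall n x, v n (u n x) = x + l n (k n x).

Lemma retr_refl N : retr N N.
Proof.
exists (gid N), (gid N), (coind N), (gzero _ _), (gzero _ _).
by split=> [|n x]; [exact: coind_inj | rewrite /= addr0].
Qed.

(** Extend [u], [v], [k] to maps [U], [V], [k'] of the injectives. Then [V U - 1 - j l k'] vanishes
    on [N], so it descends to [h : Q -> E], and the maps induced on the quotients satisfy
    [vb ub = 1 + p h]. *)
Lemma retr_step N N' E Q E' Q' (j : ghom N E) (p : ghom E Q)
    (j' : ghom N' E') (p' : ghom E' Q') :
  retr N N' -> ginjective E -> ses j p -> ginjective E' -> ses j' p' ->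
  retr Q Q' /\ forall n, tors_onto p' n -> tors_onto p n.
Proof.
move=> [u [v [J [k [l [Ji uv]]]]]] Ei s E'i s'.
have [U UE] := E'i _ _ j (gcompo j' u) (ses_mono s).
have [V VE] := Ei _ _ j' (gcompo j v) (ses_mono s').
have [k' k'E] := Ji _ _ j k (ses_mono s).
have [ub ubE] : exists h : ghom Q Q', forall n x, h n (p n x) = p' n (U n x).
  apply: (gfactor (g := gcompo p' U)); first exact: ses_surj s.
  by move=> n x /(ses_ex s)[y ->] /=; rewrite UE /= ses_pi.
have [vb vbE] : exists h : ghom Q' Q, forall n x, h n (p' n x) = p n (V n x).
  apply: (gfactor (g := gcompo p V)); first exact: ses_surj s'.
  by move=> n x /(ses_ex s')[y ->] /=; rewrite VE /= ses_pi.
have [h hE] : exists h : ghom Q E, forall n x,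
    h n (p n x) = V n (U n x) - x - j n (l n (k' n x)).
  apply: (gfactor (g := gadd (gadd (gcompo V U) (gopp (gid E)))
     (gopp (gcompo j (gcompo l k'))))); first exact: ses_surj s.
  move=> n x /(ses_ex s)[y ->] /=; rewrite UE /= VE /= k'E uv linearD /=.
  by rewrite [j n y + _]addrC addrK subrr.
have key n x : vb n (ub n x) = x + p n (h n x).
  have [y <-] := ses_surj s x; rewrite ubE vbE hE !linearB /= (ses_pi s) subr0.
  by rewrite addrC subrK.
split; first by exists ub, vb, E, h, p.
move=> n onto y ty; have [e te pe] := onto _ (tors_hom (ub) ty).
exists (V n e - h n y); first by apply: torsB; apply: tors_hom.
by rewrite linearB /= -vbE pe key addrK.
Qed.

Lemma lc_vanish_retr i N N' n : retr N N' -> lc_vanish i N' n -> lc_vanish i N n.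
Proof.
elim: i N N' => [|i IH] N N' r /= [E' [Q' [j' [p' [E'i s' h]]]]];
have [E [Q [j [p [Ei s]]]]] := enough_injectives N;
have [r2 o] := retr_step r Ei s E'i s'; exists E, Q, j, p; split=> //.
  exact: o.
exact: IH h.
Qed.

Lemma lc_vanish0P N E Q (j : ghom N E) (p : ghom E Q) n :
  ginjective E -> ses j p -> lc_vanish 0 N n <-> tors_onto p n.
Proof.
move=> Ei s; split=> [[E' [Q' [j' [p' [E'i s' h]]]]]|h].
  by have [_] := retr_step (retr_refl N) Ei s E'i s'; apply.
by exists E, Q, j, p.
Qed.

Lemma lc_vanishSP i N E Q (j : ghom N E) (p : ghom E Q) n :
  ginjective E -> ses j p -> lc_vanish i.+1 N n <-> lc_vanish i Q n.
Proof.
move=> Ei s; split=> [[E' [Q' [j' [p' [E'i s' h]]]]]|h].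
  by have [r _] := retr_step (retr_refl N) Ei s E'i s'; exact: lc_vanish_retr h.
by exists E, Q, j, p.
Qed.

Definition acyc Y := forall i n, lc_vanish i Y n.

Lemma acyc_step Y E Q (j : ghom Y E) (p : ghom E Q) :
  ginjective E -> ses j p -> acyc Y -> acyc Q /\ forall n, tors_onto p n.
Proof.
move=> Ei s a; split=> [i n|n]; last by apply/(lc_vanish0P _ Ei s).
by apply/(lc_vanishSP _ _ Ei s); exact: a.
Qed.

(** The piece [H^0(C) -> H^0(B) -> H^1(Y)] of the long exact sequence. With [w : C -> E] extending
    the embedding of [Y], the image of [y] in [Q] lifts to a torsion [e], and a preimage of [y] can
    be corrected by [Y] so that [w] maps it to [e]. *)
Lemma tors_onto_ses Y C B (a : ghom Y C) (b : ghom C B) n :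
  ses a b -> lc_vanish 0 Y n -> tors_onto b n.
Proof.
move=> s [E [Q [j [p [Ei sj o]]]]].
have [w wE] := Ei _ _ a j (ses_mono s).
have [wb wbE] : exists h : ghom B Q, forall n x, h n (b n x) = p n (w n x).
  apply: (gfactor (g := gcompo p w)); first exact: ses_surj s.
  by move=> m x /(ses_ex s)[y ->] /=; rewrite wE ses_pi.
move=> y ty; have [e te pe] := o _ (tors_hom wb ty).
have [c bc] := ses_surj s y.
have : p n (w n c - e) = 0 by rewrite linearB pe -wbE bc subrr.
case/(ses_ex sj) => z zE; exists (c - a n z); last first.
  by rewrite linearB /= bc (ses_pi s) subr0.
have wc : w n (c - a n z) = e by rewrite linearB /= wE -zE opprB addrC subrK.
case: te ty => k ke [k' ky]; exists (maxn k k').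
have {}ke := killed_le (leq_maxl k k') ke.
have {}ky := killed_le (leq_maxr k k') ky.
have by_ : b n (c - a n z) = y by rewrite linearB /= bc (ses_pi s) subr0.
(* The maps [w] and [b] together embed [C] in the product of [E] and [B], so a power killing both
   images kills the lift. *)
move: (maxn k k') (c - a n z) wc by_ ke ky; clear -wE sj s => k.
elim: k n y e => [|k IH] n y e x wx bx /= ke ky.
  have : b n x = 0 by rewrite bx.
  case/(ses_ex s) => z xz; rewrite xz.
  have : j n z = 0 by rewrite -wE -xz wx.
  by move/(gmono_eq0 (ses_mono sj)) => ->; rewrite linear0.
move=> i m e' a0 i0; apply: (IH _ (gact e' a0 y) (gact e' a0 e)).
- by rewrite ghom_act wx.
- by rewrite ghom_act bx.
- exact: ke.
- exact: ky.
Qed.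

Lemma horseshoe Y C B (a : ghom Y C) (b : ghom C B)
   EY QY (jY : ghom Y EY) (pY : ghom EY QY)
   EB QB (jB : ghom B EB) (pB : ghom EB QB) :
  ses a b -> ginjective EY -> ses jY pY -> ginjective EB -> ses jB pB ->
  exists Q (j : ghom C (gpair EY EB)) (p : ghom (gpair EY EB) Q)
   (al : ghom QY Q) (be : ghom Q QB),
   [/\ ses j p, ses al be,
       forall n e, be n (p n e) = pB n (gsnd _ _ n e) &
       forall n e, al n (pY n e) = p n (mkpair e 0)].
Proof.
move=> s EYi sY EBi sB.
have [w wE] := EYi _ _ a jY (ses_mono s).
pose j := gpairing w (gcompo jB b).
have jm : gmono j.
  apply: gmono0 => n x jx.
  have : b n x = 0.
    apply: (gmono_eq0 (ses_mono sB)); exact: (congr1 (gsnd _ _ n) jx).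
  case/(ses_ex s) => y xy; rewrite xy.
  have : jY n y = 0 by rewrite -wE -xy; exact: (congr1 (gfst _ _ n) jx).
  by move/(gmono_eq0 (ses_mono sY)) => ->; rewrite linear0.
have [Q [p sj]] := ses_coker jm.
pose in1 : ghom EY (gpair EY EB) := gpairing (gid EY) (gzero _ _).
have in1E n e : in1 n e = mkpair e 0.
  by apply/functional_extensionality_dep => -[].
have [al alE] : exists h : ghom QY Q, forall n x, h n (pY n x) = p n (in1 n x).
  apply: (gfactor (g := gcompo p in1)); first exact: ses_surj sY.
  move=> n x /(ses_ex sY)[y ->]; change (p n (in1 n (jY n y)) = 0).
  have -> : in1 n (jY n y) = j n (a n y).
    apply: gpair_eq; first by rewrite /= wE.
    by rewrite /= (ses_pi s) linear0.
  by rewrite ses_pi.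
have [be beE] : exists h : ghom Q QB, forall n x, h n (p n x) = pB n (gsnd _ _ n x).
  apply: (gfactor (g := gcompo pB (gsnd _ _))); first exact: ses_surj sj.
  by move=> n x /(ses_ex sj)[y ->] /=; rewrite ses_pi.
exists Q, j, p, al, be; split=> //; last by move=> n e; rewrite alE in1E.
split.
- apply: gmono0 => n x; have [e <-] := ses_surj sY x; rewrite alE.
  case/(ses_ex sj) => c ec.
  have e1 : e = w n c by exact: (congr1 (gfst _ _ n) ec).
  have e2 : 0 = jB n (b n c) by exact: (congr1 (gsnd _ _ n) ec).
  have [y cy] := ses_ex s (gmono_eq0 (ses_mono sB) (esym e2)).
  by rewrite e1 cy wE ses_pi.
- move=> n y; have [e eE] := ses_surj sB y.
  by exists (p n (mkpair 0 e)); rewrite beE.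
- move=> n x; have [e <-] := ses_surj sY x; rewrite alE beE /=.
  by rewrite linear0.
- move=> n q; have [e <-] := ses_surj sj q; rewrite beE.
  case/(ses_ex sB) => z zE; have [c cE] := ses_surj s z.
  exists (pY n (gfst _ _ n e - w n c)); rewrite alE.
  have -> : in1 n (gfst _ _ n e - w n c) = e - j n c.
    apply: gpair_eq; first by [].
    by rewrite [RHS]linearB [gsnd _ _ n e]zE -cE /= subrr.
  by rewrite linearB /= (ses_pi sj) subr0.
Qed.

(** The horseshoe lemma replaces the sequence by one of cosyzygies, again with acyclic kernel. In
    the base case, lift the image of a torsion element in [QB]; the remaining error is torsion in
    [QY], and lifts because [Y] is acyclic. *)
Lemma lc_vanish_ses Y C B (a : ghom Y C) (b : ghom C B) i n :
  ses a b -> acyc Y -> lc_vanish i C n <-> lc_vanish i B n.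
Proof.
elim: i Y C B a b => [|i IH] Y C B a b s aY;
have [EY [QY [jY [pY [EYi sY]]]]] := enough_injectives Y;
have [EB [QB [jB [pB [EBi sB]]]]] := enough_injectives B;
have [Q [j [p [al [be [sj sQ beE alE]]]]]] := horseshoe s EYi sY EBi sB;
have [aQ oY] := acyc_step EYi sY aY;
have Ei : ginjective (gpair EY EB) by apply: gprod_inj => -[].
- rewrite (lc_vanish0P _ Ei sj) (lc_vanish0P _ EBi sB); split=> o y ty.
    have [q tq qy] := tors_onto_ses sQ (aQ 0%N n) ty.
    have [e te pe] := o _ tq; exists (gsnd _ _ n e); first exact: tors_hom.
    by rewrite -beE pe qy.
  have [g tg gE] := o _ (tors_hom be ty).
  have t2 : torsion (mkpair 0 g : gpair EY EB n).
    pose in2 : ghom EB (gpair EY EB) := gpairing (gzero _ _) (gid EB).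
    have -> : mkpair 0 g = in2 n g by apply/functional_extensionality_dep => -[].
    exact: tors_hom.
  have : be n (y - p n (mkpair 0 g)) = 0.
    by rewrite linearB /= beE /= gE subrr.
  case/(ses_ex sQ) => z zE.
  have tz : torsion z.
    by apply: (tors_mono (ses_mono sQ)); rewrite -zE; apply: torsB => //; exact: tors_hom.
  have [e te eE] := oY _ _ tz.
  have t1 : torsion (mkpair e 0 : gpair EY EB n).
    pose in1 : ghom EY (gpair EY EB) := gpairing (gid EY) (gzero _ _).
    have -> : mkpair e 0 = in1 n e by apply/functional_extensionality_dep => -[].
    exact: tors_hom.
  exists (mkpair e 0 + mkpair 0 g); first exact: torsD.
  by rewrite linearD /= -alE eE -zE subrK.
- by rewrite (lc_vanishSP _ _ Ei sj) (lc_vanishSP _ _ EBi sB); exact: IH sQ aQ.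
Qed.

Definition bounded (c : int) M := forall n, c < n -> forall x : M n, x = 0.

Lemma bounded_torsion c M : bounded c M -> forall n (x : M n), torsion x.
Proof.
move=> h n x.
have key k m (y : M m) : c < m + k%:Z -> killed k y.
  elim: k m y => [|k IH] m y ck /=; first by apply: h; rewrite addr0 in ck.
  by move=> i q e a i0; apply: IH; lia.
exists (`|c - n|.+1); apply: key; lia.
Qed.

Lemma bounded_acyc c Y : bounded c Y -> acyc Y.
Proof.
move=> h i; elim: i Y h => [|i IH] Y h n /=;
have Em := @coind_unit_mono _ _ Y; have [Q [p s]] := ses_coker Em;
exists (coind Y), Q, (coind_unit Y), p; split=> //; try exact: coind_inj.
- move=> y _; have [x xy] := ses_surj s y; exists x => //.
  exact: (bounded_torsion (coind_bounded h)).
- apply: IH => m cm x; have [y <-] := ses_surj s x.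
  by rewrite (coind_bounded h cm y) linear0.
Qed.

(** The identity of [E] factors through an injective, so modulo such maps [E] is a retract of the
    zero module, built here as an empty product. *)
Lemma inj_acyc E : ginjective E -> acyc E.
Proof.
move=> Ei i n.
pose Z := gprod (fun _ : False => coind E).
apply: (@lc_vanish_retr i E Z); last first.
  by apply: (@bounded_acyc 0) => m _ x; apply/functional_extensionality_dep => -[].
exists (gzero _ _), (gzero _ _), E, (gid E), (gopp (gid E)); split=> // m x.
by rewrite /= subrr.
Qed.

Definition gmulhom X (f : A 1%N) (g : ghom X (shift X (- 1))) n (x : X n) : X n :=
  gact (subrK 1 n) f (g n x).

(* Localizations at linear forms have such a partition of unity. *)
Definition has_partition X : Prop := exists t (f : nat -> A 1%N)
    (g : nat -> ghom X (shift X (- 1))),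
  forall n (x : X n), x = \sum_(c < t) gmulhom (f c) (g c) x.

(** A partition of unity modulo a map through an injective. Unlike [has_partition], it is shown to
    pass to cosyzygies, so it can carry the induction on the cohomological degree. *)
Definition weak_partition X : Prop := exists t (f : nat -> A 1%N)
    (g : nat -> ghom X (shift X (- 1))) J (k : ghom X J) (l : ghom J X),
  ginjective J /\
  forall n (x : X n), \sum_(c < t) gmulhom (f c) (g c) x = x + l n (k n x).

Lemma has_partition_weak X : has_partition X -> weak_partition X.
Proof.
move=> [t [f [g h]]]; exists t, f, g, (coind X), (gzero _ _), (gzero _ _).
by split=> [|n x]; [exact: coind_inj | rewrite /= addr0 -(h n x)].
Qed.

Lemma gmulhom_linear X f (g : ghom X (shift X (- 1))) n : linear (@gmulhom X f g n).
Proof. by move=> c x y; rewrite /gmulhom linearP gact_linearr. Qed.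

Lemma gmulhom_act X f (g : ghom X (shift X (- 1))) i n m (e : n + i%:Z = m) (a : A i) x :
  gmulhom f g (gact e a x) = gact e a (gmulhom f g x).
Proof. by rewrite /gmulhom (ghom_act g) /=; exact: gactC. Qed.

Lemma gmulhom_cast X f (g : ghom X (shift X (- 1))) n (x : X n)
   (e : n + 1 - 1 + 0%N%:Z = n) :
  gmulhom f g x = gcast e (g (n + 1) (gact (erefl (n + 1%N%:Z)) f x)).
Proof.
by rewrite (ghom_act g) /= (gcast_act _ _ (subrK 1 n)).
Qed.

(** The [g_c] extend to maps [G_c] of [E], because shifts of injectives are injective. A torsion [y]
    in [Q] is lifted by induction on the power killing it: [f_c y] is killed one power sooner and
    lifts to a torsion [e], and then [G_c e] lifts [f_c g_c y]. The defect of the weak partition is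
    corrected by [h]. *)
Lemma weak_partition_step X E Q (j : ghom X E) (p : ghom E Q) :
  weak_partition X -> ginjective E -> ses j p -> weak_partition Q /\ forall n, tors_onto p n.
Proof.
move=> [t [f [g [J [k [l [Ji fg]]]]]]] Ei s.
have exG c : exists G : ghom E (shift E (- 1)), forall n x, G n (j n x) = j (n - 1) (g c n x).
  exact: (shift_inj Ei (gcompo (gshift j (- 1)) (g c)) (ses_mono s)).
pose G c := sval (cid (exG c)).
have GE c n x : G c n (j n x) = j (n - 1) (g c n x) by rewrite /G; case: cid.
have exGb c : exists Gb : ghom Q (shift Q (- 1)),
    forall n x, Gb n (p n x) = p (n - 1) (G c n x).
  apply: (gfactor (g := gcompo (gshift p (- 1)) (G c))); first exact: ses_surj s.
  by move=> n x /(ses_ex s)[y ->] /=; rewrite GE (ses_pi s).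
pose Gb c := sval (cid (exGb c)).
have GbE c n x : Gb c n (p n x) = p (n - 1) (G c n x) by rewrite /Gb; case: cid.
have [k' k'E] := Ji _ _ j k (ses_mono s).
pose Psi n (x : E n) := \sum_(c < t) gmulhom (f c) (G c) x.
have Psil n : linear (@Psi n).
  move=> c x y; rewrite /Psi scaler_sumr -big_split; apply: eq_bigr => d _.
  exact: gmulhom_linear.
have Psia i n m (e : n + i%:Z = m) (a : A i) x : Psi m (gact e a x) = gact e a (Psi n x).
  rewrite /Psi (linS (gact_linearr e a)); apply: eq_bigr => c _.
  exact: gmulhom_act.
have Psij n x : Psi n (j n x) = j n (x + l n (k n x)).
  rewrite -fg linear_sum; apply: eq_bigr => c _.
  by rewrite /gmulhom GE ghom_act.
have pPsi n x : p n (Psi n x) = \sum_(c < t) gmulhom (f c) (Gb c) (p n x).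
  rewrite linear_sum; apply: eq_bigr => c _.
  by rewrite /gmulhom GbE ghom_act.
have [h hE] : exists h : ghom Q E, forall n x,
    h n (p n x) = Psi n x - x - j n (l n (k' n x)).
  apply: (gfactor (g := gadd (gadd (mkhom Psil Psia) (gopp (gid E)))
     (gopp (gcompo j (gcompo l k'))))); first exact: ses_surj s.
  move=> n x /(ses_ex s)[y ->] /=; rewrite Psij k'E linearD /=.
  by rewrite [j n y + _]addrC addrK subrr.
have key n x : \sum_(c < t) gmulhom (f c) (Gb c) x = x + p n (h n x).
  have [y <-] := ses_surj s x; rewrite -pPsi hE !linearB /= (ses_pi s) subr0.
  by rewrite addrC subrK.
split; first by exists t, f, Gb, E, h, p.
move=> n y [d]; elim: d n y => [|d IH] n y /=.
  by move=> ->; exists 0; [exact: tors0 | rewrite linear0].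
move=> ky; have tb c : exists2 x : E n, torsion x & p n x = gmulhom (f c) (Gb c) y.
  have [e te pe] := IH _ _ (ky 1%N _ (erefl (n + 1%N%:Z)) (f c) isT).
  have e0 : n + 1 - 1 + 0%N%:Z = n by rewrite addr0 addrK.
  exists (gcast e0 (G c _ e)).
    by apply/tors_act/tors_shift/tors_hom.
  by rewrite gcast_hom -GbE pe (gmulhom_cast _ _ _ e0).
pose b c := sval (cid2 (tb c)).
have b1 c : torsion (b c) by rewrite /b; case: cid2.
have b2 c : p n (b c) = gmulhom (f c) (Gb c) y by rewrite /b; case: cid2.
exists (\sum_(c < t) b c - h n y).
  apply: torsB; first exact: tors_sum.
  by apply: tors_hom; exists d.+1.
rewrite linearB linear_sum /=; under eq_bigr => c _ do rewrite b2.
by rewrite key addrK.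
Qed.

Lemma partition_acyc X : has_partition X -> acyc X.
Proof.
move/has_partition_weak => h i; elim: i X h => [|i IH] X h n;
have [E [Q [j [p [Ei s]]]]] := enough_injectives X;
have [wQ o] := weak_partition_step h Ei s.
  by apply/(lc_vanish0P _ Ei s).
by apply/(lc_vanishSP _ _ Ei s)/IH.
Qed.

(** [x] is the sum of the [g_c (f_c x)], and [f_c x] is zero by induction on the power killing
    [x]. *)
Lemma partition_torsion_free X n (x : X n) : has_partition X -> torsion x -> x = 0.
Proof.
move=> [t [f [g h]]] [k]; elim: k n x => //= k IH n x kx.
rewrite (h n x) big1 // => c _; have e0 : n + 1 - 1 + 0%N%:Z = n by rewrite addr0 addrK.
rewrite (gmulhom_cast _ _ _ e0) (IH _ _ (kx 1%N _ (erefl (n + 1%N%:Z)) (f c) isT)).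
by rewrite linear0 /gcast gact0.
Qed.

(** The [k]-th power of the irrelevant ideal sends [x] into the image of [f]: the class of [x] in
    the cokernel is torsion. *)
Fixpoint killed_mod L M (f : ghom L M) k n (x : M n) : Prop :=
  if k is k'.+1 then
    forall i m (e : n + i%:Z = m) (a : A i), (0 < i)%N -> killed_mod f k' (gact e a x)
  else exists y, x = f n y.

Lemma killed_mod_ses L M N (f : ghom L M) (p : ghom M N) k n (x : M n) :
  ses f p -> killed_mod f k x <-> killed k (p n x).
Proof.
move=> s; elim: k n x => [|k IH] n x /=.
  by split=> [[y ->]|/(ses_ex s)] //; exact: (ses_pi s).
split=> h i m e a i0; first by rewrite -ghom_act; apply/IH/h.
by apply/IH; rewrite ghom_act; exact: h.
Qed.

Definition exact_at L M N (f : ghom L M) (g : ghom M N) n : Prop :=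
  forall x : M n, g n x = 0 -> exists y, x = f n y.

(* Maps of the augmented complex N -> X 0 -> X 1 -> ..., by position. *)
Definition aug_src N (X : nat -> gmod A) (i : nat) : gmod A :=
  if i is i'.+1 then X i' else N.
Definition aug_map N (X : nat -> gmod A) (io : ghom N (X 0%N)) (d : forall j, ghom (X j) (X j.+1)) i :
    ghom (aug_src N X i) (X i) :=
  if i is i'.+1 then d i' else io.

Lemma killed_mod_sub L L' M (f : ghom L M) (f' : ghom L' M) k n (x : M n) :
  (forall n y, exists y', f n y = f' n y') -> killed_mod f k x -> killed_mod f' k x.
Proof.
move=> h; elim: k n x => [|k IH] n x /= => [[y ->]|kx i m e a i0]; first exact: h.
exact/IH/kx.
Qed.

(* As E is injective, the pushout of E and X along N splits as the sum of E and C. *)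
Lemma pushout_ses N X C E Q (io : ghom N X) (pi : ghom X C) (j : ghom N E)
    (p : ghom E Q) : ses io pi -> ses j p -> ginjective E ->
  exists (al : ghom X (gpair E C)) (be : ghom (gpair E C) Q), ses al be /\ forall n y, gsnd E C n y = 0 -> be n y = p n (gfst E C n y).
Proof.
move=> s sE Ei; have [u uE] := Ei _ _ io j (ses_mono s).
have [ub ubE] : exists h : ghom C Q, forall n x, h n (pi n x) = p n (u n x).
  apply: (gfactor (g := gcompo p u)); first exact: ses_surj s.
  by move=> m x /(ses_ex s)[y ->] /=; rewrite uE (ses_pi sE).
pose al : ghom X (gpair E C) := gpairing u pi.
pose be : ghom (gpair E C) Q := gadd (gcompo p (gfst E C)) (gopp (gcompo ub (gsnd E C))).
exists al, be; split; last by move=> n y /= ->; rewrite linear0 subr0.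
split.
- apply: gmono0 => m x ax.
  have : pi m x = 0 by exact: (congr1 (gsnd _ _ m) ax).
  case/(ses_ex s) => y xy; rewrite xy.
  have : j m y = 0 by rewrite -uE -xy; exact: (congr1 (gfst _ _ m) ax).
  by move/(gmono_eq0 (ses_mono sE)) => ->; rewrite linear0.
- move=> m y; have [e <-] := ses_surj sE y; exists (mkpair e 0).
  by rewrite /= linear0 subr0.
- by move=> m x; rewrite /= ubE subrr.
- move=> m y /= /eqP; rewrite subr_eq0 => /eqP.
  have [x xE] := ses_surj s (gsnd _ _ m y).
  have -> : y false = pi m x by rewrite xE.
  rewrite ubE => h; have : p m (gfst _ _ m y - u m x) = 0.
    by rewrite linearB /= h subrr.
  case/(ses_ex sE) => z zE; exists (x + io m z); apply: gpair_eq.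
    by rewrite /= linearD /= uE -zE addrC subrK.
  by rewrite -xE /= linearD /= (ses_pi s) addr0.
Qed.

Lemma gpair_ses E C : ses (gpairing (gid E) (gzero E C)) (gsnd E C).
Proof.
split.
- by apply: gmono0 => n x h; exact: (congr1 (gfst _ _ n) h).
- by move=> n y; exists (mkpair 0 y).
- by [].
- by move=> n y h; exists (gfst E C n y); apply: gpair_eq.
Qed.

(** Let [C = X_0 / N]. Since [X_0] is torsion free and acyclic, [H^1(N)] is the torsion of [C]. This
    is the cohomology at [X_0], which is torsion while [X_1] is torsion free. In higher degrees
    [H^{i+2}(N)] and [H^{i+1}(C)] vanish together, and [C] may be replaced by the image [B] of
    [d 0], which heads the truncated complex. *)
Theorem lc_vanish_complex (i : nat) : forall N (X : nat -> gmod A) (io : ghom N (X 0%N))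
    (d : forall j, ghom (X j) (X j.+1)) n,
  gmono io ->
  (forall j n x, d j n (aug_map io d j n x) = 0) ->
  (forall j, has_partition (X j)) ->
  (forall j n (x : X j n), (j <= i)%N -> d j n x = 0 ->
     exists k, killed_mod (aug_map io d j) k x) ->
  (forall j, (j < i)%N -> exists c, forall n, c < n ->
     exact_at (aug_map io d j) (d j) n) ->
  lc_vanish i N n <-> exact_at (aug_map io d i) (d i) n.
Proof.
elim: i => [|i IH] N X io d n im dd pX tX bX.
- have [C [pi s]] := ses_coker im.
  have [dC dCE] : exists h : ghom C (X 1%N), forall n x, h n (pi n x) = d 0%N n x.
    apply: (gfactor (g := d 0%N)); first exact: ses_surj s.
    by move=> m x /(ses_ex s)[y ->]; exact: (dd 0%N).
  split.
    move=> h x dx; apply/(ses_ex s); have [k /(killed_mod_ses _ _ s) kx] := tX 0%N n x isT dx.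
    have [y ty <-] := tors_onto_ses s h (ex_intro _ k kx : torsion (pi n x)).
    by rewrite (partition_torsion_free (pX 0%N) ty) linear0.
  move=> ex; have [E [Q [j [p [Ei sE]]]]] := enough_injectives N.
  apply/(lc_vanish0P _ Ei sE) => q tq.
  have [al [be [sP beE]]] := pushout_ses s sE Ei.
  have [y ty yq] := tors_onto_ses sP (partition_acyc (pX 0%N) 0%N n) tq.
  exists (gfst E C n y); first exact: tors_hom.
  have tc : torsion (gsnd E C n y) by exact: tors_hom.
  suff c0 : gsnd E C n y = 0 by rewrite -yq beE.
  have [x xE] := ses_surj s (gsnd _ _ n y); rewrite -xE.
  have : d 0%N n x = 0.
    by rewrite -dCE xE; apply: (partition_torsion_free (pX 1%N)); exact: tors_hom.
  by case/ex => z ->; rewrite (ses_pi s).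
- have [E [Q [j [p [Ei sE]]]]] := enough_injectives N.
  rewrite (lc_vanishSP _ _ Ei sE).
  have [C [pi s]] := ses_coker im.
  have [al [be [sP _]]] := pushout_ses s sE Ei.
  rewrite -(lc_vanish_ses i n sP (partition_acyc (pX 0%N))).
  rewrite (lc_vanish_ses i n (gpair_ses E C) (inj_acyc Ei)).
  have [dC dCE] : exists h : ghom C (X 1%N), forall n x, h n (pi n x) = d 0%N n x.
    apply: (gfactor (g := d 0%N)); first exact: ses_surj s.
    by move=> m x /(ses_ex s)[y ->]; exact: (dd 0%N).
  pose B := gsub (gim_sub (d 0%N)); pose inc := gincl (gim_sub (d 0%N)).
  have incE m (y : B m) : exists x, inc m y = d 0%N m x.
    by have /asboolP := gincl_in y.
  have incS m x : exists y : B m, inc m y = d 0%N m x.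
    by apply: gincl_surj; apply/asboolP; exists x.
  have [r rE] : exists h : ghom C B, forall n x, inc n (h n x) = dC n x.
    apply: (glift (g := dC)); first exact: gincl_inj.
    by move=> m x; have [z <-] := ses_surj s x; rewrite dCE; have [y <-] := incS m z; exists y.
  have rs : gsurj r.
    move=> m y; have [x xE] := incE m y; exists (pi m x).
    by apply: (@gincl_inj _ _ _ _ (gim_sub (d 0%N))); rewrite rE dCE xE.
  (* [W] is the cohomology at [X_0]. It is bounded above, hence acyclic, so [C] and [B] have the
     same higher vanishing. *)
  have [W [w sW]] := ses_ker rs.
  have [c cE] := bX 0%N isT.
  have bW : bounded c W.
    move=> m cm x; apply: (gmono_eq0 (ses_mono sW)).
    have [z zE] := ses_surj s (w m x).
    have : d 0%N m z = 0 by rewrite -dCE zE -rE (ses_pi sW) linear0.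
    by case/(cE m cm) => t tE; rewrite -zE tE (ses_pi s).
  rewrite (lc_vanish_ses i n sW (bounded_acyc bW)).
  have im0 m y : exists y', aug_map (X := fun j => X j.+1) inc (fun j => d j.+1) 0 m y = d 0%N m y'.
    exact: incE.
  have im1 m y : exists y', d 0%N m y = inc m y'.
    by have [y' <-] := incS m y; exists y'.
  rewrite (IH B (fun j => X j.+1) inc (fun j => d j.+1)).
  + case: i {IH tX bX} => [|i] //=; split=> ex x /ex[y ->].
      by have [y' ->] := incE n y; exists y'.
    by have [y' <-] := incS n y; exists y'.
  + exact: gincl_inj.
  + case=> [|l] m x; last exact: (dd l.+2).
    have [y yE] := incE m x; change (d 1%N m (inc m x) = 0).
    by rewrite yE; exact: (dd 1%N).
  + by move=> l; exact: pX.
  + case=> [|l] m x ji dx; have [k kx] := tX _ _ x ji dx; exists k => //.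
    exact: killed_mod_sub kx.
  + case=> [|l] ji; last exact: (bX l.+2 ji).
    have [c' c'E] := bX 1%N ji; exists c' => m /c'E ex.
    by move=> x /ex[y ->]; have [y' <-] := incS m y; exists y'.
Qed.

(** * Comparison with a given injective resolution *)

Section Injres.
Variables (N : gmod A) (F : injres N).

(** The kernels [Z j] are the cosyzygies of the resolution, and each sequence from [Z j] through
    [res F j] to [Z j.+1] is one step of dimension shifting. *)
Lemma lc_vanish_injres i n : lc_vanish i N n <->
  forall z : res F i.+1 n, torsion z -> res_d F i.+1 n z = 0 ->
    exists2 y, torsion y & z = res_d F i n y.
Proof.
pose Z j := gsub (gker_sub (res_d F j)); pose inc j := gincl (gker_sub (res_d F j)).
have incK j m (y : Z j m) : res_d F j m (inc j m y) = 0.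
  by apply/eqP; have := gincl_in y.
have incS j m x : res_d F j m x = 0 -> exists y : Z j m, inc j m y = x.
  by move=> h; apply: gincl_surj; rewrite unfold_in h.
have exb j : exists b : ghom (res F j) (Z j.+1), forall m x, inc j.+1 m (b m x) = res_d F j m x.
  apply: (glift (g := res_d F j)); first exact: gincl_inj.
  move=> m x; have [|y <-] := incS j.+1 m (res_d F j m x); last by exists y.
  by apply/res_exactS; exists x.
(* The statement is generalized to start at an arbitrary cosyzygy, so that induction on [i] can move
   [j]. *)
suff key j N' (a : ghom N' (res F j)) : gmono a ->
    (forall m x, res_d F j m x = 0 <-> exists y, x = a m y) ->
    lc_vanish i N' n <-> forall z : res F (j + i).+1 n, torsion z -> res_d F (j + i).+1 n z = 0 ->
    exists2 y, torsion y & z = res_d F (j + i) n y.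
  by apply: (key 0%N N (res_aug F)); [exact: res_aug_inj | exact: res_exact0].
elim: i j N' a => [|i IH] j N' a am ax; have [b bE] := exb j;
have s : ses a b.
- split=> // m y.
  + have [x xE] : exists x, inc j.+1 m y = res_d F j m x by apply/res_exactS/incK.
    by exists x; apply: (@gincl_inj _ _ _ _ (gker_sub (res_d F j.+1))); rewrite bE xE.
  + apply: (@gincl_inj _ _ _ _ (gker_sub (res_d F j.+1))); rewrite bE linear0.
    by apply/ax; exists y.
  + by move=> h; apply/ax; rewrite -bE h linear0.
- rewrite (lc_vanish0P _ (@res_ginjective _ _ _ F j) s) addn0; split=> o z tz.
    move=> dz; have [y yz] := incS _ _ _ dz.
    have ty : torsion y.
      by apply: (tors_mono (f := inc j.+1)); [exact: gincl_inj | rewrite yz].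
    by have [x tx xy] := o y ty; exists x => //; rewrite -bE xy yz.
  have [x tx xE] := o (inc j.+1 n z) (tors_hom _ tz) (incK _ _ _).
  by exists x => //; apply: (@gincl_inj _ _ _ _ (gker_sub (res_d F j.+1))); rewrite bE xE.
- split=> // m y.
  + have [x xE] : exists x, inc j.+1 m y = res_d F j m x by apply/res_exactS/incK.
    by exists x; apply: (@gincl_inj _ _ _ _ (gker_sub (res_d F j.+1))); rewrite bE xE.
  + apply: (@gincl_inj _ _ _ _ (gker_sub (res_d F j.+1))); rewrite bE linear0.
    by apply/ax; exists y.
  + by move=> h; apply/ax; rewrite -bE h linear0.
- rewrite (lc_vanishSP _ _ (@res_ginjective _ _ _ F j) s) -addSnnS.
  apply: (IH j.+1 _ (inc j.+1)); first exact: gincl_inj.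
  move=> m x; split=> [/incS[y <-]|[y ->]]; [by exists y | exact: incK].
Qed.

Lemma local_cohomology_nonzero j n : nonzero (local_cohomology F j n) <->
  exists z : res F j n, [/\ torsion z, res_d F j n z = 0 & ~ coboundary z].
Proof.
have cb (x y : res F j n) c : coboundary x -> coboundary y -> coboundary (c *: x + y).
  move: x y; rewrite /coboundary; case: (j) => [|j'] x y.
    by move=> -> ->; rewrite scaler0 addr0.
  move=> [x' tx ->] [y' ty ->]; exists (c *: x' + y'); first exact: torsP.
  by rewrite linearP.
have cb0 : coboundary (0 : res F j n).
  rewrite /coboundary; case: (j) => [|j'] //; exists 0; first exact: tors0.
  by rewrite linear0.
have spanE (z : cocycle F j n) :
    (z \in Defs.span (fun z : cocycle F j n => coboundary (val z))) <-> coboundary (val z).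
  split=> [/asboolP h|h]; last exact: Defs.mem_span.
  pose Cb : {pred cocycle F j n} := fun z => `[< coboundary (val z) >].
  have : z \in Cb.
    apply: h => [|y cy]; last by apply/asboolP.
    split; first by apply/asboolP.
    by move=> c x y /asboolP cx /asboolP cy; apply/asboolP; rewrite linearP; exact: cb.
  by move/asboolP.
split.
  move=> [x x0]; pose z := lquot_repr x.
  have /asboolP[tz dz] := valP z.
  exists (val z); split=> // /spanE; rewrite -[z]subr0 -lquot_eq /z lquot_reprK.
  by rewrite linear0 (negPf x0).
move=> [z [tz dz nz]].
have cz : cocycle_pred z by apply/asboolP.
pose w : cocycle F j n := exist _ z cz.
exists (lquot_pi (fun z : cocycle F j n => coboundary (val z)) w).
apply/eqP => h; apply: nz; apply/(spanE w).
by rewrite -[w]subr0 -lquot_eq h linear0.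
Qed.

Lemma local_cohomologyS i n : nonzero (local_cohomology F i.+1 n) <-> ~ lc_vanish i N n.
Proof.
rewrite local_cohomology_nonzero lc_vanish_injres; split.
  by move=> [z [tz dz nz]] h; apply: nz; exact: h.
move=> h; apply: contrapT => nz; apply: h => z tz dz.
by apply: contrapT => nb; apply: nz; exists z.
Qed.

Lemma local_cohomology0 n : nonzero (local_cohomology F 0 n) <->
  exists2 x : N n, torsion x & x != 0.
Proof.
rewrite local_cohomology_nonzero; split.
  move=> [z [tz /res_exact0[y yz] /eqP nz]]; exists y.
    by apply: (tors_mono (@res_aug_inj _ _ _ F)); rewrite -yz.
  by apply: contraNneq nz => y0; rewrite yz y0 linear0.
move=> [x tx x0]; exists (res_aug F n x); split; first exact: tors_hom.
  by apply/res_exact0; exists x.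
move=> /= /(gmono_eq0 (@res_aug_inj _ _ _ F)) e; by rewrite e eqxx in x0.
Qed.
End Injres.
End HV.

(** * Localization at the linear forms *)

Section Pow.
Variables (K : fieldType) (A : galg K).

Fixpoint gpow (f : A 1%N) (k : nat) : A k :=
  if k is k'.+1 then amul (add1n k') f (gpow f k') else aone A.

End Pow.

Section Localization.
Variables (K : fieldType) (A : galg K) (r : nat) (x : 'I_r -> A 1%N) (Y : gmod A).

(** The family [s] stands for the fractions [s k i / x_i^k], one for each [i], of degree [n]. Only
    large [k] matters: [compat] makes the fractions of one family agree eventually, and [evnull]
    describes zero. The quotient [loc] is the product of the localizations of [Y] at the [x_i]. *)
Definition seqs (n : int) : lmodType K :=
  dprod (fun k : nat => dprod (fun i : 'I_r => Y (n + k%:Z))).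

Fact seqs_deg i n m (k : nat) : n + i%:Z = m -> n + k%:Z + i%:Z = m + k%:Z :> int.
Proof. by move=> <-; rewrite addrAC. Qed.

Definition gseq : gmod A.
Proof.
refine (@GMod K A seqs
  (fun i n m e a s => (fun k j => gact (seqs_deg k e) a (s k j)) : seqs m) _ _ _ _).
- move=> i n m e s c a b; do 2 (apply/functional_extensionality_dep => ?).
  by rewrite !dprodE gact_linearl.
- move=> i n m e a c s t; do 2 (apply/functional_extensionality_dep => ?).
  by rewrite !dprodE gact_linearr.
- move=> *; do 2 (apply/functional_extensionality_dep => ?); exact: gactA.
- move=> n e s; apply/functional_extensionality_dep => k.
  apply/functional_extensionality_dep => j.
  by rewrite (gact_irr _ (addr0 _)) gact1.
Defined.

Fact seqs_degS n k : n + k%:Z + 1%N%:Z = n + k.+1%:Z :> int.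
Proof. lia. Qed.

Definition compat n : {pred gseq n} := fun s =>
  `[< exists k0, forall k j, (k0 <= k)%N ->
      s k.+1 j = gact (seqs_degS n k) (x j) (s k j) >].

Definition evnull n (s : gseq n) : Prop :=
  exists k0, forall k j, (k0 <= k)%N -> s k j = 0.

Fact compat_sub : gsubmodule compat.
Proof.
split=> [n|i n m e a s /asboolP[k0 h]].
  split; first by apply/asboolP; exists 0%N => k j _; rewrite !dprodE gact0.
  move=> c s t /asboolP[k1 h1] /asboolP[k2 h2]; apply/asboolP.
  exists (maxn k1 k2) => k j; rewrite geq_max => /andP[l1 l2].
  by rewrite !dprodE h1 // h2 // gact_linearr.
apply/asboolP; exists k0 => k j kk /=; rewrite h //; exact: gactC.
Qed.

Let Cp := gsub compat_sub.
Let inc := gincl compat_sub.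

Definition nullp n : {pred Cp n} := fun s => `[< evnull (inc n s) >].

Fact null_sub : gsubmodule nullp.
Proof.
split=> [n|i n m e a s /asboolP[k0 h]].
  split; first by apply/asboolP; exists 0%N.
  move=> c s t /asboolP[k1 h1] /asboolP[k2 h2]; apply/asboolP.
  exists (maxn k1 k2) => k j; rewrite geq_max => /andP[l1 l2].
  have -> : inc n (c *: s + t) = c *: inc n s + inc n t by exact: linearP.
  by rewrite !dprodE h1 // h2 // scaler0 addr0.
apply/asboolP; exists k0 => k j kk.
have -> : inc m (gact e a s) = gact e a (inc n s) by exact: ghom_act.
by rewrite /= [X in gact _ _ X]h // gact0.
Qed.

Definition loc : gmod A := gquot null_sub.
Definition locpi : ghom Cp loc := gpi null_sub.

Lemma locpi_eq n (s t : Cp n) :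
  (exists k0, forall k j, (k0 <= k)%N -> inc n s k j = inc n t k j) ->
  locpi n s = locpi n t.
Proof.
move=> [k0 h]; apply/gpi_eq/asboolP; exists k0 => k j kk.
have -> : inc n (s - t) = inc n s - inc n t by exact: linearB.
by rewrite !dprodE h // subrr.
Qed.

Definition diag n (y : Y n) : seqs n := fun k j => gact (erefl (n + k%:Z)) (gpow (x j) k) y.

Fact diag_in n (y : Y n) : diag y \in @compat n.
Proof.
apply/asboolP; exists 0%N => k j _; rewrite /diag.
by rewrite (gactA (add1n k) _ _ (erefl (n + k.+1%:Z))).
Qed.

Definition diagh : ghom Y Cp.
Proof.
refine (@mkhom K A Y Cp (fun n y => Subm (proj1 compat_sub n) (diag_in y)) _ _).
  move=> n c y z; apply: val_inj; rewrite [RHS]linearP /=.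
  do 2 (apply/functional_extensionality_dep => ?).
  by rewrite /diag !dprodE gact_linearr.
move=> i n m e a y; apply: val_inj => /=.
apply/functional_extensionality_dep => k; apply/functional_extensionality_dep => j.
exact: gactC.
Defined.

Lemma loc_ker n (y : Y n) : locpi n (diagh n y) = 0 <->
  exists k0, forall k j, (k0 <= k)%N -> gact (erefl (n + k%:Z)) (gpow (x j) k) y = 0.
Proof.
rewrite gpi_eq0; split=> [/asboolP[k0 h]|[k0 h]].
  by exists k0 => k j kk; exact: (h k j kk).
by apply/asboolP; exists k0 => k j kk; exact: h.
Qed.

Fact sh_deg n k : n + k%:Z + 0%N%:Z = n - 1 + k.+1%:Z :> int.
Proof. lia. Qed.

(* Division by x i on the i-th factor, zero on the other factors. *)
Definition divs (i : 'I_r) n (s : seqs n) : seqs (n - 1) := fun k =>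
  match k return dprod (fun j : 'I_r => Y (n - 1 + k%:Z)) with
  | 0%N => 0
  | k'.+1 => fun j => if j == i then gcast (sh_deg n k') (s k' j) else 0
  end.

Fact divs_in i n (s : seqs n) : s \in @compat n -> divs i s \in @compat (n - 1).
Proof.
move=> /asboolP[k0 h]; apply/asboolP; exists k0.+1 => -[|k] j //; rewrite ltnS => kk /=.
case: eqP => _; last by rewrite gact0.
have e2 : n + k%:Z + 1%N%:Z = n - 1 + k.+2%:Z by lia.
by rewrite h // (gcast_act _ _ e2) (gact_cast _ _ e2).
Qed.

Definition divh (i : 'I_r) : ghom Cp (shift Cp (- 1)).
Proof.
refine (@mkhom K A Cp (shift Cp (- 1))
  (fun n s => Subm (proj1 compat_sub (n - 1)) (divs_in i (submP s))) _ _).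
  move=> n c s t; apply: val_inj; rewrite [RHS]linearP /=.
  apply/functional_extensionality_dep => -[|k]; apply/functional_extensionality_dep => j.
    by change (0 = c *: 0 + 0 :> Y (n - 1 + 0%N%:Z)); rewrite scaler0 add0r.
  rewrite !dprodE /=; case: eqP => _; last by rewrite scaler0 add0r.
  by rewrite -gcast_linear.
move=> d n m e a s; apply: val_inj => /=.
apply/functional_extensionality_dep => -[|k]; apply/functional_extensionality_dep => j /=.
  by rewrite !dprodE gact0.
case: eqP => _; last by rewrite gact0.
have e2 : n + k%:Z + d%:Z = m - 1 + k.+1%:Z by lia.
by rewrite (gcast_act _ _ e2) (gact_cast _ _ e2).
Defined.

(** With [g i] the division by [x_i] on the [i]-th factor, [x_i g_i] is the projection onto that
    factor: idempotent, with sum the identity. *)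
Lemma loc_exists : exists (D : gmod A) (eta : ghom Y D)
    (g : 'I_r -> ghom D (shift D (- 1))),
  [/\ forall n y, eta n y = 0 <->
        exists k0, forall k j, (k0 <= k)%N -> gact (erefl (n + k%:Z)) (gpow (x j) k) y = 0,
      forall n z, z = \sum_i gmulhom (x i) (g i) z :> D n &
      forall i n (z : D n), gmulhom (x i) (g i) (gmulhom (x i) (g i) z)
         = gmulhom (x i) (g i) z].
Proof.
have exg i : exists G : ghom loc (shift loc (- 1)),
    forall n s, G n (locpi n s) = locpi (n - 1) (divh i n s).
  apply: (gfactor (g := gcompo (gshift locpi (- 1)) (divh i))); first exact: gpi_surj.
  move=> n s /gpi_eq0/asboolP[k0 h]; apply/gpi_eq0/asboolP; exists k0.+1.
  move=> [|k] j //; rewrite ltnS => kk /=; case: eqP => // _.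
  by rewrite [X in gcast _ X]h // /gcast gact0.
pose G i := sval (cid (exg i)).
have GE i n s : G i n (locpi n s) = locpi (n - 1) (divh i n s) by rewrite /G; case: cid.
have dE i n (s : Cp n) k j :
   inc n (gmulhom (x i) (divh i) s) k.+1 j =
   if j == i then gact (seqs_degS n k) (x i) (inc n s k j) else 0.
  rewrite /gmulhom; transitivity (gact (seqs_deg k.+1 (subrK 1 n)) (x i) (divs i (val s) k.+1 j)); first by [].
  by rewrite /=; case: eqP => _; [rewrite (gact_cast _ _ (seqs_degS n k)) | rewrite gact0].
have mE i n s : gmulhom (x i) (G i) (locpi n s) = locpi n (gmulhom (x i) (divh i) s).
  by rewrite /gmulhom GE ghom_act.
have sC n (s : Cp n) : exists k0, forall k j, (k0 <= k)%N ->
      inc n s k.+1 j = gact (seqs_degS n k) (x j) (inc n s k j).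
  by have /asboolP := gincl_in s.
exists loc, (gcompo locpi diagh), G; split.
- by move=> n y; exact: loc_ker.
- move=> n z; have [s <-] := gpi_surj z; under eq_bigr => i _ do rewrite mE.
  rewrite -linear_sum; apply: locpi_eq; have [k0 h] := sC n s.
  exists k0.+1 => -[|k] j //; rewrite ltnS => kk.
  have -> : inc n (\sum_i gmulhom (x i) (divh i) s) =
      \sum_i inc n (gmulhom (x i) (divh i) s) by exact: linear_sum.
  have ev (F : 'I_r -> gseq n) : (\sum_i F i) k.+1 j = \sum_i F i k.+1 j.
    have L : linear (fun s : gseq n => s k.+1 j) by [].
    exact: (linS L).
  rewrite ev (bigD1 j) // big1 ?addr0; last first.
    by move=> i ij; rewrite dE eq_sym (negPf ij).
  by rewrite dE eqxx /= addr0; exact: h.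
- move=> i n z; have [s zs] := gpi_surj z; have {zs} <- : locpi n s = z by [].
  rewrite (mE i n s) mE; apply: locpi_eq; have [k0 h] := sC n s.
  (* Each division moves the index by one, so compatibility is available only two steps after
     [k0]. *)
  exists k0.+2 => -[|[|k]] j // kk; rewrite !dE; case: eqP => // ->.
  by symmetry; congr gact; apply: h; lia.
Qed.

End Localization.

(** * Koszul complexes on powers *)

Section Koszul.
Variables (R : comNzRingType) (W : lmodType R).
Implicit Types (c b : seq bool -> W) (fs xs : seq R) (l : seq bool).

Lemma closedZ (P : {pred W}) a w : submod_closed P -> w \in P -> a *: w \in P.
Proof. by move=> [P0 Pl] Pw; rewrite -[_ *: _]addr0; apply: (Pl). Qed.
Lemma closedD (P : {pred W}) v w : submod_closed P -> v \in P -> w \in P -> v + w \in P.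
Proof. by move=> [P0 Pl] Pv Pw; rewrite -[v]scale1r; apply: (Pl). Qed.
Lemma closedB (P : {pred W}) v w : submod_closed P -> v \in P -> w \in P -> v - w \in P.
Proof. by move=> [P0 Pl] Pv Pw; rewrite addrC -scaleN1r; apply: (Pl). Qed.

(* The Koszul differential, as an iterated mapping cone; the component of a    *)
(* cochain at a subset of the sequence fs is indexed by its bit mask.          *)
Fixpoint koszul_d fs c l : W :=
  match fs, l with
  | f :: fs', true :: l' => f *: c (false :: l') - koszul_d fs' (fun m => c (true :: m)) l'
  | f :: fs', false :: l' => koszul_d fs' (fun m => c (false :: m)) l'
  | _, _ => 0
  end.

Lemma koszul_d_linear fs a c b l :
  koszul_d fs (fun m => a *: c m + b m) l = a *: koszul_d fs c l + koszul_d fs b l.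
Proof.
elim: fs c b l => [|f fs IH] c b [|[] l] /=; rewrite ?scaler0 ?addr0 //.
rewrite IH scalerDr scalerBr !scalerA [f * a]mulrC opprD addrACA.
by [].
Qed.

Lemma koszul_d0 fs l : koszul_d fs (fun=> 0) l = 0.
Proof. by elim: fs l => [|f fs IH] [|[] l] //=; rewrite IH scaler0 subr0. Qed.

Lemma koszul_dD fs c b l : koszul_d fs (fun m => c m + b m) l = koszul_d fs c l + koszul_d fs b l.
Proof. by rewrite -[koszul_d fs c l]scale1r -koszul_d_linear; congr koszul_d; apply/funext => m; rewrite scale1r. Qed.

Lemma koszul_dZ fs a c l : koszul_d fs (fun m => a *: c m) l = a *: koszul_d fs c l.
Proof.
rewrite -[RHS]addr0 -(koszul_d0 fs l) -koszul_d_linear; congr koszul_d; apply/funext => m.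
by rewrite addr0.
Qed.

Lemma koszul_dB fs c b l : koszul_d fs (fun m => c m - b m) l = koszul_d fs c l - koszul_d fs b l.
Proof.
rewrite -scaleN1r addrC -koszul_d_linear; congr koszul_d; apply/funext => m.
by rewrite scaleN1r addrC.
Qed.

Lemma koszul_d_closed fs (P : {pred W}) c : submod_closed P -> (forall l, c l \in P) ->
  forall l, koszul_d fs c l \in P.
Proof.
move=> hP; have P0 : 0 \in P by case: hP.
elim: fs c => [|f fs IH] c h [|[] l] //=.
  apply: closedB => //; first exact: closedZ.
  by apply: IH => m; exact: h.
by apply: IH => m; exact: h.
Qed.

Lemma koszul_dd fs c l : koszul_d fs (koszul_d fs c) l = 0.
Proof.
elim: fs c l => [|f fs IH] c [|[] l] //=.
by rewrite koszul_dB koszul_dZ (IH (fun m => c (true :: m)) l) subr0 subrr.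
Qed.

(** Contraction against the [i]-th element, with the signs of the iterated cone. By [koszul_d_kh] it
    is a null homotopy for multiplication by that element. *)
Fixpoint koszul_h (i : nat) c l : W :=
  match i, l with
  | 0, b :: l' => if b then 0 else c (true :: l')
  | i'.+1, b :: l' =>
      let w := koszul_h i' (fun m => c (b :: m)) l' in if b then - w else w
  | _, [::] => 0
  end.

Lemma koszul_h_linear i a c b l :
  koszul_h i (fun m => a *: c m + b m) l = a *: koszul_h i c l + koszul_h i b l.
Proof.
elim: i c b l => [|i IH] c b [|[] l] /=; rewrite ?scaler0 ?addr0 //.
by rewrite IH opprD scalerN.
Qed.

Lemma koszul_h_closed i (P : {pred W}) c : submod_closed P -> (forall l, c l \in P) ->
  forall l, koszul_h i c l \in P.
Proof.
move=> hP; have P0 : 0 \in P by case: hP.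
elim: i c => [|i IH] c h [|[] l] //=; last by apply: IH => m; exact: h.
by rewrite -scaleN1r; apply: closedZ => //; apply: IH => m; exact: h.
Qed.

Lemma koszul_d_kh fs i c l : (i < size fs)%N -> size l = size fs ->
  koszul_d fs (koszul_h i c) l + koszul_h i (koszul_d fs c) l = nth 0 fs i *: c l.
Proof.
elim: fs i c l => [|f fs IH] [|i] c [|b l] //= il [sl].
  case: b; first by rewrite koszul_d0 subr0 addr0.
  by rewrite addrC subrK.
case: b => /=; last exact: (IH i (fun m => c (false :: m)) l il sl).
have -> : koszul_h i (fun m => f *: c (false :: m) - koszul_d fs (fun n => c (true :: n)) m) l =
   f *: koszul_h i (fun m => c (false :: m)) l - koszul_h i (koszul_d fs (fun n => c (true :: n))) l.
  rewrite -scaleN1r [LHS](_ : _ = koszul_h i (fun m => f *: c (false :: m) + (-1) *: koszul_d fs (fun n => c (true :: n)) m) l).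
    rewrite koszul_h_linear; congr (_ + _).
    have := koszul_h_linear i (-1) (koszul_d fs (fun n => c (true :: n))) (fun=> 0) l.
    have k0 : koszul_h i (fun=> 0 : W) l = 0.
      by elim: (i) (l) => [|? IH'] [|[] ?] //=; rewrite IH' oppr0.
    by rewrite k0 addr0 => <-; congr koszul_h; apply/funext => m; rewrite addr0.
  by congr koszul_h; apply/funext => m; rewrite scaleN1r.
have -> : koszul_d fs (fun m => - koszul_h i (fun n => c (true :: n)) m) l = - koszul_d fs (koszul_h i (fun n => c (true :: n))) l.
  by rewrite -[RHS]scaleN1r -koszul_dZ; congr koszul_d; apply/funext => m; rewrite scaleN1r.
by rewrite opprK opprB -(IH i (fun n => c (true :: n)) l il sl) addrC addrA subrK addrC.
Qed.

(** [Q] selects the cohomological degree. Being a predicate, it can express degree [j - 1] as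
    [q.+1 = j], which is empty for [j = 0]. *)
Definition wt (r : nat) (Q : nat -> Prop) c :=
  forall l, c l != 0 -> size l = r /\ Q (count id l).

Lemma wtE r Q c l : wt r Q c -> ~ (size l = r /\ Q (count id l)) -> c l = 0.
Proof. by move=> w n; apply/eqP; apply: contrapT => /negP /w. Qed.

Lemma wt_koszul_d fs Q c : wt (size fs) Q c ->
  wt (size fs) (fun k => exists2 k', k = k'.+1 & Q k') (koszul_d fs c).
Proof.
elim: fs Q c => [|f fs IH] Q c w [|[] l] /=; rewrite ?eqxx //.
  move=> h; have [e|n0] := eqVneq (c (false :: l)) 0.
    move: h; rewrite e scaler0 sub0r oppr_eq0 => h.
    have w' : wt (size fs) (fun k => Q k.+1) (fun m => c (true :: m)).
      by move=> m /w /= [[->]].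
    by have [-> [k' -> q]] := IH _ _ w' _ h; split=> //; exists k'.+1.
  by have [/= [->] q] := w _ n0; split=> //; exists (count id l).
have w' : wt (size fs) Q (fun m => c (false :: m)) by move=> m /w /= [[->]].
by move=> /(IH _ _ w')[-> h].
Qed.

Lemma wt_koszul_h r i Q c : wt r Q c -> wt r (fun k => Q k.+1) (koszul_h i c).
Proof.
elim: i r Q c => [|i IH] r Q c w [|[] l] /=; rewrite ?eqxx //; first by move/w.
  rewrite oppr_eq0; case: r w => [|r] w h.
    have w' : wt 0 (fun=> False) (fun m => c (true :: m)) by move=> m /w[].
    by have [] := IH _ _ _ w' _ h.
  have w' : wt r (fun k => Q k.+1) (fun m => c (true :: m)) by move=> m /w /= [[->]].
  by have [-> ?] := IH _ _ _ w' _ h.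
case: r w => [|r] w h.
  have w' : wt 0 (fun=> False) (fun m => c (false :: m)) by move=> m /w[].
  by have [] := IH _ _ _ w' _ h.
have w' : wt r Q (fun m => c (false :: m)) by move=> m /w /= [[->]].
by have [-> ?] := IH _ _ _ w' _ h.
Qed.

Lemma wt_lin r Q a c b : wt r Q c -> wt r Q b -> wt r Q (fun l => a *: c l + b l).
Proof.
move=> wc wb l n0; have [c0|] := eqVneq (c l) 0; last exact: wc.
by apply: wb; apply: contraNneq n0 => b0; rewrite c0 b0 scaler0 addr0.
Qed.

Lemma wt_add r Q c b : wt r Q c -> wt r Q b -> wt r Q (fun l => c l + b l).
Proof.
move=> wc wb l; have := wt_lin (a := 1) wc wb (l := l).
by rewrite scale1r.
Qed.

Definition powers k xs := map (fun f : R => f ^+ k) xs.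

(** Coefficient, at the mask [l], of the transition map that raises the exponents of the Koszul
    complex by [k]; see [koszul_d_mask_pow]. *)
Fixpoint mask_pow k xs l : R :=
  match xs, l with
  | x :: xs', b :: l' => (if b then x ^+ k else 1) * mask_pow k xs' l'
  | _, _ => 1
  end.

Lemma koszul_d_mask_pow k t xs c l :
  koszul_d (powers (k + t) xs) (fun m => mask_pow t xs m *: c m) l = mask_pow t xs l *: koszul_d (powers k xs) c l.
Proof.
elim: xs c l => [|x xs IH] c [|[] l] /=; rewrite ?scaler0 //; last first.
  rewrite mul1r -IH; congr koszul_d; apply/funext => m; by rewrite mul1r.
rewrite mul1r scalerBr !scalerA; congr (_ - _).
  by congr (_ *: _); rewrite exprD -mulrA mulrC.
rewrite -scalerA -IH -koszul_dZ; congr koszul_d; apply/funext => m; by rewrite scalerA.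
Qed.

Lemma mask_powD t t' xs l : mask_pow (t + t') xs l = mask_pow t' xs l * mask_pow t xs l.
Proof.
elim: xs l => [|x xs IH] [|b l] /=; rewrite ?mulr1 // IH mulrACA; congr (_ * _).
by case: b; rewrite ?mulr1 // exprD mulrC.
Qed.

Lemma mask_pow0 xs l : mask_pow 0 xs l = 1.
Proof. by elim: xs l => [|x xs IH] [|[] l] //=; rewrite IH mulr1. Qed.

Lemma mask_pow_pos t xs l : size l = size xs -> (0 < count id l)%N ->
  exists x a, x \in xs /\ mask_pow t xs l = a * x ^+ t.
Proof.
elim: xs l => [|x xs IH] [|[] l] //= [sl] h.
  by exists x, (mask_pow t xs l); rewrite mem_head mulrC.
have [y [a [yx ->]]] := IH _ sl h; exists y, a; rewrite mul1r; split=> //.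
by rewrite inE yx orbT.
Qed.

Lemma wt_mask_pow r Q (a : seq bool -> R) c : wt r Q c -> wt r Q (fun l => a l *: c l).
Proof. by move=> w l h; apply: w; apply: contraNneq h => ->; rewrite scaler0. Qed.

(** * Vanishing of Koszul cohomology below the depth *)

Section Depth.
Variables (fs : seq R) (a : nat -> R) (d : nat) (B : {pred W}) (A : nat -> {pred W}).
Hypothesis (hB : submod_closed B) (hA : forall i, submod_closed (A i)).
Hypothesis AS : forall i, (i < d)%N -> {subset A i <= A i.+1}.
Hypothesis aB : forall i, (i < d)%N -> forall w, w \in B -> a i *: w \in A i.+1.
Hypothesis A_gen : forall i, (i < d)%N -> forall w, w \in A i.+1 ->
  exists2 g, g \in B & w - a i *: g \in A i.
Hypothesis a_reg : forall i, (i < d)%N -> forall w, w \in B -> a i *: w \in A i -> w \in A i.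
Hypothesis a_nil : forall i, (i < d)%N -> exists N (q : nat -> R),
  a i ^+ N = \sum_(m < size fs) q m * nth 0 fs m.

(** Degree [j] Koszul cohomology of [B / A i] vanishes. The hypotheses describe [A i] as generated
    by the first [i] elements of a regular sequence, each nilpotent modulo the ideal of [fs]. *)
Let KV i j := forall c,
  wt (size fs) (fun k => k = j) c -> (forall l, c l \in B) ->
  (forall l, koszul_d fs c l \in A i) ->
  exists b, [/\ wt (size fs) (fun k => k.+1 = j) b, forall l, b l \in B &
    forall l, c l - koszul_d fs b l \in A i].

(** If [a_i e] is a boundary [d b] modulo [A i], then [b] is a cocycle modulo [A i.+1], hence
    [b = d b2 + a_i g] modulo [A i]. Therefore [a_i (e - d g)] lies in [A i], and regularity cancels
    [a_i]. *)
Lemma koszul_descent i j e b : (i < d)%N -> (forall j', j = j'.+1 -> KV i.+1 j') ->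
  wt (size fs) (fun k => k = j) e -> (forall l, e l \in B) ->
  wt (size fs) (fun k => k.+1 = j) b -> (forall l, b l \in B) ->
  (forall l, a i *: e l - koszul_d fs b l \in A i) ->
  exists b', [/\ wt (size fs) (fun k => k.+1 = j) b', forall l, b' l \in B &
    forall l, e l - koszul_d fs b' l \in A i].
Proof.
move=> id prev we eB wb bB h; case: j prev we wb => [|j] prev we wb.
  have b0 : b = fun=> 0.
    by apply/funext => l; apply: (wtE wb) => -[_].
  exists (fun=> 0); split.
  - by move=> l; rewrite eqxx.
  - by move=> l; case: hB.
  - move=> l; rewrite koszul_d0 subr0; apply: (a_reg id) => //.
    by have := h l; rewrite b0 koszul_d0 subr0.
have [|//||b2 [wb2 b2B hb2]] := prev j erefl b.
- by move=> l /wb [-> [->]].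
- move=> l; rewrite -[koszul_d fs b l](subKr (a i *: e l)); apply: closedB => //.
    exact: aB.
  by apply: AS.
have exg l : exists2 g, g \in B & b l - koszul_d fs b2 l - a i *: g \in A i.
  exact: A_gen (hb2 l).
(* Choosing [0] wherever the left side vanishes keeps [g] supported in the right degree. *)
pose g l := if b l - koszul_d fs b2 l == 0 then 0 else sval (cid2 (exg l)).
have gB l : g l \in B.
  by rewrite /g; case: ifP => _; [case: hB | case: cid2].
have gA l : b l - koszul_d fs b2 l - a i *: g l \in A i.
  rewrite /g; case: eqP => [->|_]; last by case: cid2.
  by rewrite scaler0 subr0; case: (hA i).
have wg : wt (size fs) (fun k => k.+1 = j.+1) g.
  move=> l; rewrite /g; case: ifP => [_|/negbT n0 _]; first by rewrite eqxx.
  have [b0|] := eqVneq (b l) 0; last exact: wb.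
  have : koszul_d fs b2 l != 0 by apply: contraNneq n0 => k0; rewrite b0 k0 subrr.
  by move/(wt_koszul_d wb2) => [-> [k' -> ->]].
exists g; split=> // l; apply: (a_reg id).
  by apply: closedB => //; apply: koszul_d_closed.
have -> : a i *: (e l - koszul_d fs g l) = (a i *: e l - koszul_d fs b l)
    + koszul_d fs (fun m => b m - koszul_d fs b2 m - a i *: g m) l.
  by rewrite !koszul_dB koszul_dd koszul_dZ subr0 addrA subrK scalerBr.
by apply: closedD => //; apply: koszul_d_closed.
Qed.

Lemma koszul_d_sum (I : Type) (s : seq I) (F : I -> seq bool -> W) l :
  koszul_d fs (fun m => \sum_(i <- s) F i m) l = \sum_(i <- s) koszul_d fs (F i) l.
Proof.
elim: s => [|i s IH].
  by rewrite big_nil -[RHS](koszul_d0 fs l); congr koszul_d; apply/funext => m; rewrite big_nil.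
rewrite big_cons -IH -koszul_dD; congr koszul_d; apply/funext => m; by rewrite big_cons.
Qed.

Lemma closed_sum (P : {pred W}) (I : Type) (s : seq I) (F : I -> W) :
  submod_closed P -> (forall i, F i \in P) -> \sum_(i <- s) F i \in P.
Proof.
move=> hP h; elim: s => [|i s IH]; first by rewrite big_nil; case: hP.
by rewrite big_cons; apply: closedD.
Qed.

(** A power [a_i^N] is a combination of the [fs], so the same combination of contractions makes
    [a_i^N c] a boundary modulo [A i]. Descent then removes the factors [a_i] one at a time. *)
Lemma koszul_step i j : (i < d)%N -> (forall j', j = j'.+1 -> KV i.+1 j') -> KV i j.
Proof.
move=> id prev c wc cB dA; have [N [q aN]] := a_nil id.
pose b l := \sum_(m < size fs) q m *: koszul_h m c l.
have bB l : b l \in B.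
  by apply: closed_sum => // m; apply: closedZ => //; apply: koszul_h_closed.
have wb : wt (size fs) (fun k => k.+1 = j) b.
  move=> l n0; have [m mn0] : exists m : 'I_(size fs), koszul_h m c l != 0.
    apply: contrapT => no; move: n0; rewrite /b big1 ?eqxx // => m _.
    have [->|n0] := eqVneq (koszul_h m c l) 0; first by rewrite scaler0.
    by case: no; exists m.
  exact: (wt_koszul_h wc mn0).
have key l : a i ^+ N *: c l - koszul_d fs b l \in A i.
  have [sl|sl] := eqVneq (size l) (size fs).
    rewrite aN /b koszul_d_sum scaler_suml -sumrB; apply: closed_sum => // m.
    rewrite koszul_dZ -scalerA -scalerBr -(koszul_d_kh c _ sl) // addrAC subrr add0r.
    by apply: closedZ => //; apply: koszul_h_closed.
  rewrite (wtE wc) ?scaler0 ?sub0r; last by move=> [/eqP]; rewrite (negPf sl).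
  suff -> : koszul_d fs b l = 0 by rewrite oppr0; case: (hA i).
  by apply: (wtE (wt_koszul_d wb)) => -[/eqP]; rewrite (negPf sl).
clearbody b; clear aN; elim: N b bB wb key => [|N IHN] b bB wb key.
  by exists b; split=> // l; have := key l; rewrite expr0 scale1r.
have [||l|b' [wb' b'B h']] := @koszul_descent i j (fun l => a i ^+ N *: c l) b id prev _ _ wb bB.
- exact: wt_mask_pow.
- by move=> l; apply: closedZ.
- by rewrite scalerA -exprS; exact: key.
- exact: (IHN b').
Qed.

Lemma koszul_depth j i : (i + j < d)%N -> KV i j.
Proof.
elim: j i => [|j IH] i ijd; have id : (i < d)%N by lia.
  exact: (koszul_step id).
by apply: (koszul_step id) => j' [<-]; apply: IH; lia.
Qed.
End Depth.

(** * Colimits of Koszul cohomology over powers *)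

Section colim_vanish.
Variable xs : seq R.
Let r := size xs.

(* The class of the cochain c of level k becomes zero in the colimit of the    *)
(* Koszul complexes of the powers of xs on B / A.                              *)
Definition colim_boundary (B A : {pred W}) j k c : Prop := exists t b,
  [/\ wt r (fun q => q.+1 = j) b, forall l, b l \in B &
      forall l, mask_pow t xs l *: c l - koszul_d (powers (k + t) xs) b l \in A].

Definition colim_vanish (B A : {pred W}) j : Prop := forall k c,
  wt r (fun q => q = j) c -> (forall l, c l \in B) ->
  (forall l, koszul_d (powers k xs) c l \in A) -> colim_boundary B A j k c.

Lemma size_powers k : size (powers k xs) = r. Proof. by rewrite size_map. Qed.

Lemma wt_koszul_dr Q k c : wt r Q c -> wt r (fun q => exists2 q', q = q'.+1 & Q q') (koszul_d (powers k xs) c).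
Proof. by rewrite -(size_powers k) => w; exact: wt_koszul_d. Qed.

(** Long exact sequence for [C / A], [B / A], [B / C]: a bound modulo [C] leaves a cocycle in [C],
    which bounds modulo [A] at a later level. *)
Lemma colim_vanish_ext (A C B : {pred W}) j : submod_closed A -> submod_closed C -> submod_closed B ->
  {subset A <= C} -> {subset C <= B} -> colim_vanish B C j -> colim_vanish C A j -> colim_vanish B A j.
Proof.
move=> hA hC hB AC CB v1 v2 k c wc cB dA.
have [|t [b [wb bB hb]]] := v1 k c wc cB; first by move=> l; apply: AC.
pose c1 l := mask_pow t xs l *: c l - koszul_d (powers (k + t) xs) b l.
have wc1 : wt r (fun q => q = j) c1.
  move=> l n0; have [c0|] := eqVneq (c l) 0; last exact: wc.
  have : koszul_d (powers (k + t) xs) b l != 0.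
    by apply: contraNneq n0 => k0; rewrite /c1 c0 k0 scaler0 subrr.
  by move/(wt_koszul_dr wb) => [-> [q -> ->]].
have [//||t2 [b2 [wb2 b2C h2]]] := v2 (k + t)%N c1 wc1.
  by move=> l; rewrite koszul_dB koszul_dd subr0 koszul_d_mask_pow; apply: closedZ.
exists (t + t2)%N, (fun l => mask_pow t2 xs l *: b l + b2 l); split.
- exact: (wt_add (wt_mask_pow (a := mask_pow t2 xs) wb) wb2).
- by move=> l; apply: closedD => //; [exact: closedZ | exact: CB].
- move=> l; rewrite addnA koszul_dD koszul_d_mask_pow mask_powD -scalerA opprD addrA -scalerBr; exact: h2.
Qed.

(** In positive degree every mask contains some element of [xs], so one transition already
    multiplies into [A]. *)
Lemma colim_vanish_killed (A B : {pred W}) j : submod_closed A -> (0 < j)%N ->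
  (forall x w, x \in xs -> w \in B -> x *: w \in A) -> submod_closed B -> colim_vanish B A j.
Proof.
move=> hA j0 kil hB k c wc cB dA; exists 1%N, (fun=> 0); split.
- by move=> l; rewrite eqxx.
- by move=> l; case: hB.
- move=> l; rewrite koszul_d0 subr0; have [->|n0] := eqVneq (c l) 0.
    by rewrite scaler0; case: hA.
  have [sl cl] := wc _ n0; have [|x [a [xx ->]]] := mask_pow_pos 1 sl; first by rewrite cl.
  by rewrite expr1 -scalerA; apply: closedZ => //; apply: kil.
Qed.

Definition sub_ker (x : R) (B A : {pred W}) : {pred W} := fun w => (w \in B) && (x *: w \in A).
Definition sub_im (x : R) (B A : {pred W}) : {pred W} :=
  fun w => `[< exists2 g, g \in B & w - x *: g \in A >].

Lemma sub_ker_closed x B A : submod_closed B -> submod_closed A -> submod_closed (sub_ker x B A).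
Proof.
move=> hB hA; split.
  by rewrite unfold_in scaler0; case: hB => ->; case: hA => ->.
move=> c v w /andP[v1 v2] /andP[w1 w2]; apply/andP; split.
  by case: hB => _; apply.
by rewrite scalerDr scalerA mulrC -scalerA; case: hA => _; apply.
Qed.

Lemma sub_im_closed x B A : submod_closed B -> submod_closed A -> submod_closed (sub_im x B A).
Proof.
move=> hB hA; split.
  by apply/asboolP; exists 0; [case: hB | rewrite scaler0 subr0; case: hA].
move=> c v w /asboolP[g gB vg] /asboolP[h hB' wh]; apply/asboolP; exists (c *: g + h).
  by case: hB => _; apply.
have -> : c *: v + w - x *: (c *: g + h) = c *: (v - x *: g) + (w - x *: h).
  by rewrite scalerBr scalerDr !scalerA [x * c]mulrC opprD addrACA.
by case: hA => _; apply.
Qed.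

(** The two hypotheses concern the kernel and the cokernel of multiplication by [x] on [B / A], and
    make it injective on the colimit in degree [j]. But a power of [x] kills each class, so every
    class is zero. *)
Lemma colim_vanish_step (A B : {pred W}) j x : submod_closed A -> submod_closed B ->
  {subset A <= B} -> x \in xs -> (0 < j)%N ->
  colim_vanish (sub_ker x B A) A j -> colim_vanish B (sub_im x B A) j.-1 -> colim_vanish B A j.
Proof.
move=> hA hB AB xx j0 v1 v2.
(* Injectivity: if [x c] bounds by [b], then [b] is a cocycle modulo [x B + A], so up to a boundary
   it is [x g], and [c - d g] is a cocycle with values in the kernel of [x]. *)
have inj k c : wt r (fun q => q = j) c -> (forall l, c l \in B) ->
    (forall l, koszul_d (powers k xs) c l \in A) -> colim_boundary B A j k (fun l => x *: c l) -> colim_boundary B A j k c.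
  move=> wc cB dA [t [b [wb bB hb]]].
  have [|//||t2 [b2 [wb2 b2B h2]]] := v2 (k + t)%N b.
  - by move=> l /wb[-> <-].
  - move=> l; apply/asboolP; exists (mask_pow t xs l *: c l); first exact: closedZ.
    have := hb l; rewrite !scalerA mulrC => h.
    by rewrite -opprB -scaleN1r; apply: closedZ.
  have exg l : exists2 g, g \in B & mask_pow t2 xs l *: b l - koszul_d (powers (k + t + t2) xs) b2 l - x *: g \in A.
    by have /asboolP := h2 l.
  pose y l := mask_pow t2 xs l *: b l - koszul_d (powers (k + t + t2) xs) b2 l.
  pose g l := if y l == 0 then 0 else sval (cid2 (exg l)).
  have gB l : g l \in B.
    by rewrite /g; case: ifP => _; [case: hB | case: cid2].
  have gA l : y l - x *: g l \in A.
    rewrite /g; case: eqP => [->|_]; last by case: cid2.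
    by rewrite scaler0 subr0; case: hA.
  have wg : wt r (fun q => q.+1 = j) g.
    move=> l; rewrite /g; case: ifP => [_|/negbT n0 _]; first by rewrite eqxx.
    have [b0|] := eqVneq (b l) 0; last exact: wb.
    have : koszul_d (powers (k + t + t2) xs) b2 l != 0.
      by apply: contraNneq n0 => k0; rewrite /y b0 k0 scaler0 subrr.
    by move/(wt_koszul_dr wb2) => [-> [q -> ->]]; rewrite prednK.
  pose c2 l := mask_pow (t + t2) xs l *: c l - koszul_d (powers (k + (t + t2)) xs) g l.
  have wc2 : wt r (fun q => q = j) c2.
    move=> l n0; have [c0|] := eqVneq (c l) 0; last exact: wc.
    have : koszul_d (powers (k + (t + t2)) xs) g l != 0.
      by apply: contraNneq n0 => k0; rewrite /c2 c0 k0 scaler0 subrr.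
    by move/(wt_koszul_dr wg) => [-> [q -> <-]].
  have [||t3 [b3 [wb3 b3B h3]]] := v1 (k + (t + t2))%N c2 wc2.
  - move=> l; apply/andP; split.
      by apply: closedB => //; [exact: closedZ | exact: koszul_d_closed].
    have -> : x *: c2 l = mask_pow t2 xs l *: (mask_pow t xs l *: (x *: c l) - koszul_d (powers (k + t) xs) b l)
        + koszul_d (powers (k + (t + t2)) xs) (fun m => y m - x *: g m) l.
      rewrite /c2 !koszul_dB koszul_dZ addnA koszul_dd subr0 koszul_d_mask_pow !scalerBr !scalerA addrA subrK.
      by congr (_ *: _ - _); rewrite mask_powD mulrC mulrA.
    apply: closedD => //; first exact: closedZ.
    exact: koszul_d_closed.
  - by move=> l; rewrite /c2 koszul_dB koszul_dd subr0 koszul_d_mask_pow; apply: closedZ.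
  exists (t + t2 + t3)%N, (fun l => mask_pow t3 xs l *: g l + b3 l); split.
  - exact: (wt_add (wt_mask_pow (a := mask_pow t3 xs) wg) wb3).
  - by move=> l; apply: closedD => //; [exact: closedZ | have /andP[] := b3B l].
  - move=> l; rewrite addnA koszul_dD koszul_d_mask_pow mask_powD -scalerA opprD addrA -scalerBr; exact: h3.
move=> k c wc cB dA.
(* At level [k] the complex is built on the [k]-th powers, so contraction against [x^k] shows that
   [x^k c] bounds. *)
have Zpow : colim_boundary B A j k (fun l => x ^+ k *: c l).
  pose i := index x xs; have ir : (i < r)%N by rewrite index_mem.
  exists 0%N, (koszul_h i c); split; first exact: (wt_koszul_h (i := i) wc).
    exact: koszul_h_closed.
  move=> l; rewrite mask_pow0 scale1r addn0.
  have [sl|sl] := eqVneq (size l) r.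
    have := koszul_d_kh (fs := powers k xs) (i := i) c; rewrite size_powers => /(_ l ir sl).
    rewrite (nth_map 0) // nth_index // => <-; rewrite addrAC subrr add0r.
    exact: koszul_h_closed.
  rewrite (wtE wc); last by move=> [/eqP]; rewrite (negPf sl).
  rewrite (wtE (wt_koszul_dr (wt_koszul_h (i := i) wc))); last by move=> [/eqP]; rewrite (negPf sl).
  by rewrite scaler0 subr0; case: hA.
suff desc m : colim_boundary B A j k (fun l => x ^+ m *: c l) -> colim_boundary B A j k c by exact: (desc k).
elim: m {Zpow} => [|m IHm].
  by congr colim_boundary; apply/funext => l; rewrite expr0 scale1r.
move=> h; apply/IHm/inj.
- exact: wt_mask_pow.
- by move=> l; apply: closedZ.
- by move=> l; rewrite koszul_dZ; apply: closedZ.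
- by move: h; congr colim_boundary; apply/funext => l; rewrite scalerA exprS.
Qed.

End colim_vanish.
End Koszul.

(** * Noetherian rings and Grothendieck vanishing *)

Section Noetherian.
Variable R : comNzRingType.
Implicit Types J : {pred R}.

Definition ideal J : Prop :=
  0 \in J /\ forall a u v, u \in J -> v \in J -> a * u + v \in J.

Definition noetherian : Prop := forall J : nat -> {pred R},
  (forall k, ideal (J k)) -> (forall k, {subset J k <= J k.+1}) ->
  exists k, {subset J k.+1 <= J k}.

Lemma noetherian_ind (Pr : {pred R} -> Prop) : noetherian ->
  (forall J, ideal J -> (forall J', ideal J' -> {subset J <= J'} ->
     ~ {subset J' <= J} -> Pr J') -> Pr J) ->
  forall J, ideal J -> Pr J.
Proof.
move=> noeth step J0 iJ0; apply: contrapT => nJ0.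
pose T := {J : {pred R} | ideal J /\ ~ Pr J}.
have next (J : T) : exists J' : T, {subset sval J <= sval J'} /\ ~ {subset sval J' <= sval J}.
  have [iJ nJ] := svalP J; apply: contrapT => no; apply: nJ; apply: step => // J' iJ' JJ' J'J.
  by apply: contrapT => nJ'; apply: no; exists (exist _ J' (conj iJ' nJ')).
pose nx (J : T) := sval (cid (next J)).
pose s k := iter k nx (exist _ J0 (conj iJ0 nJ0) : T).
have [k|k|k] := noeth (fun k => sval (s k)); first by case: (svalP (s k)).
  by rewrite /= /nx; case: cid => J' /= [].
by rewrite /= /nx; case: cid => J' /= [_ h] h'; apply: h.
Qed.

Definition chain J l (P : nat -> {pred R}) : Prop :=
  (forall i, (i <= l)%N -> [/\ idealr_closed (P i), prime_idealr_closed (P i)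
     & {subset J <= P i}]) /\
  (forall i, (i < l)%N -> {subset P i <= P i.+1} /\ exists2 p, p \in P i.+1 & p \notin P i).

Definition addi J f : {pred R} := fun p => `[< exists q a, q \in J /\ p = q + a * f >].

Lemma addi_ideal J f : ideal J -> ideal (addi J f).
Proof.
move=> [J0 Jl]; split; first by apply/asboolP; exists 0, 0; rewrite mul0r addr0.
move=> c u v /asboolP[q [a [qJ ->]]] /asboolP[q' [a' [qJ' ->]]]; apply/asboolP.
exists (c * q + q'), (c * a + a'); split; first exact: Jl.
by rewrite mulrDr mulrDl mulrA addrACA.
Qed.

Lemma addi_sub J f : {subset J <= addi J f}.
Proof. by move=> q qJ; apply/asboolP; exists q, 0; rewrite mul0r addr0. Qed.

Lemma addi_mem J f : ideal J -> f \in addi J f.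
Proof. by move=> [J0 _]; apply/asboolP; exists 0, 1; rewrite mul1r add0r. Qed.

Lemma chain_sub J J' l P : {subset J <= J'} -> chain J' l P -> chain J l P.
Proof.
move=> JJ' [c1 c2]; split=> // i /c1[h1 h2 h3]; split=> // p /JJ'; exact: h3.
Qed.

Variables (W : lmodType R) (xs : seq R).

(* Grothendieck vanishing, in Koszul form. *)
Theorem colim_vanish_dim : noetherian -> forall J, ideal J -> forall e,
  (forall l P, chain J l P -> (l < e)%N) ->
  forall A B : {pred W}, submod_closed A -> submod_closed B -> {subset A <= B} ->
  (forall p w, p \in J -> w \in B -> p *: w \in A) ->
  forall j, (e <= j)%N -> colim_vanish xs B A j.
Proof.
move=> noeth; apply: noetherian_ind => // J iJ IH e bd A B hA hB AB JBA j ej.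
have IH' f e' : f \notin J -> (forall l P, chain (addi J f) l P -> (l < e')%N) ->
  forall A B : {pred W}, submod_closed A -> submod_closed B -> {subset A <= B} ->
  (forall p w, p \in addi J f -> w \in B -> p *: w \in A) ->
  forall j, (e' <= j)%N -> colim_vanish xs B A j.
  move=> fJ bd'; apply: IH => //; [exact: addi_ideal|exact: addi_sub|].
  by move=> /(_ _ (addi_mem f iJ)) h; rewrite h in fJ.
have bdf f l P : chain (addi J f) l P -> (l < e)%N.
  by move/(chain_sub (@addi_sub J f)); exact: bd.
have kil f (A' B' : {pred W}) : submod_closed A' -> {subset B' <= B} -> {subset A <= A'} ->
   (forall w, w \in B' -> f *: w \in A') ->
   forall p w, p \in addi J f -> w \in B' -> p *: w \in A'.
  move=> hA' B'B AA' fB p w /asboolP[q [a [qJ ->]]] wB; rewrite scalerDl -scalerA.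
  apply: closedD => //; first by apply/AA'/JBA => //; exact: B'B.
  by apply: closedZ => //; exact: fB.
have [J1|J1] := boolP (1 \in J).
  move=> k c wc cB dA; exists 0%N, (fun=> 0); split.
  - by move=> l; rewrite eqxx.
  - by move=> l; case: hB.
  - by move=> l; rewrite koszul_d0 subr0 mask_pow0 scale1r -[c l]scale1r; exact: JBA.
have imB f : {subset A <= sub_im f B A}.
  move=> w wA; apply/asboolP; exists 0; first by case: hB.
  by rewrite scaler0 subr0.
have imB' f : {subset sub_im f B A <= B}.
  move=> w /asboolP[g gB wg]; rewrite -(subrK (f *: g) w).
  by apply: closedD => //; [exact: AB | exact: closedZ].
have imf f w : w \in B -> f *: w \in sub_im f B A.
  by move=> wB; apply/asboolP; exists w => //; rewrite subrr; case: hA.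
(* If [J] is not prime, take [f g] in [J] with both factors outside. [B / (f B + A)] is killed by
   [J + (f)] and [(f B + A) / A] by [J + (g)], both larger ideals. *)
have [pr|npr] := pselect (prime_idealr_closed J); last first.
  have [f [g [fgJ fJ gJ]]] : exists f g, [/\ f * g \in J, f \notin J & g \notin J].
    apply: contrapT => no; apply: npr => u v uvJ; apply: contrapT => /negP.
    by rewrite negb_or => /andP[uJ vJ]; apply: no; exists u, v.
  have hC := sub_im_closed f hB hA.
  apply: (@colim_vanish_ext _ _ _ A (sub_im f B A) B) => //.
    apply: (IH' f e) => //; first exact: bdf.
    by apply: kil => //; exact: imf.
  apply: (IH' g e) => //; first exact: bdf.
  apply: kil => //.
  move=> w /asboolP[b bB wb].
  rewrite -(subrK (f *: b) w) scalerDr scalerA; apply: closedD => //.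
    exact: closedZ.
  by rewrite mulrC; exact: JBA.
have iJc : idealr_closed J by case: iJ => J0 Jl; split=> // a u v uJ vJ; exact: Jl.
(* [J] is now prime, so it forms a chain of length 0 by itself. *)
have e0 : (0 < e)%N.
  by apply: (bd 0%N (fun=> J)); split=> // i _; split.
have [xJ|] := boolP (all (fun x => x \in J) xs).
  apply: colim_vanish_killed => //; first exact: leq_trans ej.
  by move=> x w xxs wB; apply: JBA => //; exact: (allP xJ).
case/allPn => x xxs xJ.
(* A chain above [J + (x)] is lengthened by putting the prime [J] below it, so the bound drops by
   one. This is what the cokernel of [x] needs in degree [j - 1]. *)
have bd1 l P : chain (addi J x) l P -> (l < e.-1)%N.
  move=> [c1 c2]; have : (l.+1 < e)%N; last by lia.
  apply: (bd _ (fun i => if i is i'.+1 then P i' else J)); split.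
    case=> [|i] il; first by split.
    by have [h1 h2 h3] := c1 i il; split=> // p /(@addi_sub J x); exact: h3.
  case=> [|i] il; last exact: c2.
  have [h1 h2 h3] := c1 0%N isT; split.
    by move=> p /(@addi_sub J x); exact: h3.
  by exists x => //; apply: h3; exact: addi_mem.
have hK := sub_ker_closed x hB hA.
apply: (@colim_vanish_step _ _ _ A B j x) => //; first by lia.
- apply: (IH' x e.-1) => //; last by lia.
    move=> w wA; apply/andP; split; first exact: AB.
    exact: closedZ.
  by apply: kil => // [w /andP[]|w /andP[]].
- apply: (IH' x e.-1) => //; [exact: sub_im_closed| | lia].
  by apply: kil => //; [exact: sub_im_closed | exact: imf].
Qed.

End Noetherian.

(** * Dickson's lemma and the Hilbert basis theorem *)

Section Dickson.

(** Choose repeatedly, beyond the last index, an index where [f] attains its minimum over the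
    remaining tail. *)
Lemma nondecreasing_subseq (f : nat -> nat) : exists phi : nat -> nat,
  (forall i, (phi i < phi i.+1)%N) /\ forall i j, (i <= j)%N -> (f (phi i) <= f (phi j))%N.
Proof.
have sel N : exists k, (N <= k)%N /\ forall l, (N <= l)%N -> (f k <= f l)%N.
  have ex : exists v, `[< exists2 k, (N <= k)%N & f k = v >].
    by exists (f N); apply/asboolP; exists N.
  have [v /asboolP[k Nk <-] vmin] := ex_minnP ex; exists k; split=> // l Nl.
  by apply: vmin; apply/asboolP; exists l.
pose se N := sval (cid (sel N)).
have se1 N : (N <= se N)%N by exact: (svalP (cid (sel N))).1.
have se2 N : forall l, (N <= l)%N -> (f (se N) <= f l)%N.
  exact: (svalP (cid (sel N))).2.
pose phi := fix phi i := if i is i'.+1 then se (phi i').+1 else se 0%N.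
have phi1 i : (phi i < phi i.+1)%N by exact: se1.
have mono i j : (i <= j)%N -> (phi i <= phi j)%N.
  by move=> ij; rewrite -(subnK ij); elim: (j - i)%N => // d IH; exact: leq_trans IH (ltnW (phi1 _)).
exists phi; split=> // -[|i] j ij; first exact: se2.
by case: j ij => // j ij; apply: se2; apply: leq_trans (se1 _); rewrite ltnS; exact: mono.
Qed.

Lemma dickson n (m : nat -> 'X_{1..n}) : exists i j, (i < j)%N /\ (m i <= m j)%MM.
Proof.
suff key (s : seq 'I_n) : exists phi : nat -> nat, (forall i, (phi i < phi i.+1)%N) /\
    forall i j x, x \in s -> (i <= j)%N -> (m (phi i) x <= m (phi j) x)%N.
  have [phi [p1 p2]] := key (enum 'I_n); exists (phi 0%N), (phi 1%N); split=> //.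
  by apply/mnm_lepP => x; apply: p2 => //; rewrite mem_enum.
elim: s => [|x s [phi [p1 p2]]]; first by exists id; split.
have [psi [q1 q2]] := nondecreasing_subseq (fun k => m (phi k) x).
have mono (f : nat -> nat) i j : (forall i, (f i < f i.+1)%N) -> (i <= j)%N -> (f i <= f j)%N.
  move=> f1 ij; rewrite -(subnK ij); elim: (j - i)%N => // d IH.
  exact: leq_trans IH (ltnW (f1 _)).
have smono (f : nat -> nat) i j : (forall i, (f i < f i.+1)%N) -> (i < j)%N -> (f i < f j)%N.
  by move=> f1 ij; apply: leq_trans (f1 i) _; apply: mono.
exists (fun k => phi (psi k)); split=> [i|i j y]; first exact: smono.
rewrite inE => /orP[/eqP ->|ys] ij; first exact: q2.
by apply: p2 => //; exact: mono.
Qed.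

(** If every inclusion were strict, choose [p k] in [J k.+1] outside [J k] with least leading
    monomial. Dickson's lemma gives [i < j] with the leading monomial of [p i] dividing that of
    [p j]. Cancelling the leading term of [p j] by a multiple of [p i] leaves an element of [J j],
    which forces [p j] into [J j]. *)
Lemma mpoly_noetherian (K : fieldType) n : noetherian {mpoly K[n]}.
Proof.
move=> J iJ JS; apply: contrapT => no.
have mono i j : (i <= j)%N -> {subset J i <= J j}.
  move=> ij; rewrite -(subnK ij); elim: (j - i)%N => // d IH p /IH.
  exact: JS.
have ex k : exists p, [/\ p \in J k.+1, p \notin J k &
    forall q, q \in J k.+1 -> (mlead q < mlead p)%O -> q \in J k].
  have [p0 p1 p2] : exists2 p, p \in J k.+1 & p \notin J k.
    apply: contrapT => np; apply: no; exists k => p pJ.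
    by apply: contrapT => /negP pJ'; apply: np; exists p.
  move: p1 p2; move e: (mlead p0) => m; move: m p0 e; apply: (@ltmwf n) => m IH p pm p1 p2.
  have [[q [q1 q2 q3]]|nq] :=
    pselect (exists q, [/\ q \in J k.+1, q \notin J k & (mlead q < mlead p)%O]).
    by apply: (IH (mlead q)) q1 q2; rewrite // -pm.
  exists p; split=> // q q1 q2; apply: contrapT => /negP q3.
  by apply: nq; exists q.
pose p k := sval (cid (ex k)).
have pP k : [/\ p k \in J k.+1, p k \notin J k &
    forall q, q \in J k.+1 -> (mlead q < mlead (p k))%O -> q \in J k].
  by rewrite /p; case: cid.
have [i [j [ij mij]]] := dickson (fun k => mlead (p k)).
have [pi1 pi2 _] := pP i; have [pj1 pj2 pj3] := pP j.
have J0 k : 0 \in J k by case: (iJ k).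
have pi0 : p i != 0 by apply: contraNneq pi2 => ->.
have piJ : p i \in J j by apply: mono pi1.
pose mu := (mlead (p j) - mlead (p i))%MM.
pose t := (mleadc (p j) / mleadc (p i)) *: 'X_[mu] * p i.
have tJ : t \in J j.
  by have [_ Jl] := iJ j; rewrite -[t]addr0; apply: Jl.
have qJ : p j - t \in J j.+1.
  have [_ Jl] := iJ j.+1; rewrite addrC -mulN1r; apply: Jl => //; exact: JS.
have pjE : p j = 1 * (p j - t) + t by rewrite mul1r subrK.
suff : p j - t \in J j.
  by move=> h; case/negP: pj2; rewrite pjE; have [_ Jl] := iJ j; apply: Jl.
have [->|q0] := eqVneq (p j - t) 0; first exact: J0.
apply: pj3 => //.
have c0 : mleadc (p i) != 0 by rewrite mleadc_eq0.
have mE : (mu + mlead (p i))%MM = mlead (p j) by exact: submK.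
have tl : (mlead t <= mlead (p j))%O.
  rewrite /t -scalerAl; apply: le_trans (mleadZ_le _ _) _.
  by apply: le_trans (mleadM_le _ _) _; rewrite mleadXm mE.
rewrite lt_neqAle; apply/andP; split.
  apply: contraNneq q0 => e; rewrite -mleadc_eq0 e mcoeffB /t -scalerAl mcoeffZ.
  have := mleadcM 'X_[mu] (p i); rewrite mleadXm mE mcoeffX eqxx mul1r => ->.
  by rewrite divfK // subrr.
apply: le_trans (mleadB_le _ _) _.
by rewrite leUx lexx tl.
Qed.

End Dickson.

(** * Modules over polynomial rings *)

Section Tot.
Variables (K : fieldType) (r : nat).
Local Notation S := (polyAlg K r).
Local Notation R := {mpoly K[r]}.
Implicit Types (M N : gmod S) (p q : R).

Lemma hcompD p q d : hcomp (p + q) d = hcomp p d + hcomp q d.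
Proof. by apply: val_inj; exact: raddfD. Qed.

Lemma hcomp_ge p d : (msize p <= d)%N -> hcomp p d = 0.
Proof.
move=> h; apply: val_inj => /=; rewrite pihomogE big_seq_cond big1 // => m.
by move=> /andP[/msize_mdeg_lt]; case: eqP => // ->; rewrite ltnNge h.
Qed.

Lemma hcomp_homog p d e : p \is d.-homog -> d != e -> hcomp p e = 0.
Proof. by move=> ph de; apply: val_inj; apply: (pihomog_ne0 de). Qed.

Lemma gact_fam M (x : forall n, M n) i n m m' (e : m + i%:Z = n) (e' : m' + i%:Z = n)
  (a : S i) : gact e a (x m) = gact e' a (x m').
Proof.
have mm : m = m' by apply: (addIr i%:Z); rewrite e e'.
by subst m'; exact: gact_irr.
Qed.

Lemma tactE M p (x : forall n, M n) n k : (msize p <= k)%N ->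
  tact p x n = \sum_(d < k) gact (subrK (d : nat)%:Z n) (hcomp p d) (x (n - d%:Z)).
Proof.
move=> pk; rewrite /tact (big_ord_widen k (fun d => gact (subrK d%:Z n) (hcomp p d) (x (n - d%:Z)))) //.
rewrite [RHS](bigID (fun d : 'I_k => (d < msize p)%N)) /= [X in _ + X]big1 ?addr0 //.
by move=> d; rewrite -leqNgt => h; rewrite hcomp_ge // gact0l.
Qed.

Lemma tact_homog M p d (x : forall n, M n) n : p \is d.-homog ->
  tact p x n = gact (subrK d%:Z n) (hcomp p d) (x (n - d%:Z)).
Proof.
move=> ph; have [/hcomp_ge h|dp] := leqP (msize p) d.
  rewrite h gact0l /tact big1 // => e _.
  have [de|de] := eqVneq d (e : nat); last by rewrite (hcomp_homog ph) // gact0l.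
  by subst d; rewrite h gact0l.
rewrite /tact (bigD1 (Ordinal dp)) //= big1 ?addr0 // => e de.
by rewrite (hcomp_homog ph) ?gact0l //; apply: contraNneq de => ed; apply/eqP/val_inj.
Qed.

(** The direct product of the components, on which each polynomial acts by finite sums in every
    degree. The module itself is the submodule [fsupp] of finitely supported families. *)
Definition tot M : Type := dprod (fun n : int => M n).
HB.instance Definition _ M := GRing.Zmodule.on (tot M).

Let ts M (p : R) (x : tot M) : tot M := tact p x.

Lemma ts_addl M p q (x : tot M) : ts (p + q) x = ts p x + ts q x.
Proof.
apply/functional_extensionality_dep => n; pose k := maxn (msize (p + q)) (maxn (msize p) (msize q)).
rewrite dprodD /ts !(@tactE M _ x n k) ?leq_max ?leqnn ?orbT // -big_split.
apply: eq_bigr => d _ /=.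
by rewrite hcompD (linD (gact_linearl _ _)).
Qed.

Lemma ts_addr M p (x y : tot M) : ts p (x + y) = ts p x + ts p y.
Proof.
apply/functional_extensionality_dep => n; rewrite dprodD /ts /tact -big_split.
by apply: eq_bigr => d _; rewrite dprodD (linD (gact_linearr _ _)).
Qed.

Lemma ts0l M (x : tot M) : ts 0 x = 0.
Proof. by have := ts_addl 0 0 x; rewrite addr0 => /eqP; rewrite -subr_eq0 opprD addNKr oppr_eq0 => /eqP. Qed.

Lemma ts_suml M (I : Type) (s : seq I) (F : I -> R) (x : tot M) :
  ts (\sum_(i <- s) F i) x = \sum_(i <- s) ts (F i) x.
Proof.
elim: s => [|i s IH]; first by rewrite !big_nil ts0l.
by rewrite !big_cons ts_addl IH.
Qed.

Lemma ts0r M p : ts p (0 : tot M) = 0.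
Proof. by apply/functional_extensionality_dep => n; rewrite /ts /tact big1 // => d _; rewrite gact0. Qed.

Lemma ts_sumr M (I : Type) (s : seq I) p (F : I -> tot M) :
  ts p (\sum_(i <- s) F i) = \sum_(i <- s) ts p (F i).
Proof.
elim: s => [|i s IH]; first by rewrite !big_nil ts0r.
by rewrite !big_cons ts_addr IH.
Qed.

Lemma ts_mul M p q (x : tot M) : ts p (ts q x) = ts (p * q) x.
Proof.
rewrite (pihomog_partitionE (mf := mdeg) (p := p) (leqnn _)).
rewrite (pihomog_partitionE (mf := mdeg) (p := q) (leqnn _)).
rewrite mulr_suml !ts_suml; apply: eq_bigr => i _.
rewrite mulr_sumr ts_suml ts_sumr; apply: eq_bigr => j _.
set p' := pihomog _ _ p; set q' := pihomog _ _ q.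
have ph : p' \is (i : nat).-homog by exact: pihomogP.
have qh : q' \is (j : nat).-homog by exact: pihomogP.
apply/functional_extensionality_dep => n; rewrite /ts (tact_homog _ _ ph) (tact_homog _ _ qh).
rewrite (tact_homog _ _ (dhomogM ph qh)).
have hE : hcomp (p' * q') (i + j) = amul (g := S) (erefl (i + j)%N) (hcomp p' i) (hcomp q' j).
  by apply: val_inj => /=; rewrite !pihomog_dE //; exact: dhomogM.
have e3 : n - i%:Z - j%:Z + (i + j)%N%:Z = n by lia.
by rewrite hE (gactA (erefl (i + j)%N) _ _ e3); exact: gact_fam.
Qed.

Lemma ts1 M (x : tot M) : ts 1 x = x.
Proof.
apply/functional_extensionality_dep => n.
rewrite /ts (tact_homog _ _ (@dhomog1 r K mdeg)).
have -> : hcomp 1 0 = aone S by apply: val_inj => /=; rewrite pihomog_dE //; exact: (@dhomog1 r K mdeg).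
by rewrite (gact_fam _ _ (addr0 n)) gact1.
Qed.

HB.instance Definition _ M := GRing.Zmodule_isLmodule.Build R (tot M)
  (fun p q x => @ts_mul M p q x) (@ts1 M) (fun p x y => @ts_addr M p x y)
  (fun x p q => @ts_addl M p q x).

Lemma totE M p (x : tot M) : p *: x = tact p x. Proof. by []. Qed.
Lemma totD M (x y : tot M) n : (x + y) n = x n + y n. Proof. by []. Qed.
Lemma tot0 M n : (0 : tot M) n = 0. Proof. by []. Qed.

Definition fsupp M : {pred tot M} := fun x => `[< finsupp x >].

Lemma fsupp_closed M : submod_closed (@fsupp M).
Proof.
split; first by apply/asboolP; exists 0%N.
move=> p x y /asboolP[b hb] /asboolP[c hc]; apply/asboolP.
exists (b + c + msize p)%N => n bn; rewrite totD hc; last by lia.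
rewrite addr0 totE /tact big1 // => d _; rewrite hb ?gact0 //.
by have := ltn_ord d; lia.
Qed.

Definition tot_map M N (f : ghom M N) (x : tot M) : tot N := fun n => f n (x n).

Lemma tot_map_linear M N (f : ghom M N) p (x y : tot M) :
  tot_map f (p *: x + y) = p *: tot_map f x + tot_map f y.
Proof.
apply/functional_extensionality_dep => n; rewrite /tot_map !totD linearD /=; congr (_ + _).
rewrite !totE /tact linear_sum; apply: eq_bigr => d _; exact: ghom_act.
Qed.

Lemma tot_map0 M N (f : ghom M N) : tot_map f 0 = 0.
Proof. by apply/functional_extensionality_dep => n; rewrite /tot_map linear0. Qed.

Lemma tot_mapZ M N (f : ghom M N) p (x : tot M) : tot_map f (p *: x) = p *: tot_map f x.
Proof. by have := tot_map_linear f p x 0; rewrite tot_map0 !addr0. Qed.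

Lemma tot_mapB M N (f : ghom M N) (x y : tot M) : tot_map f (x - y) = tot_map f x - tot_map f y.
Proof. by apply/functional_extensionality_dep => n; exact: linearB. Qed.

Lemma tot_map_fsupp M N (f : ghom M N) (x : tot M) : x \in @fsupp M -> tot_map f x \in @fsupp N.
Proof.
by move=> /asboolP[b h]; apply/asboolP; exists b => n /h; rewrite /tot_map => ->; rewrite linear0.
Qed.

Lemma tot_map_koszul_d M N (f : ghom M N) (fs : seq R) (c : seq bool -> tot M) l :
  tot_map f (koszul_d fs c l) = koszul_d fs (fun m => tot_map f (c m)) l.
Proof.
elim: fs c l => [|g fs IH] c [|[] l] /=; rewrite ?tot_map0 //.
by rewrite tot_mapB tot_mapZ IH.
Qed.

Lemma koszul_d_map (W W' : lmodType R) (F : W -> W') (fs : seq R) (c : seq bool -> W) l :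
  linear F -> F (koszul_d fs c l) = koszul_d fs (fun m => F (c m)) l.
Proof.
move=> Fl; have F0 : F 0 = 0.
  by have := Fl (-1) 0 0; rewrite !scaleN1r !addNr.
have FZ p w : F (p *: w) = p *: F w by have := Fl p w 0; rewrite F0 !addr0.
have FB v w : F (v - w) = F v - F w.
  by rewrite addrC -scaleN1r Fl scaleN1r addrC.
elim: fs c l => [|g fs IH] c [|[] l] //=.
by rewrite FB FZ IH.
Qed.

(** A set-theoretic section, chosen to send zero components to zero so that finite support and
    cochain degree survive lifting. *)
Lemma tot_lift M N (f : ghom M N) (P : forall n, N n -> Prop) :
  (forall n y, P n y -> exists x, f n x = y) ->
  exists s : tot N -> tot M, [/\ s 0 = 0, forall y, y \in @fsupp N -> s y \in @fsupp M &
    forall y, (forall n, P n (y n)) -> tot_map f (s y) = y].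
Proof.
move=> h; have ex n y : exists x, P n y -> f n x = y.
  by have [/h[x <-]|nP] := pselect (P n y); [exists x | exists 0].
pose s (y : tot N) : tot M := fun n => if y n == 0 then 0 else sval (cid (ex n (y n))).
exists s; split.
- by apply/functional_extensionality_dep => n; rewrite /s tot0 eqxx.
- by move=> y /asboolP[b hb]; apply/asboolP; exists b => n /hb; rewrite /s => ->; rewrite eqxx.
- move=> y Py; apply/functional_extensionality_dep => n; rewrite /tot_map /s.
  by case: eqP => [->|_]; [rewrite linear0 | exact: (svalP (cid (ex n (y n))))].
Qed.

Definition var (i : 'I_r) : S 1%N.
Proof. by refine (@DHomog _ _ _ 'X_i _); rewrite dhomogX /= mdeg1. Defined.

Lemma gpow_val i k : mpoly_of_dhomog (gpow (var i) k : dhomog r K k) = 'X_i ^+ k.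
Proof. by elim: k => [|k IH] //=; rewrite IH exprS. Qed.

Lemma Xhomog i k : ('X_i ^+ k : R) \is k.-homog.
Proof. by rewrite -gpow_val; exact: dhomog_is_dhomog. Qed.

Lemma hcompX i k : hcomp ('X_i ^+ k) k = gpow (var i) k.
Proof. by apply: val_inj; rewrite /= gpow_val pihomog_dE //; exact: Xhomog. Qed.

Lemma Xact M i k (x : tot M) n :
  ('X_i ^+ k *: x) n = gact (subrK k%:Z n) (gpow (var i) k) (x (n - k%:Z)).
Proof. by rewrite totE (tact_homog _ _ (Xhomog i k)) hcompX. Qed.

Definition homog_elt M n (y : M n) : tot M := fun k =>
  if n + 0%N%:Z =P k is ReflectT e then gcast e y else 0.

Lemma homog_elt_at M n (y : M n) k (e : n + 0%N%:Z = k) : homog_elt y k = gcast e y.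
Proof. by rewrite /homog_elt; case: eqP => // e'; exact: gact_irr. Qed.

Lemma homog_elt_out M n (y : M n) k : k <> n -> homog_elt y k = 0.
Proof. by rewrite /homog_elt; case: eqP => // e h; case: h; rewrite -e addr0. Qed.

Lemma homog_elt_id M n (y : M n) : homog_elt y n = y.
Proof. by rewrite (homog_elt_at _ (addr0 n)); exact: gact1. Qed.

Lemma homog_elt0 M n : homog_elt (0 : M n) = 0.
Proof.
apply/functional_extensionality_dep => k; rewrite /homog_elt; case: eqP => // e.
exact: gact0.
Qed.

Lemma homog_elt_fsupp M n (y : M n) : homog_elt y \in @fsupp M.
Proof. by apply/asboolP; exists `|n|%N => k nk; apply: homog_elt_out => kn; subst k; lia. Qed.

Lemma homog_elt_act M n (y : M n) p d : p \is d.-homog ->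
  p *: homog_elt y = homog_elt (gact (erefl (n + d%:Z)) (hcomp p d) y).
Proof.
move=> ph; apply/functional_extensionality_dep => k.
rewrite totE (tact_homog _ _ ph).
have [e|e] := pselect (n + d%:Z = k).
  have e1 : n + 0%N%:Z = k - d%:Z by lia.
  have e2 : n + d%:Z + 0%N%:Z = k by lia.
  by rewrite (homog_elt_at _ e1) (homog_elt_at _ e2) (gact_cast _ _ e) (gcast_act _ _ e).
rewrite !homog_elt_out ?gact0 //; last by move=> h; apply: e; lia.
by move=> h; apply: e; lia.
Qed.

Lemma killed_of_ge M k n (y : M n) :
  (forall j m (e : n + j%:Z = m) (a : S j), (k <= j)%N -> gact e a y = 0) -> killed k y.
Proof.
elim: k n y => [|k IH] n y h /=; first by rewrite -(gact1 (addr0 n) y) h.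
move=> i m e a i0; apply: IH => j q e' b kj.
have e3 : n + (j + i)%N%:Z = q by lia.
by rewrite (gactA (erefl _) e e' e3) h //; lia.
Qed.

Lemma killed_gpow M k k' n m (y : M n) (f : S 1%N) (e : n + k'%:Z = m) :
  (k <= k')%N -> killed k y -> gact e (gpow f k') y = 0.
Proof.
elim: k' k n m y e => [|k' IH] [|k] n m y e //= kk.
- by move->; rewrite gact0.
- by move->; rewrite gact0.
- move=> h; have e1 : n + k'%:Z = n + k'%:Z by [].
  have e2 : n + k'%:Z + 1%N%:Z = m by lia.
  have e3 : n + 1%N%:Z + k'%:Z = m by lia.
  rewrite -(gactA (add1n k') e1 e2) (gactC _ _ (erefl (n + 1%N%:Z)) e3).
  by apply: (IH k) => //; exact: (h 1%N).
Qed.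

(** Pigeonhole: a monomial of degree greater than [r * k0] is divisible by the [k0]-th power of some
    variable. This identifies torsion with the kernel of the map to the localizations in
    [loc_exists]. *)
Lemma torsionE M n (y : M n) : torsion y <->
  exists k0, forall k j, (k0 <= k)%N -> gact (erefl (n + k%:Z)) (gpow (var j) k) y = 0.
Proof.
split=> [[k h]|[k0 h]]; first by exists k => k' j kk; exact: killed_gpow kk h.
exists (r * k0).+1; apply: killed_of_ge => j m e a kj.
pose p : R := mpoly_of_dhomog (a : dhomog r K j).
have ph : p \is j.-homog by exact: dhomog_is_dhomog.
have pa : hcomp p j = a by apply: val_inj => /=; rewrite pihomog_dE.
have w0 i : ('X_i ^+ k0 : R) *: homog_elt y = 0.
  by rewrite (homog_elt_act _ (Xhomog i k0)) hcompX h // homog_elt0.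
suff : p *: homog_elt y = 0.
  rewrite (homog_elt_act _ ph) pa => /(congr1 (fun w : tot M => w m)).
  have e2 : n + j%:Z + 0%N%:Z = m by lia.
  by rewrite (homog_elt_at _ e2) (gcast_act _ _ e).
rewrite [p]mpolyE scaler_suml big_seq big1 // => mu /(dhomogP _ _ _ ph) mdj.
have [i mi] : exists i, (k0 <= mu i)%N.
  apply: contrapT => no; have : (mdeg mu <= \sum_(i < r) k0)%N.
    by rewrite mdegE; apply: leq_sum => i _; rewrite leqNgt; apply/negP => lt; apply: no; exists i; exact: ltnW.
  by rewrite mdj sum_nat_const card_ord; move: kj; lia.
have -> : 'X_[mu] = 'X_[(mu - U_(i) *+ k0)%MM] * 'X_i ^+ k0 :> R.
  rewrite mpolyXn -mpolyXD; congr 'X_[_]; rewrite submK //.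
  apply/mnm_lepP => x; rewrite mulmnE mnm1E; case: eqP => [<-|_]; first by rewrite mul1n.
  by rewrite mul0n.
by rewrite scalerAl -scalerA w0 scaler0.
Qed.

Definition vars : seq R := [seq 'X_i | i <- enum 'I_r].

Lemma size_vars : size vars = r. Proof. by rewrite size_map size_enum_ord. Qed.

(** Koszul form of the vanishing of the [j]-th local cohomology of [M], in all degrees at once. *)
Definition koszul_vanish M j := colim_vanish vars (@fsupp M) (pred1 0) j.

Lemma pred0_closed M : submod_closed (pred1 0 : {pred tot M}).
Proof.
split; first by rewrite inE.
by move=> p x y /eqP -> /eqP ->; rewrite scaler0 addr0 inE.
Qed.

Lemma koszul_d_zero (W : lmodType R) (fs : seq R) (c : seq bool -> W) l :
  (forall f m, f \in fs -> f *: c m = 0) -> koszul_d fs c l = 0.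
Proof.
elim: fs c l => [|f fs IH] c [|[] l] //= h.
  rewrite h ?mem_head // IH ?subrr // => g m gf; apply: h; by rewrite inE gf orbT.
by rewrite IH // => g m gf; apply: h; rewrite inE gf orbT.
Qed.

Lemma mask_pow_nseq t (ys : seq R) : mask_pow t ys (nseq (size ys) false) = 1.
Proof. by elim: ys => //= y ys ->; rewrite mulr1. Qed.

(** A torsion element is a 0-cocycle for large powers of the variables, and the transition maps are
    the identity on the empty mask. *)
Lemma koszul_vanish0_torsion M : koszul_vanish M 0 -> forall n (y : M n), torsion y -> y = 0.
Proof.
move=> v n y /torsionE[k h].
pose z := nseq (size vars) false.
pose c l : tot M := if l == z then homog_elt y else 0.
have [|l|l|t [b [wb _ hb]]] := v k c.
- move=> l; rewrite /c; have [-> _|_] := eqVneq l z; last by rewrite eqxx.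
  by rewrite size_nseq; split=> //; rewrite /z; elim: (size vars).
- by rewrite /c; case: eqP => _; [exact: homog_elt_fsupp | case: (fsupp_closed M)].
- apply/eqP; apply: koszul_d_zero => f m /mapP[g /mapP[i _ ->] ->]; rewrite /c.
  case: eqP => _; last by rewrite scaler0.
  by rewrite (homog_elt_act _ (Xhomog i k)) hcompX h // homog_elt0.
have b0 : b = fun=> 0 by apply/funext => l; apply: (wtE wb) => -[].
have /eqP := hb z; rewrite b0 koszul_d0 subr0 mask_pow_nseq scale1r /c eqxx => e.
by rewrite -(homog_elt_id y) e.
Qed.
End Tot.

(** * Koszul vanishing passes from Y to the cokernel of Y -> D *)

Section Link.
Variables (K : fieldType) (r : nat).
Local Notation S := (polyAlg K r).
Local Notation R := {mpoly K[r]}.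
Local Notation vars := (vars K r).

Lemma hcompX1 i : hcomp ('X_i : R) 1 = var K i.
Proof.
apply: val_inj => /=; rewrite pihomog_dE //; have := Xhomog K i 1.
by rewrite expr1.
Qed.

Lemma fsupp_torsion (M : gmod S) (w : tot M) : w \in @fsupp _ _ M -> (forall n, torsion (w n)) ->
  exists T0, forall T i, (T0 <= T)%N -> ('X_i ^+ T : R) *: w = 0.
Proof.
move=> /asboolP[b hb] tw; pose kf n := sval (cid (tw n)).
have kfP n : killed (kf n) (w n) by exact: (svalP (cid (tw n))).
exists (\sum_(m < b.*2.+1) kf ((m : nat)%:Z - b%:Z)) => T i hT.
apply/functional_extensionality_dep => n; rewrite Xact.
have [h|h] := ltnP b `|n - T%:Z|%N; first by rewrite hb // gact0.
apply: killed_gpow (kfP _); apply: leq_trans hT.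
have mb : (`|(n - T%:Z + b%:Z)%R|%N < b.*2.+1)%N by lia.
rewrite (bigD1 (Ordinal mb)) //=; apply: leq_trans (leq_addr _ _).
by rewrite (_ : `|(n - T%:Z + b%:Z)%R|%N%:Z - b%:Z = n - T%:Z) //; lia.
Qed.

Variables (Y D N : gmod S) (eta : ghom Y D) (pi : ghom D N)
  (g : 'I_r -> ghom D (shift D (- 1))).
Hypothesis eta_ker : forall n y, eta n y = 0 <-> torsion y.
Hypothesis pi_surj : gsurj pi.
Hypothesis pi_ker : forall n x, pi n x = 0 <-> exists y, x = eta n y.
Hypothesis g_sum : forall n (z : D n), z = \sum_i gmulhom (var K i) (g i) z.
Hypothesis g_idem : forall i n (z : D n), gmulhom (var K i) (g i) (gmulhom (var K i) (g i) z)
   = gmulhom (var K i) (g i) z.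

Fact Gt_deg n : n + 1 - 1 + 0%N%:Z = n :> int. Proof. lia. Qed.
Definition Gt i (w : tot D) : tot D := fun n => gcast (Gt_deg n) (g i (n + 1) (w (n + 1))).

Lemma shift_fam i (w : tot D) d (q q' n : int) (e : q - 1 + d%:Z = n) (e' : q' - 1 + d%:Z = n)
  (a : S d) : gact e a (g i q (w q) : D (q - 1)) = gact e' a (g i q' (w q') : D (q' - 1)).
Proof.
have qq : q = q' by lia.
by subst q'; exact: gact_irr.
Qed.

Lemma Gt_linear i : linear (Gt i).
Proof.
move=> p x y; apply/functional_extensionality_dep => n.
rewrite /Gt !totD linearD (linD (gcast_linear _)); congr (_ + _).
rewrite !totE /tact linear_sum (linS (gcast_linear _)); apply: eq_bigr => d _.
have e2 : n + 1 - (d : nat)%:Z - 1 + (d : nat)%:Z = n by lia.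
have e3 : n - (d : nat)%:Z + 1 - 1 + (d : nat)%:Z = n by lia.
rewrite /= (ghom_act (g i)) /= (gcast_act _ _ e2) (gact_cast _ _ e3); exact: shift_fam.
Qed.

Lemma XGt i (w : tot D) n : ('X_i *: Gt i w) n = gmulhom (var K i) (g i) (w n).
Proof.
have X1 : ('X_i : R) \is 1.-homog by have := Xhomog K i 1; rewrite expr1.
rewrite totE (tact_homog _ _ X1) hcompX1 /Gt /gmulhom.
have e3 : n - 1%N%:Z + 1 - 1 + 1%N%:Z = n by lia.
rewrite (gact_cast _ _ e3); exact: (@shift_fam i w 1 _ n n).
Qed.

Lemma Gt_sum (w : tot D) : \sum_i 'X_i *: Gt i w = w.
Proof.
apply/functional_extensionality_dep => n.
have -> : (\sum_i 'X_i *: Gt i w) n = \sum_i ('X_i *: Gt i w) n.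
  by elim/big_rec2: _ => // i x y _ <-; rewrite totD.
by under eq_bigr => i _ do rewrite XGt; rewrite -g_sum.
Qed.

Lemma Gt_idem i (w : tot D) : 'X_i *: Gt i ('X_i *: Gt i w) = 'X_i *: Gt i w.
Proof. by apply/functional_extensionality_dep => n; rewrite !XGt g_idem. Qed.

(** Idempotency turns the partition of unity by the variables into one by their [k.+1]-st powers. *)
Lemma Gt_pow i k (w : tot D) : 'X_i ^+ k.+1 *: iter k.+1 (Gt i) w = 'X_i *: Gt i w.
Proof.
have GZ p x : Gt i (p *: x) = p *: Gt i x.
  have G0 : Gt i 0 = 0 by have := Gt_linear i (-1) 0 0; rewrite !scaleN1r !addNr.
  by have := Gt_linear i p x 0; rewrite G0 !addr0.
elim: k w => [|k IH] w; first by rewrite expr1.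
by rewrite exprS -scalerA iterSr IH -[X in 'X_i *: X]GZ Gt_idem.
Qed.

Lemma Gt_fsupp i (w : tot D) : w \in @fsupp _ _ D -> Gt i w \in @fsupp _ _ D.
Proof.
move=> /asboolP[b hb]; apply/asboolP; exists b.+1 => n bn.
by rewrite /Gt hb ?linear0 /gcast ?gact0 //; lia.
Qed.

Lemma iter_Gt_linear i k : linear (iter k (Gt i)).
Proof. by elim: k => [|k IH] c x y //=; rewrite IH Gt_linear. Qed.

(** By [Gt_sum] and [Gt_pow] the identity of [D] is the sum of the maps [X_i^(k+1) Gt_i^(k+1)].
    Hence the contractions, applied after [Gt_i^(k+1)] and summed over [i], bound every cocycle. *)
Lemma loc_koszul_exact k j (z : seq bool -> tot D) :
  wt r (fun q => q = j) z -> (forall l, z l \in @fsupp _ _ D) ->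
  (forall l, koszul_d (powers k.+1 vars) z l = 0) ->
  exists e, [/\ wt r (fun q => q.+1 = j) e, forall l, e l \in @fsupp _ _ D &
    forall l, z l = koszul_d (powers k.+1 vars) e l].
Proof.
move=> wz zB dz; pose c i := fun l => iter k.+1 (Gt i) (z l).
have it0 i : iter k.+1 (Gt i) 0 = 0.
  by have := iter_Gt_linear i k.+1 (-1) 0 0; rewrite !scaleN1r !addNr.
have wc i : wt r (fun q => q = j) (c i).
  by move=> l h; apply: wz; apply: contraNneq h => z0; rewrite /c z0 it0.
exists (fun l => \sum_(i < r) koszul_h i (c i) l); split.
- move=> l n0; have [i mn0] : exists i : 'I_r, koszul_h i (c i) l != 0.
    apply: contrapT => no; move: n0; rewrite big1 ?eqxx // => i _.
    by apply/eqP; apply: contrapT => /negP n0; apply: no; exists i.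
  exact: (wt_koszul_h (wc i) mn0).
- move=> l; apply: closed_sum; first exact: fsupp_closed.
  move=> i; apply: koszul_h_closed; first exact: fsupp_closed.
  move=> m; rewrite /c; elim: k.+1 => [|k' IH] //=; exact: Gt_fsupp.
move=> l; rewrite koszul_d_sum.
have [sl|sl] := eqVneq (size l) r; last first.
  rewrite (wtE wz); last by move=> [/eqP]; rewrite (negPf sl).
  rewrite big1 // => i _.
  apply: (wtE (wt_koszul_d (fs := powers k.+1 vars) (Q := fun q => q.+1 = j) _)).
    by rewrite size_powers size_vars; exact: (wt_koszul_h (wc i)).
  by rewrite size_powers size_vars => -[/eqP]; rewrite (negPf sl).
rewrite -[LHS]Gt_sum; apply: eq_bigr => i _.
have := koszul_d_kh (fs := powers k.+1 vars) (i := i) (c i) (l := l).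
rewrite size_powers size_vars => /(_ (ltn_ord i) sl) h.
have d0 : koszul_h i (koszul_d (powers k.+1 vars) (c i)) l = 0.
  have -> : koszul_d (powers k.+1 vars) (c i) = fun=> 0.
    apply/funext => m; rewrite /c -(koszul_d_map _ _ _ (iter_Gt_linear i k.+1)) dz.
    exact: it0.
  have P : submod_closed (pred1 0 : {pred tot D}) by exact: pred0_closed.
  by apply/eqP; apply: (koszul_h_closed i P) => m; rewrite inE.
rewrite d0 addr0 in h; rewrite h (nth_map 0) ?size_vars // (nth_map i) ?size_enum_ord //.
by rewrite nth_ord_enum Gt_pow.
Qed.

(** Connecting map: lift the cocycle [c] to [c1] on [D] and write [d c1] as the image of a cochain
    [u] on [Y]. After raising the level, [u] becomes a boundary [d b]; then [c1] minus the image of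
    [b] is a cocycle on [D], hence a boundary, and projecting to [N] bounds [c]. *)
Lemma koszul_vanish_link j : koszul_vanish Y j.+1 -> koszul_vanish N j.
Proof.
move=> v k c wc cB dc.
have [sp [sp0 spB spE]] := @tot_lift _ _ _ _ pi (fun _ _ => True) (fun n y _ => pi_surj y).
have [se [se0 seB seE]] := @tot_lift _ _ _ _ eta (fun n x => exists y, x = eta n y)
  (fun n x '(ex_intro y e) => ex_intro _ y (esym e)).
pose c1 l := sp (c l).
have c1B l : c1 l \in @fsupp _ _ D by exact: spB.
have c1E l : tot_map pi (c1 l) = c l by exact: spE.
have wc1 : wt r (fun q => q = j) c1.
  move: wc; rewrite size_vars => wc l h; apply: wc.
  by apply: contraNneq h => z0; rewrite /c1 z0 sp0.
have dk l n : exists y, koszul_d (powers k vars) c1 l n = eta n y.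
  apply/pi_ker; have := tot_map_koszul_d pi (powers k vars) c1 l.
  have -> : (fun m => tot_map pi (c1 m)) = c by apply/funext.
  by move/(congr1 (fun w : tot N => w n)); have /eqP -> := dc l.
pose u l := se (koszul_d (powers k vars) c1 l).
have uE l : tot_map eta (u l) = koszul_d (powers k vars) c1 l by apply: seE => n; exact: dk.
have uB l : u l \in @fsupp _ _ Y.
  by apply: seB; apply: koszul_d_closed => //; exact: fsupp_closed.
have wu : wt r (fun q => q = j.+1) u.
  move=> l h; have : koszul_d (powers k vars) c1 l != 0 by apply: contraNneq h => z0; rewrite /u z0 se0.
  have w1 : wt (size (powers k vars)) (fun q => q = j) c1 by rewrite size_powers size_vars.
  by move/(wt_koszul_d w1); rewrite size_powers size_vars => -[-> [q -> ->]].
have wdu : wt r (fun q => q = j.+2) (koszul_d (powers k vars) u).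
  move=> l; have w1 : wt (size (powers k vars)) (fun q => q = j.+1) u by rewrite size_powers size_vars.
  by move/(wt_koszul_d w1); rewrite size_powers size_vars => -[-> [q -> ->]].
have tu l n : torsion (koszul_d (powers k vars) u l n).
  apply/eta_ker; have := tot_map_koszul_d eta (powers k vars) u l.
  have -> : (fun m => tot_map eta (u m)) = koszul_d (powers k vars) c1 by apply/funext.
  by rewrite koszul_dd => /(congr1 (fun w : tot D => w n)).
have exT (l : r.-tuple bool) : exists T0, forall T i, (T0 <= T)%N -> ('X_i ^+ T : R) *: koszul_d (powers k vars) u l = 0.
  by apply: fsupp_torsion => //; apply: koszul_d_closed => //; exact: fsupp_closed.
(* [d u] vanishes only in [D], so it is torsion in [Y]. Its masks are nonempty, so [mask_pow T]
   contains a power of a variable that kills it. The successor makes the final level [kk] positive,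
   as [loc_koszul_exact] requires. *)
pose T := (\sum_(l : r.-tuple bool) sval (cid (exT l))).+1.
have Tu l : mask_pow T vars l *: koszul_d (powers k vars) u l = 0.
  have [->|n0] := eqVneq (koszul_d (powers k vars) u l) 0; first by rewrite scaler0.
  have [sl cl] := wdu _ n0.
  have [||x [a [/mapP[i _ ->] ->]]] := mask_pow_pos (xs := vars) (l := l) T; first by rewrite size_vars.
    by rewrite cl.
  have sl' : size l == r by apply/eqP.
  rewrite -scalerA (_ : 'X_i ^+ T *: _ = 0) ?scaler0 //.
  apply: (svalP (cid (exT (Tuple sl')))).
  by rewrite /T (bigD1 (Tuple sl')) //=; lia.
pose u' l := mask_pow T vars l *: u l.
have [|l|l|t [b [wb bB hb]]] := v (k + T)%N u'.
- by rewrite size_vars; exact: wt_mask_pow.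
- by apply: closedZ => //; exact: fsupp_closed.
- by rewrite koszul_d_mask_pow Tu inE.
pose kk := (k + T + t)%N.
pose z l := mask_pow (T + t) vars l *: c1 l - tot_map eta (b l).
have bE l : mask_pow t vars l *: u' l = koszul_d (powers kk vars) b l.
  by apply/eqP; rewrite -subr_eq0; exact: hb.
have kkS : kk = (kk.-1).+1 by rewrite /kk /T; lia.
have wb' : wt r (fun q => q = j) b.
  by move=> l /wb; rewrite size_vars => -[-> [->]].
have wz : wt r (fun q => q = j) z.
  move=> l n0; have [c0|] := eqVneq (c1 l) 0; last exact: wc1.
  by apply: wb'; apply: contraNneq n0 => b0; rewrite /z c0 b0 scaler0 tot_map0 subrr.
have [||e [we eB ze]] := loc_koszul_exact (k := kk.-1) wz.
- move=> l; apply: closedB; first exact: fsupp_closed.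
    by apply: closedZ => //; exact: fsupp_closed.
  by apply: tot_map_fsupp; exact: bB.
- move=> l; rewrite -kkS koszul_dB -tot_map_koszul_d -bE /kk -addnA koszul_d_mask_pow mask_powD -scalerA /u' !tot_mapZ uE.
  by rewrite subrr.
exists (T + t)%N, (fun l => tot_map pi (e l)); split.
- rewrite size_vars => l h; apply: we; apply: contraNneq h => e0; by rewrite e0 tot_map0.
- by move=> l; exact: tot_map_fsupp.
- move=> l; rewrite addnA -/kk -tot_map_koszul_d kkS -ze /z tot_mapB tot_mapZ c1E inE.
  have -> : tot_map pi (tot_map eta (b l)) = 0.
    by apply/functional_extensionality_dep => n; apply/pi_ker; exists (b l n).
  by rewrite subr0 subrr.
Qed.
End Link.

(** * Vanishing above the dimension and below the depth *)

Section VanishOutside.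
Variables (K : fieldType) (r : nat).
Local Notation S := (polyAlg K r).
Local Notation R := {mpoly K[r]}.
Local Notation vars := (vars K r).
Variable M : gmod S.

Lemma annihilatesE (p : R) :
  annihilates M p <-> forall x : tot M, x \in @fsupp _ _ M -> p *: x = 0.
Proof.
split=> [h x _|h d n m e x].
  by apply/functional_extensionality_dep => n; rewrite totE /tact big1 // => d _; exact: h.
have := congr1 (fun w : tot M => w m) (h _ (homog_elt_fsupp x)).
rewrite totE /tact tot0; have [pd|pd] := ltnP d (msize p); last first.
  by rewrite hcomp_ge // gact0l.
rewrite (bigD1 (Ordinal pd)) //= big1 ?addr0.
  have e0 : n + 0%N%:Z = m - d%:Z by lia.
  by rewrite (homog_elt_at _ e0) (gact_cast _ _ e).
move=> i id; rewrite homog_elt_out ?gact0 // => h'.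
by case/eqP: id; apply: val_inj => /=; lia.
Qed.

Definition annp : {pred R} := fun p => `[< annihilates M p >].

Lemma annp_ideal : ideal annp.
Proof.
split; first by apply/asboolP/annihilatesE => x _; rewrite scale0r.
move=> a u v /asboolP/annihilatesE hu /asboolP/annihilatesE lc_vanish.
apply/asboolP/annihilatesE => x vars; rewrite scalerDl -scalerA hu // lc_vanish //.
by rewrite scaler0 addr0.
Qed.

Lemma koszul_vanish_gt_dim d j : is_dim M d -> (d < j)%N -> koszul_vanish M j.
Proof.
move=> [_ dmax] dj; apply: (colim_vanish_dim (@mpoly_noetherian K r) annp_ideal (e := d.+1)) => //.
- move=> l P [c1 c2]; rewrite ltnS; have := dmax l; rewrite leEnat; apply.
  exists P; split=> // i /c1[h1 h2 h3]; split=> // p hp.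
  by apply: h3; apply/asboolP.
- exact: pred0_closed.
- exact: fsupp_closed.
- by move=> w /eqP ->; case: (fsupp_closed M).
- by move=> p w /asboolP/annihilatesE h wB; rewrite h // inE.
Qed.

Let low N (p : R) := forall m, (mdeg m < N)%N -> p@_m = 0.

Lemma low_mul N1 N2 p q : low N1 p -> low N2 q -> low (N1 + N2) (p * q).
Proof.
move=> hp hq m lm; rewrite mcoeffM big1 // => -[k1 k2] /= /eqP mE.
have [h|h] := ltnP (mdeg k1) N1; first by rewrite hp // mul0r.
rewrite [X in _ * X]hq ?mulr0 //.
have := congr1 mdeg mE; rewrite mdegD; lia.
Qed.

Lemma low_exp (a : R) N : a@_0%MM = 0 -> low N (a ^+ N).
Proof.
move=> a0; elim: N => [|N IH]; first by move=> m; rewrite ltn0.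
rewrite exprS -add1n; apply: low_mul => // m; rewrite ltnS leqn0 mdeg_eq0.
by move/eqP ->.
Qed.

(** Without constant term, [a^N] has only monomials of degree at least [N = r k + 1], and each is
    divisible by the [k]-th power of some variable. *)
Lemma nilp_pow (a : R) k : a@_0%MM = 0 -> exists N (q : nat -> R),
  a ^+ N = \sum_(m < size (powers k vars)) q m * nth 0 (powers k vars) m.
Proof.
move=> a0; rewrite size_powers size_vars; pose N := (r * k).+1; exists N.
have nE (i : 'I_r) : nth 0 (powers k vars) i = 'X_i ^+ k.
  by rewrite (nth_map 0) ?size_vars // (nth_map i) ?size_enum_ord // nth_ord_enum.
suff [q qE] : exists q : nat -> R, a ^+ N = \sum_(i < r) q i * 'X_i ^+ k.
  by exists q; rewrite qE; apply: eq_bigr => i _; rewrite nE.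
rewrite [a ^+ N]mpolyE.
have : {in msupp (a ^+ N), forall m, N <= mdeg m}%N.
  move=> m; rewrite mcoeff_msupp; apply: contraNleq => h.
  by apply/eqP; apply: (@low_exp a N a0).
elim: (msupp _) => [|mu s IH] hs.
  by exists (fun=> 0); rewrite big_nil big1 // => i _; rewrite mul0r.
have [|q qE] := IH; first by move=> m ms; apply: hs; rewrite inE ms orbT.
rewrite big_cons qE.
have [i mi] : exists i, (k <= mu i)%N.
  apply: contrapT => no; have : (mdeg mu <= \sum_(i < r) k)%N.
    by rewrite mdegE; apply: leq_sum => i _; rewrite leqNgt; apply/negP => lt; apply: no; exists i; exact: ltnW.
  by rewrite sum_nat_const card_ord; have := hs mu (mem_head _ _); rewrite /N; lia.
have muE : 'X_[mu] = 'X_[(mu - U_(i) *+ k)%MM] * 'X_i ^+ k :> R.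
  rewrite mpolyXn -mpolyXD; congr 'X_[_]; rewrite submK //.
  apply/mnm_lepP => x; rewrite mulmnE mnm1E; case: eqP => [<-|_]; first by rewrite mul1n.
  by rewrite mul0n.
pose t := (a ^+ N)@_mu *: 'X_[(mu - U_(i) *+ k)%MM].
exists (fun m : nat => (if m == i :> nat then t else 0) + q m).
under [RHS]eq_bigr => m _ do rewrite mulrDl; rewrite big_split /=; congr (_ + _).
rewrite (bigD1 i) //= eqxx big1 ?addr0; first by rewrite muE -scalerAl.
by move=> m mi'; rewrite ifN ?mul0r.
Qed.

Lemma koszul_vanish_lt_depth (a : seq R) j : regular_seq M a -> (j < size a)%N -> koszul_vanish M j.
Proof.
move=> [a0 areg _] ja k c wc cB dc.
(* [A i] is the submodule generated by the first [i] elements of the regular sequence, the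
   filtration that [koszul_depth] works with. *)
pose A i : {pred tot M} := fun w => `[< exists y : nat -> tot M,
  (forall m, y m \in @fsupp _ _ M) /\ w = \sum_(m < i) a`_m *: y m >].
have hB := fsupp_closed M; have B0 : 0 \in @fsupp _ _ M by case: hB.
have AE i (w : tot M) : (i <= size a)%N ->
    (w \in A i) <-> in_ideal_mul (take i a) w.
  move=> ia; have st : size (take i a) = i by rewrite size_take; case: ltngtP ia => // ->.
  have evs (F : 'I_i -> tot M) n : (\sum_m F m) n = \sum_m F m n.
    by elim/big_rec2: _ => // m x y _ <-; rewrite totD.
  split=> [/asboolP[y [yB ->]]|[y [yB wE]]].
    exists y; split; first by move=> m; apply/asboolP/yB.
    by move=> n; rewrite evs st; apply: eq_bigr => m _; rewrite nth_take.
  apply/asboolP; exists y; split; first by move=> m; apply/asboolP/yB.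
  apply/functional_extensionality_dep => n; rewrite wE evs st.
  by apply: eq_bigr => m _; rewrite nth_take.
have hA i : submod_closed (A i).
  split; first by apply/asboolP; exists (fun=> 0); split=> //; rewrite big1 // => m _; rewrite scaler0.
  move=> p x y /asboolP[x' [xB ->]] /asboolP[y' [yB ->]]; apply/asboolP.
  exists (fun m => p *: x' m + y' m); split.
    by move=> m; case: hB => _; apply.
  rewrite scaler_sumr -big_split; apply: eq_bigr => m _.
  by rewrite scalerDr !scalerA mulrC.
have A0 w : w \in A 0%N -> w = 0 by move=> /asboolP[y [_ ->]]; rewrite big_ord0.
have H1 i : (i < size a)%N -> {subset A i <= A i.+1}.
  move=> ia w /asboolP[y [yB ->]]; apply/asboolP.
  exists (fun m => if (m < i)%N then y m else 0); split=> [m|]; first by case: ifP.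
  rewrite big_ord_recr /= ltnn scaler0 addr0; apply: eq_bigr => m _.
  by rewrite ltn_ord.
have H2 i : (i < size a)%N -> forall w, w \in @fsupp _ _ M -> a`_i *: w \in A i.+1.
  move=> ia w wB; apply/asboolP; exists (fun m : nat => if m == i then w else 0).
  split=> [m|]; first by case: ifP.
  rewrite big_ord_recr /= eqxx big1 ?add0r // => m _.
  by rewrite ifN ?scaler0 // neq_ltn ltn_ord.
have H3 i : (i < size a)%N -> forall w, w \in A i.+1 ->
    exists2 g, g \in @fsupp _ _ M & w - a`_i *: g \in A i.
  move=> ia w /asboolP[y [yB ->]]; exists (y i) => //; apply/asboolP.
  by exists y; split=> //; rewrite big_ord_recr /= addrK.
have H4 i : (i < size a)%N -> forall w, w \in @fsupp _ _ M -> a`_i *: w \in A i -> w \in A i.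
  move=> ia w wB /(AE _ _ (ltnW ia)) h; apply/(AE _ _ (ltnW ia)).
  by apply: areg => //; apply/asboolP.
have H5 i : (i < size a)%N -> exists N (q : nat -> R),
    a`_i ^+ N = \sum_(m < size (powers k vars)) q m * nth 0 (powers k vars) m.
  by move=> ia; apply: nilp_pow; apply: a0; rewrite mem_nth.
have [|//|l|b [wb bB hb]] := koszul_depth hB hA H1 H2 H3 H4 H5 (j := j) (i := 0%N) ja (c := c).
- by rewrite size_powers.
- by have /eqP -> := dc l; case: (hA 0%N).
- exists 0%N, b; split=> //; first by rewrite -(size_powers vars k).
  by move=> l; rewrite mask_pow0 scale1r addn0 inE; apply: A0; exact: hb.
Qed.

End VanishOutside.

(** * Koszul homology by degrees *)

Lemma sum_alternating (V : zmodType) r (F : 'I_r -> 'I_r -> V) :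
  (forall i, F i i = 0) -> (forall i j, F i j = - F j i) ->
  \sum_i \sum_j F i j = 0.
Proof.
move=> F0 FN.
have E i : \sum_j F i j = \sum_(j : 'I_r | (j < i)%N) F i j + \sum_(j : 'I_r | (i < j)%N) F i j.
  rewrite (bigID (fun j : 'I_r => (j < i)%N)) /=; congr (_ + _).
  rewrite (bigID (fun j : 'I_r => (i < j)%N)) /= [X in _ + X]big1 ?addr0.
    by apply: eq_bigl => j; case: ltngtP.
  move=> j; case: ltngtP => // e _; rewrite (_ : j = i) //; exact: val_inj.
under eq_bigr => i _ do rewrite E; rewrite big_split /= [X in _ + X](exchange_big_dep xpredT) //=.
rewrite -big_split big1 // => i _; rewrite -big_split big1 // => j ji.
by rewrite /= FN addNr.
Qed.

Section Chains.
Variables (K : fieldType) (A : galg K) (r : nat) (x : 'I_r -> A 1%N).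
Implicit Types (N B C : gmod A).

Definition alt (V : zmodType) (c : seq 'I_r -> V) : Prop :=
  (forall l1 i l2, c (l1 ++ i :: i :: l2) = 0) /\
  (forall l1 i j l2, c (l1 ++ i :: j :: l2) = - c (l1 ++ j :: i :: l2)).

Definition csupp (V : zmodType) p (c : seq 'I_r -> V) : Prop :=
  forall l, c l != 0 -> size l = p.

Definition bd N m m' (e : m + 1%N%:Z = m') (c : seq 'I_r -> N m) (l : seq 'I_r) : N m' :=
  \sum_j gact e (x j) (c (j :: l)).

Definition cyc N m (c : seq 'I_r -> N m) : Prop :=
  forall m' (e : m + 1%N%:Z = m') l, bd e c l = 0.

(* A p-chain is an alternating function on sequences of length p.              *)
Definition koszul_exact p N m : Prop := forall c : seq 'I_r -> N m, alt c -> csupp p c -> cyc c ->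
  exists c' : seq 'I_r -> N (m - 1), [/\ alt c', csupp p.+1 c' &
    forall l, bd (subrK 1 m) c' l = c l].

Lemma alt_lin (V W : zmodType) (f : V -> W) (c : seq 'I_r -> V) :
  f 0 = 0 -> (forall v, f (- v) = - f v) -> alt c -> alt (fun l => f (c l)).
Proof. by move=> f0 fN [h1 h2]; split=> *; rewrite ?h1 // h2 fN. Qed.

Lemma alt_sub (V : zmodType) (c b : seq 'I_r -> V) : alt c -> alt b -> alt (fun l => c l - b l).
Proof.
move=> [h1 h2] [h3 h4]; split=> [l1 i l2|l1 i j l2]; first by rewrite h1 h3 subrr.
by rewrite h2 h4 opprB opprK addrC.
Qed.

Lemma alt_cons (V : zmodType) (c : seq 'I_r -> V) i : alt c -> alt (fun l => c (i :: l)).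
Proof. by move=> [h1 h2]; split=> [l1|l1]; [exact: (h1 (i :: l1)) | exact: (h2 (i :: l1))]. Qed.

Lemma csupp_lin (V W : zmodType) (f : V -> W) p (c : seq 'I_r -> V) :
  f 0 = 0 -> csupp p c -> csupp p (fun l => f (c l)).
Proof. by move=> f0 h l n0; apply: h; apply: contraNneq n0 => ->; rewrite f0. Qed.

Lemma csupp_sub (V : zmodType) p (c b : seq 'I_r -> V) :
  csupp p c -> csupp p b -> csupp p (fun l => c l - b l).
Proof.
move=> h1 h2 l n0; have [c0|] := eqVneq (c l) 0; last exact: h1.
by apply: h2; apply: contraNneq n0 => b0; rewrite c0 b0 subrr.
Qed.

Lemma alt_nonuniq (V : zmodType) (c : seq 'I_r -> V) l : alt c -> ~~ uniq l -> c l = 0.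
Proof.
move=> [h1 h2]; have move_ l2 : forall l1 i l3, c (l1 ++ i :: l2 ++ i :: l3) = 0.
  elim: l2 => [|k l2 IH] l1 i l3 /=; first exact: h1.
  by rewrite h2 -cat_rcons IH oppr0.
suff gen l1 : ~~ uniq l -> c (l1 ++ l) = 0 by exact: (gen [::]).
elim: l l1 => //= i l IH l1; rewrite negb_and negbK => /orP[|nu].
  by case/splitPr => p1 p2; exact: move_.
by rewrite -cat_rcons; exact: IH.
Qed.

Lemma bd_alt N m m' (e : m + 1%N%:Z = m') (c : seq 'I_r -> N m) : alt c -> alt (bd e c).
Proof.
move=> [h1 h2]; split=> [l1 i l2|l1 i j l2]; rewrite /bd.
  by rewrite big1 // => k _; rewrite (h1 (k :: l1)) gact0.
by rewrite -sumrN; apply: eq_bigr => k _; rewrite (h2 (k :: l1)) (linN (gact_linearr _ _)).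
Qed.

Lemma bd_supp N m m' (e : m + 1%N%:Z = m') p (c : seq 'I_r -> N m) :
  csupp p.+1 c -> csupp p (bd e c).
Proof.
move=> h l n0; have [j] : exists j, c (j :: l) != 0.
  apply: contrapT => no; move: n0; rewrite /bd big1 ?eqxx // => j _.
  have [->|n0] := eqVneq (c (j :: l)) 0; first by rewrite gact0.
  by case: no; exists j.
by move/h => /= [].
Qed.

Lemma bd_bd N m m' m'' (e : m + 1%N%:Z = m') (e' : m' + 1%N%:Z = m'') (c : seq 'I_r -> N m) l :
  alt c -> bd e' (bd e c) l = 0.
Proof.
move=> [h1 h2]; rewrite /bd.
under eq_bigr => j _ do rewrite (linS (gact_linearr _ _)).
apply: sum_alternating => [i|i j]; first by rewrite (h1 [::]) !gact0.
by rewrite (h2 [::]) (gactC _ _ e e') !(linN (gact_linearr _ _)).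
Qed.

Lemma bd_hom M N (f : ghom M N) m m' (e : m + 1%N%:Z = m') (c : seq 'I_r -> M m) l :
  f m' (bd e c l) = bd e (fun k => f m (c k)) l.
Proof. by rewrite /bd linear_sum; apply: eq_bigr => j _; exact: ghom_act. Qed.

Lemma bd_sub N m m' (e : m + 1%N%:Z = m') (c b : seq 'I_r -> N m) l :
  bd e (fun k => c k - b k) l = bd e c l - bd e b l.
Proof. by rewrite /bd -sumrB; apply: eq_bigr => j _; rewrite (linB (gact_linearr _ _)). Qed.

Lemma cyc_of N m m' (e : m + 1%N%:Z = m') (c : seq 'I_r -> N m) :
  (forall l, bd e c l = 0) -> cyc c.
Proof. by move=> h q e' l; subst m' q; exact: h. Qed.

Lemma koszul_exact_zero p N m : (forall c : seq 'I_r -> N m, alt c -> csupp p c -> forall l, c l = 0) ->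
  koszul_exact p N m.
Proof.
move=> h c ca cs _; exists (fun=> 0); split.
- by split=> *; rewrite ?oppr0.
- by move=> l; rewrite eqxx.
- by move=> l; rewrite (h c ca cs l) /bd big1 // => j _; rewrite gact0.
Qed.

(** An alternating function vanishes on sequences with a repetition, and [p > r] indices always
    repeat. *)
Lemma koszul_exact_big p N m : (r < p)%N -> koszul_exact p N m.
Proof.
move=> rp; apply: koszul_exact_zero => c ca cs l; have [->//|n0] := eqVneq (c l) 0.
apply: alt_nonuniq => //; apply/negP => u.
have := max_card (mem l); rewrite (card_uniqP u) card_ord (cs l n0).
by move: rp; lia.
Qed.

Lemma koszul_exact_trivial p N m : (forall y : N m, y = 0) -> koszul_exact p N m.
Proof. by move=> h; apply: koszul_exact_zero. Qed.

Section Contract.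
Variables (N : gmod A) (g : 'I_r -> ghom N (shift N (- 1))).
Hypothesis g_sum : forall n (z : N n), z = \sum_i gmulhom (x i) (g i) z.

(** Exterior multiplication by the sum of the [g_j e_j]: the alternating sum, over the entries [j]
    of [l], of [g_j] applied to the value of [c] at [l] with that entry removed. *)
Fixpoint hc m (c : seq 'I_r -> N m) (l : seq 'I_r) : N (m - 1) :=
  if l is j :: l' then g j m (c l') - hc (fun k => c (j :: k)) l' else 0.

Lemma hc0 m l : hc (fun=> 0 : N m) l = 0.
Proof. by elim: l => [|j l IH] //=; rewrite IH subr0; exact: linear0. Qed.

Lemma hcN m (c : seq 'I_r -> N m) l : hc (fun k => - c k) l = - hc c l.
Proof.
elim: l c => [|j l IH] c /=; first by rewrite oppr0.
by rewrite IH opprB linearN opprK; exact: addrC.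
Qed.

Lemma hc_alt m (c : seq 'I_r -> N m) : alt c -> alt (hc c).
Proof.
move=> ca; split=> [l1 i l2|l1 i j l2].
  elim: l1 c ca => [|k l1 IH] c ca /=.
    have [h1 _] := ca; rewrite opprB addrCA subrr addr0.
    rewrite (_ : (fun k => _) = fun=> 0) ?hc0 //; apply/funext => k; exact: (h1 [::]).
  have [h1 _] := ca; rewrite h1 (IH _ (alt_cons k ca)) subr0; exact: linear0.
elim: l1 c ca => [|k l1 IH] c ca /=.
  have [_ h2] := ca.
  have -> : (fun k => c (i :: j :: k)) = fun k => - c (j :: i :: k).
    by apply/funext => k; exact: (h2 [::]).
  by rewrite hcN !opprB; exact: addrA.
have [_ h2] := ca; rewrite h2 (IH _ (alt_cons k ca)) linearN opprB opprK.
exact: addrC.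
Qed.

Lemma hc_supp m k q (c : seq 'I_r -> N m) :
  (forall l, c l != 0 -> (size l + k).+1 = q) -> forall l, hc c l != 0 -> (size l + k)%N = q.
Proof.
move=> h l; elim: l k c h => [|j l IH] k c h /=; first by rewrite eqxx.
move=> n0; have [c0|] := eqVneq (c l) 0; last by move/h.
have h' : hc (fun k => c (j :: k)) l != 0.
  by apply: contraNneq n0 => ->; rewrite c0 subr0 linear0.
rewrite addSnnS; apply: IH h' => l' /h /=.
by rewrite addSnnS.
Qed.

Lemma hc_comm m (C : 'I_r -> seq 'I_r -> N m) l :
  (forall l, \sum_j gact (erefl (m + 1%N%:Z)) (x j) (C j l) = 0) ->
  \sum_j gact (subrK 1 m : m - 1 + 1%N%:Z = m) (x j) (hc (C j) l) = 0.
Proof.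
have e0 : m + 1 - 1 + 0%N%:Z = m by lia.
elim: l C => [|k l IH] C h /=; first by rewrite big1 // => j _; rewrite gact0.
under eq_bigr => j _ do rewrite (linB (gact_linearr _ _)).
rewrite sumrB (IH (fun j l => C j (k :: l))) ?subr0 //.
under eq_bigr => j _ do rewrite -/(gmulhom (x j) (g k) (C j l)) (gmulhom_cast _ _ _ e0).
by rewrite -(linS (gcast_linear e0)) -linear_sum h linear0 /gcast gact0.
Qed.

(** The boundary of [hc c] is the sum of the [x_j g_j c], which is [c], minus a term that [hc_comm]
    kills because the [g_j] commute with the [x_j] and [c] is a cycle. *)
Lemma koszul_exact_contract p m : koszul_exact p N m.
Proof.
move=> c ca cs cc; exists (hc c); split; first exact: hc_alt.
  move=> l n0; rewrite -[size l]addn0; apply: (hc_supp _ n0) => l' /cs <-.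
  by rewrite addn0.
move=> l; rewrite /bd /=; under eq_bigr => j _ do rewrite (linB (gact_linearr _ _)).
rewrite sumrB (hc_comm (C := fun j l => c (j :: l))) ?subr0; last by move=> l'; exact: cc.
by rewrite -g_sum.
Qed.
End Contract.

Section Exact.
Variables (L B C : gmod A) (i : ghom L B) (pi : ghom B C).
Hypothesis s : ses i pi.

Lemma chain_lift m (e : seq 'I_r -> C m) p : alt e -> csupp p e ->
  exists f : seq 'I_r -> B m, [/\ alt f, csupp p f & forall l, pi m (f l) = e l].
Proof.
move=> ea es; have [t tl tK] := lin_section (ghom_linear pi (n:=m)) (ses_surj s (n:=m)).
exists (fun l => t (e l)); split.
- by apply: alt_lin => //; [exact: lin0 | exact: linN].
- by apply: csupp_lin => //; exact: lin0.
- by move=> l; exact: tK.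
Qed.

Lemma chain_pull m (c : seq 'I_r -> B m) p : alt c -> csupp p c ->
  (forall l, pi m (c l) = 0) ->
  exists a : seq 'I_r -> L m, [/\ alt a, csupp p a & forall l, i m (a l) = c l].
Proof.
move=> [h1 h2] cs c0; have ex l : exists y, i m y = c l.
  by have [y ->] := ses_ex s (c0 l); exists y.
pose a l := sval (cid (ex l)).
have aE l : i m (a l) = c l by exact: (svalP (cid (ex l))).
have im := ses_mono s (n:=m).
exists a; split=> //.
  split=> [l1 k l2|l1 k j l2]; apply: im; rewrite ?linearN !aE ?h1 ?linear0 //.
by move=> l n0; apply: cs; rewrite -aE; apply: contraNneq n0 => /eqP; rewrite -(linear0 (i m)) => /eqP/im ->.
Qed.

Lemma koszul_exact_mid p m : koszul_exact p L m -> koszul_exact p C m -> koszul_exact p B m.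
Proof.
move=> hL hC c ca cs cc.
have [|||e [ea es eE]] := hC (fun l => pi m (c l)).
- by apply: alt_lin => // [|v]; rewrite ?linear0 ?linearN.
- by apply: csupp_lin => //; rewrite linear0.
- by move=> m' e l; rewrite -bd_hom cc linear0.
have [f [fa fs fE]] := chain_lift ea es.
have [|||a [aa as_ aE]] := @chain_pull m (fun l => c l - bd (subrK 1 m) f l) p.
- by apply: alt_sub => //; exact: bd_alt.
- by apply: csupp_sub => //; exact: bd_supp.
- move=> l; rewrite linearB /= bd_hom -eE.
  by rewrite (_ : (fun k => pi _ (f k)) = e) ?subrr //; apply/funext.
have [|//|//|b [ba bs bE]] := hL a; first by [].
  move=> m' e' l; apply: (ses_mono s); rewrite bd_hom linear0.
  rewrite (_ : (fun k => i m (a k)) = fun k => c k - bd (subrK 1 m) f k); last exact/funext.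
  by rewrite bd_sub cc bd_bd // subrr.
exists (fun l => f l - - i _ (b l)); split.
- apply: alt_sub => //; apply: (@alt_lin _ _ (fun v => - i (m - 1) v) b) => // [|v].
    by rewrite linear0 oppr0.
  by rewrite linearN.
- apply: csupp_sub => //; apply: (@csupp_lin _ _ (fun v => - i (m - 1) v) p.+1 b) => //.
  by rewrite linear0 oppr0.
- move=> l; have -> : bd (subrK 1 m) (fun l => f l - - i _ (b l)) l = bd (subrK 1 m) f l + i m (bd (subrK 1 m) b l).
    rewrite bd_hom /bd -big_split; apply: eq_bigr => j _ /=.
    by rewrite opprK (linD (gact_linearr _ _)).
  by rewrite bE aE addrC subrK.
Qed.

(** Long exact sequence of Koszul homology. The connecting map raises the homological degree and
    lowers the coefficient degree, because a bounding chain has coefficients one degree lower. *)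
Lemma koszul_exact_left p m : koszul_exact p B m -> koszul_exact p.+1 C (m - 1) -> koszul_exact p L m.
Proof.
move=> hB hC c ca cs cc.
have [|||c' [ca' cs' cE']] := hB (fun l => i m (c l)).
- by apply: alt_lin => // [|v]; rewrite ?linear0 ?linearN.
- by apply: csupp_lin => //; rewrite linear0.
- by move=> m' e l; rewrite -bd_hom cc linear0.
have [|||e [ea es eE]] := hC (fun l => pi (m - 1) (c' l)).
- by apply: alt_lin => // [|v]; rewrite ?linear0 ?linearN.
- by apply: csupp_lin => //; rewrite linear0.
- by apply: (cyc_of (e := subrK 1 m)) => l; rewrite -bd_hom cE' (ses_pi s).
have [f [fa fs fE]] := chain_lift ea es.
have [|||a [aa as_ aE]] := @chain_pull (m - 1) (fun l => c' l - bd (subrK 1 (m - 1)) f l) p.+1.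
- by apply: alt_sub => //; exact: bd_alt.
- by apply: csupp_sub => //; exact: bd_supp.
- move=> l; rewrite linearB /= bd_hom -eE.
  by rewrite (_ : (fun k => pi _ (f k)) = e) ?subrr //; apply/funext.
exists a; split=> // l; apply: (ses_mono s); rewrite bd_hom.
rewrite (_ : (fun k => i _ (a k)) = fun k => c' k - bd (subrK 1 (m - 1)) f k); last exact/funext.
by rewrite bd_sub bd_bd // subr0 cE'.
Qed.

Lemma koszul_exact0_right m : koszul_exact 0 B m -> koszul_exact 0 C m.
Proof.
move=> hB c ca cs _; have [f [fa fs fE]] := chain_lift ca cs.
have [//|//||f' [fa' fs' fE']] := hB f.
  move=> m' e l; rewrite /bd big1 // => j _.
  have [->|/fs //] := eqVneq (f (j :: l)) 0; exact: gact0.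
exists (fun l => pi _ (f' l)); split.
- by apply: alt_lin => // [|v]; rewrite ?linear0 ?linearN.
- by apply: csupp_lin => //; rewrite linear0.
- by move=> l; rewrite -bd_hom fE' fE.
Qed.
End Exact.

(** Graded Nakayama in a single degree: vanishing of [H_0] writes [y] as a sum of [x_j z_j] with
    [z_j] of degree [m - 1]. *)
Lemma koszul_exact0_zero N m : koszul_exact 0 N m -> (forall y : N (m - 1), y = 0) -> forall y : N m, y = 0.
Proof.
move=> h z y; pose c (l : seq 'I_r) := if l is [::] then y else 0.
have [|||c' [_ _ /(_ [::])]] := h c.
- by split=> [[|k l1] i l2|[|k l1] i j l2] //=; rewrite oppr0.
- by case=> [|j l] //=; rewrite eqxx.
- by move=> m' e l; rewrite /bd big1 // => j _; rewrite gact0.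
by rewrite /bd big1 //= => j _; rewrite (z (c' [:: j])) gact0.
Qed.

End Chains.

(** * Cohen-Macaulay modules *)

Section Cmres.
Variables (K : fieldType) (A : galg K).

(* N has a resolution-like complex of modules with partitions of unity, whose  *)
(* only augmented cohomology sits at position b and in degrees at most e.      *)
Definition cmres (N : gmod A) (b : nat) (e : int) : Prop :=
  exists (D : nat -> gmod A) (io : ghom N (D 0%N)) (d : forall j, ghom (D j) (D j.+1)),
  [/\ gmono io, forall j n x, d j n (aug_map io d j n x) = 0, forall j, has_partition (D j),
      forall j n, exact_at (aug_map io d j) (d j) n <-> ~ (j = b /\ n <= e) &
      forall n, nonzero (N n) \/ n - b%:Z <= e].

Lemma image_factor (Y D : gmod A) (f : ghom Y D) : exists (T I : gmod A)
  (t : ghom T Y) (q : ghom Y I) (c : ghom I D),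
  [/\ ses t q, gmono c & forall n y, c n (q n y) = f n y].
Proof.
pose I := gsub (gim_sub f); pose c := gincl (gim_sub f).
have [q qE] : exists q : ghom Y I, forall n y, c n (q n y) = f n y.
  apply: (glift (g := f)); first exact: gincl_inj.
  move=> n y; have [|z <-] := @gincl_surj _ _ _ _ (gim_sub f) n (f n y); last by exists z.
  by apply/asboolP; exists y.
have qs : gsurj q.
  move=> n z; have /asboolP[y zy] := gincl_in z; exists y.
  by apply: (@gincl_inj _ _ _ _ (gim_sub f)); rewrite qE -zy.
have [T [t s]] := ses_ker qs; exists T, I, t, q, c; split=> //; exact: gincl_inj.
Qed.

Lemma killed_mod_ker (L M N : gmod A) (f : ghom L M) (p : ghom M N) k n (x : M n) :
  (forall n z, p n z = 0 -> exists y, z = f n y) -> killed k (p n x) -> killed_mod f k x.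
Proof.
move=> h; elim: k n x => [|k IH] n x /=; first exact: h.
by move=> kx i m e a i0; apply: IH; rewrite ghom_act; exact: kx.
Qed.

End Cmres.

Section CohenMacaulay.
Variables (K : fieldType) (r : nat).
Local Notation S := (polyAlg K r).

(** One step of the resolution: [Y] maps to the product [sD] of its localizations with kernel the
    torsion of [Y], and [sN] is the cokernel. *)
Record loc_step (Y : gmod S) := LocStep {
  sD : gmod S; sN : gmod S; seta : ghom Y sD; spi : ghom sD sN;
  sg : 'I_r -> ghom sD (shift sD (- 1));
  s_ker : forall n y, seta n y = 0 <-> torsion y;
  s_surj : gsurj spi;
  s_pik : forall n x, spi n x = 0 <-> exists y, x = seta n y;
  s_sum : forall n (z : sD n), z = \sum_i gmulhom (var K i) (sg i) z;
  s_idem : forall i n (z : sD n), gmulhom (var K i) (sg i) (gmulhom (var K i) (sg i) z)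
    = gmulhom (var K i) (sg i) z }.

Lemma loc_step_ex Y : exists s : loc_step Y, True.
Proof.
have [D [eta [g [ke su idm]]]] := loc_exists (@var K r) Y.
have h1 n y : eta n y = 0 <-> torsion y by rewrite ke torsionE.
have h2 : gsurj (gpi (gim_sub eta)) by exact: gpi_surj.
have h3 n x : gpi (gim_sub eta) n x = 0 <-> exists y, x = eta n y.
  by rewrite gpi_eq0; split=> [/asboolP|h]; last exact/asboolP.
by exists (@LocStep Y D _ eta (gpi (gim_sub eta)) g h1 h2 h3 su idm).
Qed.

Definition loc_step_of Y : loc_step Y := sval (cid (loc_step_ex Y)).

Lemma s_partition Y (s : loc_step Y) : has_partition (sD s).
Proof.
pose f c := if insub c is Some i then var K (i : 'I_r) else 0.
pose g c := if insub c is Some i then sg s (i : 'I_r) else gzero _ _.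
exists r, f, g => n x; rewrite [LHS](s_sum x); apply: eq_bigr => c _.
by rewrite /f /g valK.
Qed.

Variable M : gmod S.

Fixpoint Yseq j : gmod S := if j is j'.+1 then sN (loc_step_of (Yseq j')) else M.
Let st j : loc_step (Yseq j) := loc_step_of (Yseq j).
Definition Dseq j : gmod S := sD (st j).
Let eta j : ghom (Yseq j) (Dseq j) := seta (st j).
Let pi j : ghom (Dseq j) (Yseq j.+1) := spi (st j).
Definition dseq j : ghom (Dseq j) (Dseq j.+1) := gcompo (eta j.+1) (pi j).

(** The torsion of [Yseq j] plays the role of the [j]-th local cohomology of [M]; [lc_torsionless]
    proves that they vanish together. *)
Definition torsionless j n := forall y : Yseq j n, torsion y -> y = 0.

Variable d : nat.
Hypothesis d_gt0 : (0 < d)%N.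
Hypothesis V_M : forall j, j != d -> koszul_vanish M j.

Lemma koszul_vanish_Yseq i j : koszul_vanish M (i + j) -> koszul_vanish (Yseq i) j.
Proof.
elim: i j => [|i IH] j //; rewrite addSnnS => /IH.
apply: (koszul_vanish_link (g := sg (st i)) (eta := eta i) (pi := pi i)).
- exact: s_ker.
- exact: s_surj.
- exact: s_pik.
- exact: s_sum.
- exact: s_idem.
Qed.

Lemma torsionless_neq j n : j != d -> torsionless j n.
Proof. by move=> jd y; apply: koszul_vanish0_torsion; apply: koszul_vanish_Yseq; rewrite addn0; exact: V_M. Qed.

Lemma aug_im j n x : (exists y, x = aug_map (eta 0) dseq j n y) <-> pi j n x = 0.
Proof.
rewrite s_pik; case: j x => [|j] x //=; split=> [[y ->]|[y ->]].
  by exists (pi j n y).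
by have [z <-] := s_surj (l := st j) y; exists z.
Qed.

(** The cocycles of [Dseq j] are the preimage of the torsion of [Yseq j.+1], and the boundaries are
    the kernel of the projection onto it. *)
Lemma exact_torsionless j n : exact_at (aug_map (eta 0) dseq j) (dseq j) n <-> torsionless j.+1 n.
Proof.
split=> [ex y ty|tz x dx].
  have [x xy] := s_surj (l := st j) y; rewrite -xy; apply/aug_im/ex.
  by apply/(s_ker (st j.+1)); rewrite xy.
by apply/aug_im; apply: tz; apply/(s_ker (st j.+1)).
Qed.

Let x := @var K r.

Lemma koszul_exact_Dseq p j m : koszul_exact x p (Dseq j) m.
Proof. by apply: (koszul_exact_contract (g := sg (st j))); exact: s_sum. Qed.

Lemma Yseq_factor j : exists (T I : gmod S) (t : ghom T (Yseq j)) (q : ghom (Yseq j) I)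
  (c : ghom I (Dseq j)),
  [/\ ses t q, ses c (pi j) & forall n, (forall z : T n, z = 0) <-> torsionless j n].
Proof.
have [T [I [t [q [c [s cm cE]]]]]] := image_factor (eta j).
exists T, I, t, q, c; split=> //.
  split=> //; first exact: s_surj.
    by move=> n z; have [y <-] := ses_surj s z; rewrite cE; apply/s_pik; exists y.
  by move=> n z /s_pik[y ->]; exists (q n y); rewrite cE.
move=> n; split=> [h y ty|h z].
  have : q n y = 0 by apply: cm; rewrite cE linear0; exact/s_ker.
  by case/(ses_ex s) => z ->; rewrite (h z) linear0.
apply: (gmono_eq0 (ses_mono s)); apply: h; apply/(s_ker (st j)).
by rewrite -[LHS]cE (ses_pi s) linear0.
Qed.

Lemma koszul_exact_Yseq_step p j m : torsionless j m -> koszul_exact x p.+1 (Yseq j.+1) (m - 1) -> koszul_exact x p (Yseq j) m.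
Proof.
have [T [I [t [q [c [s s' tz]]]]]] := Yseq_factor j => /tz h hk.
apply: (koszul_exact_mid s); first exact: koszul_exact_trivial.
by apply: (koszul_exact_left s') => //; exact: koszul_exact_Dseq.
Qed.

(** Beyond [d] there is no torsion, so [Yseq j] embeds in [Dseq j] with cokernel [Yseq j.+1]. As
    [Dseq j] has no Koszul homology, [H_p] of the former is controlled by [H_{p+1}] of the latter,
    until [p] exceeds [r]. *)
Lemma koszul_exact_Yseq_above p j m : (d < j)%N -> koszul_exact x p (Yseq j) m.
Proof.
move: {2}(r.+1 - p)%N (leqnn (r.+1 - p)) => k; elim: k p j m => [|k IH] p j m kp dj.
  by apply: koszul_exact_big; lia.
apply: koszul_exact_Yseq_step; first by apply: torsionless_neq; rewrite gtn_eqF.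
by apply: IH; lia.
Qed.

(** The torsion [T] of [Yseq d] has [H_0 = 0], so degree [n] generates degree [n + 1]. Indeed [H_0]
    of [Yseq d] vanishes, as it is a quotient of [Dseq d.-1], and [H_1] of its image in [Dseq d]
    vanishes because [H_2] of [Yseq d.+1] does. *)
Lemma torsionless_up n : torsionless d n -> torsionless d (n + 1).
Proof.
have [T [I [t [q [c [s s' tz]]]]]] := Yseq_factor d => /tz h; apply/tz.
apply: (koszul_exact0_zero (x := x)); last by rewrite addrK.
apply: (koszul_exact_left s).
  case: d d_gt0 => [//|d'] _; have [T' [I' [t' [q' [c' [_ s'' _]]]]]] := Yseq_factor d'.
  by apply: (koszul_exact0_right s''); exact: koszul_exact_Dseq.
by apply: (koszul_exact_left s'); [exact: koszul_exact_Dseq | exact: koszul_exact_Yseq_above].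
Qed.

(** Shifting [d] times reduces [H_0(M)] in degree [a] to [H_d] of [Yseq d] in coefficient degree
    [a - d], which vanishes when there is no torsion there. Thus [M] has no minimal generator in
    degree [a]. *)
Lemma torsionless_initial a : torsionless d (a - d%:Z) -> (forall y : M (a - 1), y = 0) -> forall y : M a, y = 0.
Proof.
move=> tz; apply: (koszul_exact0_zero (x := x)).
suff gen k : (k <= d)%N -> koszul_exact x (d - k) (Yseq (d - k)) (a - (d - k)%N%:Z).
  by have := gen d (leqnn d); rewrite subnn subr0.
elim: k => [|k IH] koszul_d.
  by rewrite subn0; apply: koszul_exact_Yseq_step => //; exact: koszul_exact_Yseq_above.
apply: koszul_exact_Yseq_step; first by apply: torsionless_neq; lia.
have e1 : (d - k.+1).+1 = (d - k)%N by lia.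
rewrite e1 (_ : a - (d - k.+1)%N%:Z - 1 = a - (d - k)%N%:Z); last by lia.
exact: IH (ltnW koszul_d).
Qed.

Variables (E : injres M) (rho : int).
Hypothesis M_reg : is_reg E rho.

Let eta0_mono : gmono (eta 0).
Proof.
apply: gmono0 => n y h; apply: (torsionless_neq (j := 0%N)); first by rewrite ltn_eqF.
exact/(s_ker (st 0)).
Qed.

Lemma dseqK j m z : dseq j m (aug_map (eta 0) dseq j m z) = 0.
Proof.
have h : pi j m (aug_map (eta 0) dseq j m z) = 0 by apply/aug_im; exists z.
by rewrite [LHS](congr1 (eta j.+1 m) h) linear0.
Qed.

Lemma lc_vanish_Yseq i n : (forall j, (j < i)%N -> exists c, forall n, c < n -> torsionless j.+1 n) ->
  lc_vanish i M n <-> torsionless i.+1 n.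
Proof.
move=> bd; rewrite -exact_torsionless; apply: lc_vanish_complex => //.
- exact: dseqK.
- by move=> j; exact: s_partition.
- move=> j m z _ dz; have [k kz] : torsion (pi j m z) by exact/(s_ker (st j.+1)).
  by exists k; apply: killed_mod_ker kz => q w /aug_im.
- by move=> j /bd[c h]; exists c => m /h /exact_torsionless.
Qed.
Let lc_torsionless i n : (forall j, (j < i)%N -> exists c, forall n, c < n -> torsionless j n) ->
  nonzero (local_cohomology E i n) <-> ~ torsionless i n.
Proof.
case: i => [|i] bd.
  rewrite local_cohomology0; split=> [[y ty /eqP y0] h|h]; first by apply: y0; exact: h.
  by case: h; apply: torsionless_neq; rewrite ltn_eqF.
by rewrite local_cohomologyS lc_vanish_Yseq // => j ji; exact: bd.
Qed.

Let torsionless_above n : rho - d%:Z < n -> torsionless d n.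
Proof.
move=> h; apply: contrapT => nT.
have [_ /(_ (n + d%:Z)) mx] := M_reg.
suff : (n + d%:Z <= rho)%O by lia.
apply: mx; exists d, n; split=> //; apply/lc_torsionless => // j jd.
by exists 0 => m _; apply: torsionless_neq; rewrite ltn_eqF.
Qed.

Let torsionless_bounded j : exists c, forall n, c < n -> torsionless j n.
Proof.
have [->|jd] := eqVneq j d; first by exists (rho - d%:Z) => n /torsionless_above.
by exists 0 => n _; exact: torsionless_neq.
Qed.

Let torsionlessE j n : torsionless j n <-> ~ (j = d /\ n <= rho - d%:Z).
Proof.
split=> [tz [jd nr]|h]; last first.
  have [jd|] := eqVneq j d; last exact: torsionless_neq.
  by rewrite jd; apply: torsionless_above; rewrite ltNge; apply/negP => nr; apply: h.
(* Absence of torsion at some [n <= rho - d] would propagate up to [rho - d], where the definition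
   of regularity provides nonzero local cohomology. *)
subst j; have up k : torsionless d (n + k%:Z).
  elim: k => [|k IH]; first by rewrite addr0.
  by rewrite (_ : n + k.+1%:Z = n + k%:Z + 1); [exact: torsionless_up | lia].
have [[j [m [nz e]]] _] := M_reg; have /lc_torsionless := nz => /(_ (fun j _ => torsionless_bounded j)).
have [jd|jd] := eqVneq j d; last by apply; exact: torsionless_neq.
subst j; have := up `|m - n|%N; rewrite (_ : n + _ = m) //; lia.
Qed.

Lemma cohen_macaulay_local_cohomology j n :
  nonzero (local_cohomology E j n) <-> j = d /\ n <= rho - d%:Z.
Proof.
rewrite lc_torsionless; last by move=> i _; exact: torsionless_bounded.
by rewrite torsionlessE; split=> [/contrapT|h /(_ h)].
Qed.

Lemma cohen_macaulay_cmres : cmres M d.-1 (rho - d%:Z).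
Proof.
exists Dseq, (eta 0), dseq; split=> //.
- exact: dseqK.
- by move=> j; exact: s_partition.
- move=> j n; rewrite exact_torsionless torsionlessE; split=> h [h1 h2]; apply: h; split=> //; lia.
- move=> n; case: (pselect (nonzero (M n))) => [|nz]; [by left | right].
  (* Here [n >= rho]. If [M] vanishes in degree [n], it has no new generators above and so is
     bounded above; then [H^d(M) = 0], as [d > 0], contrary to [M_reg]. *)
  rewrite leNgt; apply/negP => lt; have M0 : forall y : M n, y = 0.
    by move=> y; apply/eqP; apply: contrapT => /negP yn; apply: nz; exists y.
  have up k : forall y : M (n + k%:Z), y = 0.
    elim: k => [|k IH]; first by rewrite addr0.
    apply: torsionless_initial; first by apply: torsionless_above; lia.
    by rewrite (_ : n + k.+1%:Z - 1 = n + k%:Z) //; lia.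
  have [[j [m [/cohen_macaulay_local_cohomology[jd mr] _]]] _] := M_reg.
  have /cohen_macaulay_local_cohomology : d = d /\ m <= rho - d%:Z by [].
  rewrite -(prednK d_gt0) => /local_cohomologyS; apply; apply: (bounded_acyc (c := n)).
  move=> k nk; have -> : k = n + `|k - n|%N%:Z by lia.
  exact: up.
Qed.
End CohenMacaulay.

Lemma cohen_macaulay_koszul_vanish (K : fieldType) r (M : gmod (polyAlg K r)) d j :
  cohen_macaulay M -> is_dim M d -> j != d -> koszul_vanish M j.
Proof.
move=> [d' dim' [[a sa ra] _]] dim jd.
have dd : d' = d.
  have [h1 h2] := dim; have [h1' h2'] := dim'.
  by apply/eqP; rewrite eqn_leq; apply/andP; split; [exact: h2 | exact: h2'].
have [jl|lj|jE] := ssrnat.ltngtP j d; last by rewrite jE eqxx in jd.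
  by apply: (koszul_vanish_lt_depth ra); rewrite sa dd.
exact: (koszul_vanish_gt_dim dim).
Qed.

(** * Veronese transforms *)

Section Part.
Variables (K : fieldType) (A : galg K).

Lemma partition_fin (X : gmod A) (C : finType) (f : C -> A 1%N) (g : C -> ghom X (shift X (- 1))) :
  (forall n x, x = \sum_c gmulhom (f c) (g c) x :> X n) -> has_partition X.
Proof.
move=> h.
pose f' i := if insub i is Some j then f (enum_val (j : 'I_#|C|)) else 0.
pose g' i := if insub i is Some j then g (enum_val (j : 'I_#|C|)) else gzero _ _.
exists #|C|, f', g' => n x; rewrite [LHS]h (reindex_onto enum_val enum_rank) /=.
  by rewrite (eq_bigl xpredT) => [|i]; [apply: eq_bigr => i _; rewrite /f' /g' valK | rewrite enum_valK eqxx].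
by move=> i _; exact: enum_rankK.
Qed.

Definition gmulk (X : gmod A) k (f : A k) (g : ghom X (shift X (- k%:Z))) n (x : X n) : X n :=
  gact (subrK k%:Z n) f (g n x).

(** Partition of unity by forms of degree [k], the [k]-fold product of one by linear forms. Linear
    forms of the Veronese ring are forms of degree [n]. *)
Definition partition_power k (X : gmod A) : Prop := exists (C : finType) (f : C -> A k)
    (g : C -> ghom X (shift X (- k%:Z))),
  forall n x, x = \sum_c gmulk (f c) (g c) x :> X n.

Lemma partition_power0 X : partition_power 0 X.
Proof.
have e n : n + 0%N%:Z = n - 0%N%:Z by lia.
pose G n (x : X n) : shift X (- 0%N%:Z) n := gcast (e n) x.
have Gl n : linear (G n) by exact: gcast_linear.
have act i n m (e' : n + i%:Z = m) (a : A i) (x : X n) :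
    G m (gact e' a x) = gact e' a (G n x).
  have e2 : n + i%:Z = m - 0%N%:Z by lia.
  by rewrite /G (gcast_act _ _ e2); symmetry; exact: (gact_cast (e n) (shift_deg (- 0%N%:Z) e') e2).
exists unit, (fun _ => aone A), (fun _ => mkhom Gl act).
move=> n x; rewrite (big_pred1 tt) => [|[]//].
exact: esym (gcastK (e n) (subrK 0%N%:Z n) x).
Qed.

Lemma partition_powerS k X : has_partition X -> partition_power k X -> partition_power k.+1 X.
Proof.
move=> [t [f [g h]]] [C [f' [g' h']]].
have e n : n - 1 - k%:Z + 0%N%:Z = n - k.+1%:Z by lia.
pose G c c' n (x : X n) : shift X (- k.+1%:Z) n := gcast (e n) (g' c' (n - 1) (g c n x)).
have Gl c c' n : linear (G c c' n) by move=> a x y; rewrite /G !linearP gcast_linear.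
have Ga c c' i n m (e' : n + i%:Z = m) (a : A i) (x : X n) :
    G c c' m (gact e' a x) = gact e' a (G c c' n x).
  rewrite /G (ghom_act (g c)) (ghom_act (g' c')).
  have e2 : n - 1 - k%:Z + i%:Z = m - k.+1%:Z by lia.
  by rewrite (gcast_act _ _ e2); symmetry; exact: (gact_cast (e n) (shift_deg (- k.+1%:Z) e') e2).
exists ('I_t * C)%type, (fun p : 'I_t * C => amul (add1n k) (f p.1) (f' p.2)).
exists (fun p : 'I_t * C => mkhom (Gl p.1 p.2) (Ga p.1 p.2)) => n x.
rewrite [LHS]h -(pair_bigA _ (fun (c : 'I_t) (c' : C) => gmulk (amul (add1n k) (f c) (f' c'))
  (mkhom (Gl c c') (Ga c c')) x)) /=; apply: eq_bigr => c _.
rewrite /gmulhom [g c n x in LHS]h' (linS (gact_linearr _ _)); apply: eq_bigr => c' _.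
have e3 : n - 1 - k%:Z + k.+1%:Z = n by lia.
rewrite /gmulk (gactA (add1n k) (subrK k%:Z (n - 1)) (subrK 1 n) e3) /= /G.
by rewrite gact_cast.
Qed.

Lemma has_partition_power X k : has_partition X -> partition_power k X.
Proof. by move=> p; elim: k => [|k]; [exact: partition_power0 | exact: partition_powerS]. Qed.
End Part.

Section Veronese.
Variables (K : fieldType) (A : galg K) (n : nat) (tau : int).
Local Notation "M ^v" := (veronese n M tau) (at level 2, format "M ^v").

Definition gver (M N : gmod A) (f : ghom M N) : ghom M^v N^v.
Proof.
refine (@mkhom _ _ M^v N^v (fun k (x : M (n%:Z * k + tau)) => f (n%:Z * k + tau) x) _ _).
  by move=> k; exact: (ghom_linear f).
by move=> i k m e a x; exact: (ghom_act f).
Defined.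

Lemma partition_veronese (X : gmod A) : has_partition X -> has_partition X^v.
Proof.
move=> /(has_partition_power (1 * n))[C [f [g h]]].
have e k : n%:Z * k + tau - (1 * n)%N%:Z + 0%N%:Z = n%:Z * (k - 1) + tau by lia.
pose G c k (x : X^v k) : shift X^v (-1) k := gcast (e k) (g c (n%:Z * k + tau) x).
have Gl c k : linear (G c k) by move=> a x y; rewrite /G linearP gcast_linear.
have Ga c i k m (e' : k + i%:Z = m) (a : veroneseAlg A n i) (x : X^v k) :
    G c m (gact e' a x) = gact e' a (G c k x).
  rewrite /G (ghom_act (g c)).
  have e2 : n%:Z * k + tau - (1 * n)%N%:Z + (i * n)%N%:Z = n%:Z * (m - 1) + tau by nia.
  by rewrite (gcast_act _ _ e2); symmetry; exact: (gact_cast (e k) (veronese_mdeg n tau (shift_deg (- 1) e')) e2).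
apply: (partition_fin (f := f : C -> veroneseAlg A n 1) (g := fun c => mkhom (Gl c) (Ga c))).
move=> k x; rewrite [LHS]h; apply: eq_bigr => c _.
symmetry; exact: (gact_cast (e k) (veronese_mdeg n tau (subrK 1 k)) (subrK _ _)).
Qed.

Lemma cmres_veronese (N : gmod A) b e e' : (0 < n)%N ->
  (forall k, n%:Z * k + tau <= e <-> k <= e') -> cmres N b e -> cmres N^v b e'.
Proof.
move=> n0 ee [D [io [d [mio dd pD ex ne]]]].
have exv j k : exact_at (aug_map (X := fun j => (D j)^v) (gver io) (fun j => gver (d j)) j) (gver (d j)) k
    <-> exact_at (aug_map io d j) (d j) (n%:Z * k + tau) by case: j.
exists (fun j => (D j)^v), (gver io), (fun j => gver (d j)); split.
- by move=> k; exact: mio.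
- by case=> [|j] k x; [exact: (dd 0%N) | exact: (dd j.+1)].
- by move=> j; exact: partition_veronese.
- by move=> j k; rewrite exv ex ee.
(* As [n >= 1], replacing [k] by [k - b] lowers the degree [n k + tau] by at least [b]. *)
- move=> k; have [[x x0]|le] := ne (n%:Z * k + tau); first by left; exists x.
  by right; apply/ee; nia.
Qed.
End Veronese.

(** * Tensor products *)

Section TensorMaps.
Variables (K : fieldType) (I : finType).

Lemma span_lin (V W : lmodType K) (f : V -> W) (P : V -> Prop) (Q : {pred W}) x :
  linear f -> submod_closed Q -> (forall y, P y -> f y \in Q) -> x \in Defs.span P -> f x \in Q.
Proof.
move=> fl [Q0 QD] h /asboolP/(_ (fun y => f y \in Q)); apply=> //.
split=> [|c u v hu lc_vanish]; first by rewrite unfold_in lin0.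
by rewrite unfold_in fl; exact: QD.
Qed.

Lemma span_eq0 (V W : lmodType K) (f : V -> W) (P : V -> Prop) x :
  linear f -> (forall y, P y -> f y = 0) -> x \in Defs.span P -> f x = 0.
Proof.
move=> fl h /asboolP/(_ (fun y => f y == 0)) h'; apply/eqP; apply: h'.
  split=> [|c u v /eqP hu /eqP lc_vanish]; rewrite unfold_in; first by rewrite lin0.
  by rewrite fl hu lc_vanish scaler0 addr0.
by move=> y /h/eqP.
Qed.

Lemma eq_dfwith (V : I -> Type) (x y : forall i, V i) l :
  (forall i, i != l -> x i = y i) -> dfwith y (x l) = x.
Proof.
move=> h; apply: functional_extensionality_dep => i; have [->|il] := eqVneq i l.
  by rewrite dfwith_in.
by rewrite dfwith_out 1?eq_sym // h.
Qed.

Lemma pure_slot (V : I -> lmodType K) (u v w : forall i, V i) l c :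
  (forall i, i != l -> u i = w i) -> (forall i, i != l -> v i = w i) ->
  w l = c *: u l + v l -> pure w = c *: pure u + pure v.
Proof.
move=> hu lc_vanish hw; rewrite -(eq_dfwith hu) -(eq_dfwith lc_vanish) -pure_multilinear -hw.
by congr pure; rewrite eq_dfwith.
Qed.

Lemma pure_slot0 (V : I -> lmodType K) (v : forall i, V i) l : v l = 0 -> pure v = 0.
Proof.
move=> v0; have e : pure v = 1 *: pure v + pure v.
  by apply: (pure_slot (l := l)); rewrite // v0 scaler0 addr0.
by apply: (addrI (pure v)); rewrite addr0 {3}e scale1r.
Qed.

Lemma pure_slotN (V : I -> lmodType K) (u w : forall i, V i) l :
  (forall i, i != l -> u i = w i) -> w l = - u l -> pure w = - pure u.
Proof.
move=> hu hw; pose z := dfwith u (0 : V l).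
have zu i : i != l -> z i = w i by move=> il; rewrite -hu // /z dfwith_out // eq_sym.
have z0 : z l = 0 by rewrite /z dfwith_in.
by rewrite (pure_slot (c := -1) hu zu) ?z0 ?addr0 ?scaleN1r // (pure_slot0 z0) addr0.
Qed.

Definition tensor_map (V W : I -> lmodType K) (f : forall i, V i -> W i) : tensor V -> tensor W :=
  tlift (fun v => pure (fun i => f i (v i))).

Section Tmap.
Variables (V W : I -> lmodType K) (f : forall i, V i -> W i).
Hypothesis fl : forall i, linear (@f i).

Let tmap_ml : multilinear (fun v : forall i, V i => pure (fun i => @f i (v i))).
Proof. by move=> v i c x y; rewrite !(comp_dfwith f) fl pure_multilinear. Qed.

Lemma tensor_map_pure v : tensor_map f (pure v) = pure (fun i => @f i (v i)).
Proof. exact: tlift_pure. Qed.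

Lemma tensor_map_linear : linear (tensor_map f).
Proof. exact: tlift_linear. Qed.
End Tmap.

Section Tfun.
Variables (V : I -> lmodType K) (f : forall i, V i -> K^o).
Hypothesis fl : forall i, linear (@f i).

Let tfun_ml : multilinear (fun v : forall i, V i => (\prod_i f (v i) : K^o)).
Proof.
move=> v l c x y.
have E (u : forall i, V i) : \prod_i f (u i) = f (u l) * \prod_(i | i != l) f (u i).
  by rewrite (bigD1 l).
rewrite 3!E !dfwith_in fl mulrDl -scalerAl.
congr (_ *: (_ * _) + _ * _); apply: eq_bigr => i il; by rewrite !dfwith_out // eq_sym.
Qed.

Definition tfun : tensor V -> K^o := tlift (fun v => \prod_i f (v i) : K^o).

Lemma tfun_pure v : tfun (pure v) = \prod_i f (v i).
Proof. exact: tlift_pure. Qed.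

Lemma tfun_linear : linear tfun.
Proof. exact: tlift_linear. Qed.
End Tfun.

Lemma linear0_closed (V : lmodType K) : submod_closed (fun x : V => x == 0).
Proof.
split=> [|c x y /eqP -> /eqP ->]; rewrite unfold_in //.
by rewrite scaler0 addr0.
Qed.

(** A product of functionals with value [1] at each [v i] has value [1] on the pure tensor. *)
Lemma pure_neq0 (V : I -> lmodType K) (v : forall i, V i) : (forall i, v i <> 0) -> pure v <> 0.
Proof.
move=> v0 e0.
have h i : exists f : V i -> K^o, linear f /\ f (v i) = 1.
  have [|f fl [f1 _]] := functional (v := v i) (linear0_closed (V i)); last by exists f.
  by rewrite unfold_in; apply/negP => /eqP; exact: v0.
pose f i := sval (cid (h i)); have fl i : linear (f i) by case: (svalP (cid (h i))).
have := lin0 (tfun_linear fl); rewrite -e0 tfun_pure // big1 => [/eqP|i _].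
  by rewrite oner_eq0.
by case: (svalP (cid (h i))).
Qed.

Lemma tensor_nonzero (V : I -> lmodType K) : nonzero (tensor V) <-> forall i, nonzero (V i).
Proof.
split=> [[t t0] i|h]; last first.
  exists (pure (fun i => sval (cid (h i)))); apply/eqP; apply: pure_neq0 => i.
  by apply/eqP; exact: (svalP (cid (h i))).
apply: contrapT => nz; move/eqP: t0; apply.
apply: (@tensor_ext K I V (tensor V) id (fun=> 0)) => //.
  by move=> c x y; rewrite scaler0 addr0.
move=> v; apply: (pure_slot0 (l := i)); apply/eqP; apply: contrapT => vi; apply: nz.
by exists (v i); apply/negP.
Qed.

(** Multilinear expansion of a pure tensor of sums. The index set and [phi] depend only on [C] and
    [r], so one expansion serves all degrees and all elements of a module. *)
Lemma pure_expand (C : finType) (c0 : C) (r : seq I) : uniq r ->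
  exists (C' : finType) (phi : C' -> I -> C), forall (V : I -> lmodType K) (F : forall i, C -> V i)
    (v : forall i, V i),
  pure (fun i => if i \in r then \sum_c F i c else v i) =
  \sum_c' pure (fun i => if i \in r then F i (phi c' i) else v i).
Proof.
elim: r => [|j r IH] /= => [_|/andP[jr /IH{IH}[C' [phi IH]]]].
  by exists unit, (fun _ _ => c0) => V F v; rewrite (big_pred1 tt) => // -[].
exists (C * C')%type, (fun p i => if i == j then p.1 else phi p.2 i) => V F v.
pose u0 i := if i \in r then \sum_c F i c else v i.
have Ll : linear (fun x : V j => pure (dfwith u0 x)) by move=> c x y; exact: pure_multilinear.
transitivity (pure (dfwith u0 (\sum_c F j c))).
  congr pure; apply: functional_extensionality_dep => i; rewrite in_cons.
  have [->|ij] := eqVneq i j; first by rewrite dfwith_in.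
  by rewrite dfwith_out // eq_sym.
rewrite (linS Ll).
rewrite -(pair_bigA _ (fun (c : C) (c' : C') => pure (fun i : I => if i \in j :: r
  then F i (if i == j then c else phi c' i) else v i))) /=; apply: eq_bigr => c _.
transitivity (pure (fun i => if i \in r then \sum_c F i c else dfwith v (F j c) i)).
  congr pure; apply: functional_extensionality_dep => i.
  have [->|ij] := eqVneq i j; first by rewrite (negPf jr) !dfwith_in.
  by rewrite !dfwith_out 1?eq_sym.
rewrite IH; apply: eq_bigr => c' _; congr pure; apply: functional_extensionality_dep => i.
rewrite in_cons; have [->|ij] := eqVneq i j; first by rewrite (negPf jr) dfwith_in.
by rewrite dfwith_out // eq_sym.
Qed.
End TensorMaps.

(** * Differentials and homotopies on tensor products *)

Section Homotopy.
Variables (K : fieldType) (s : nat) (V : 'I_s -> lmodType K).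
Implicit Types (l m i : 'I_s).

(** The operator [b] in slot [l], with the sign rule carried by the operator [a] in all earlier
    slots. *)
Definition slotwise (a b : forall i, V i -> V i) l i : V i -> V i :=
  if (i < l)%N then @a i else if i == l then @b i else id.

Lemma slotwise_linear (a b : forall i, V i -> V i) l i :
  (forall i, linear (@a i)) -> (forall i, linear (@b i)) -> linear (@slotwise a b l i).
Proof. by move=> al bl; rewrite /slotwise; do 2?case: ifP. Qed.

Section Anti.
Variables (a a' b b' : forall i, V i -> V i).
Hypotheses (al : forall i, linear (@a i)) (al' : forall i, linear (@a' i)).
Hypotheses (bl : forall i, linear (@b i)) (bl' : forall i, linear (@b' i)).
Hypothesis aa : forall i x, a (a' x) = a' (a x) :> V i.
Hypothesis ab : forall i x, a (b' x) = - b' (a x) :> V i.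
Hypothesis ba : forall i x, a' (b x) = - b (a' x) :> V i.

Lemma slotwise_anti l m v : l != m ->
  tensor_map (slotwise a b l) (tensor_map (slotwise a' b' m) (pure v)) = - tensor_map (slotwise a' b' m) (tensor_map (slotwise a b l) (pure v)).
Proof.
move=> lm; have fl1 i : linear (@slotwise a b l i) by exact: slotwise_linear.
have fl2 i : linear (@slotwise a' b' m i) by exact: slotwise_linear.
rewrite !tensor_map_pure //; have [ml|ml] := ltnP m l.
  apply: (pure_slotN (l := m)) => [i im|]; last first.
    by rewrite /slotwise ltnn eqxx ml ab.
  rewrite /slotwise -!val_eqE /= in im *; case: (ssrnat.ltngtP i m) im => // h _.
    by rewrite (ltn_trans h ml) aa.
have {}lm : (l < m)%N by rewrite ltn_neqAle lm.
apply: (pure_slotN (l := l)) => [i im|]; last first.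
  by rewrite /slotwise ltnn eqxx lm ba opprK.
rewrite /slotwise -!val_eqE /= in im *; case: (ssrnat.ltngtP i l) im => // h _.
by rewrite (ltn_trans h lm) aa.
Qed.
End Anti.

Variables sg dl kp p : forall i, V i -> V i.
Hypotheses (sgl : forall i, linear (@sg i)) (dll : forall i, linear (@dl i)).
Hypotheses (kpl : forall i, linear (@kp i)) (pl : forall i, linear (@p i)).
Hypothesis sgK : forall i x, sg (sg x) = x :> V i.
Hypothesis sgd : forall i x, sg (dl x) = - dl (sg x) :> V i.
Hypothesis dd : forall i x, dl (dl x) = 0 :> V i.

Definition tensor_diff (t : tensor V) : tensor V := \sum_l tensor_map (slotwise sg dl l) t.

Let fl l i : linear (@slotwise sg dl l i). Proof. exact: slotwise_linear. Qed.

Lemma tensor_diff_linear : linear tensor_diff.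
Proof.
move=> c x y; rewrite /tensor_diff scaler_sumr -big_split; apply: eq_bigr => l _.
exact: tensor_map_linear.
Qed.

Lemma tensor_diffK t : tensor_diff (tensor_diff t) = 0.
Proof.
move: t; apply: (@tensor_ext K _ V _ (fun t => tensor_diff (tensor_diff t)) (fun=> 0)) => [||v].
- by move=> c x y; rewrite !tensor_diff_linear.
- by move=> c x y; rewrite scaler0 addr0.
rewrite {1}/tensor_diff; under eq_bigr => l _ do rewrite /tensor_diff (linS (tensor_map_linear (@fl l))).
apply: sum_alternating => [l|l m].
  rewrite !tensor_map_pure; try exact: fl.
  by apply: (pure_slot0 (l := l)); rewrite /slotwise ltnn eqxx dd.
have [->|lm] := eqVneq l m.
  rewrite !tensor_map_pure; try exact: fl.
  by rewrite (pure_slot0 (l := m)) ?oppr0 // /slotwise ltnn eqxx dd.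
by apply: slotwise_anti => // i x; rewrite sgd opprK.
Qed.

Hypothesis sgk : forall i x, sg (kp x) = - kp (sg x) :> V i.
Hypothesis dk : forall i x, dl (kp x) + kp (dl x) = x - p x :> V i.

Lemma sg_p i x : sg (p x) = p (sg x) :> V i.
Proof.
have e y : p y = y - (dl (kp y) + kp (dl y)) :> V i by rewrite dk subKr.
by rewrite !e (linB (@sgl i)) (linD (@sgl i)) sgd !sgk sgd (linN (@kpl i)) (linN (@dll i)) !opprK.
Qed.

Lemma dl_p i x : dl (p x) = p (dl x) :> V i.
Proof.
have e y : p y = y - (dl (kp y) + kp (dl y)) :> V i by rewrite dk subKr.
by rewrite !e (linB (@dll i)) (linD (@dll i)) !dd (lin0 (@kpl i)) !addr0 add0r.
Qed.

Definition tensor_homotopy (t : tensor V) : tensor V := \sum_l tensor_map (slotwise (fun i x => sg (p x) : V i) kp l) t.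

Let spl i : linear (fun x : V i => sg (p x)).
Proof. by move=> c x y; rewrite pl sgl. Qed.

Let fl' l i : linear (@slotwise (fun i x => sg (p x) : V i) kp l i).
Proof. exact: slotwise_linear. Qed.

Lemma tensor_homotopy_linear : linear tensor_homotopy.
Proof.
move=> c x y; rewrite /tensor_homotopy scaler_sumr -big_split; apply: eq_bigr => l _.
exact: tensor_map_linear.
Qed.

(** Terms with the differential and the homotopy in different slots cancel by [slotwise_anti]. The
    terms in the same slot telescope. *)
Lemma tensor_homotopyP t : tensor_diff (tensor_homotopy t) + tensor_homotopy (tensor_diff t) = t - tensor_map p t.
Proof.
move: t; apply: (@tensor_ext K _ V _ (fun t => tensor_diff (tensor_homotopy t) + tensor_homotopy (tensor_diff t)) (fun t => t - tensor_map p t)) => [||v].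
- by move=> c x y; rewrite !(tensor_diff_linear, tensor_homotopy_linear) scalerDr addrACA.
- by move=> c x y; rewrite (tensor_map_linear pl) opprD scalerBr addrACA.
rewrite {1}/tensor_diff {2}/tensor_homotopy; under eq_bigr => l _ do rewrite /tensor_homotopy (linS (tensor_map_linear (@fl l))).
under [X in _ + X]eq_bigr => l _ do rewrite /tensor_diff (linS (tensor_map_linear (@fl' l))).
rewrite [X in _ + X]exchange_big -big_split /=.
(* [w k] has [p] applied in the first [k] slots; slot [l] contributes the difference of [w l] and
   [w l.+1]. *)
pose w k : forall i, V i := fun i => if (i < k)%N then p (v i) else v i.
have anti l m : l != m -> tensor_map (slotwise sg dl l) (tensor_map (slotwise (fun i x => sg (p x) : V i) kp m) (pure v)) =
    - tensor_map (slotwise (fun i x => sg (p x) : V i) kp m) (tensor_map (slotwise sg dl l) (pure v)).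
  by apply: slotwise_anti => // i x; rewrite -?sg_p // -dl_p sgd.
transitivity (\sum_(k < s) (pure (w k) - pure (w k.+1))).
  apply: eq_bigr => l _; rewrite -big_split (bigD1 l) //= [X in _ + X]big1 => [|m ml]; last first.
    by rewrite anti 1?eq_sym // addNr.
  rewrite addr0 !tensor_map_pure; try exact: fl; try exact: fl'.
  have Ll : linear (fun x : V l => pure (dfwith (w l) x)) by move=> c x y; exact: pure_multilinear.
  have LE (u : forall i, V i) x : (forall i, i != l -> u i = w l i) -> u l = x ->
      pure u = pure (dfwith (w l) x) by move=> h <-; rewrite eq_dfwith.
  rewrite (LE (fun i => slotwise _ _ l (slotwise _ _ l (v i))) (dl (kp (v l)))); first last.
  - by rewrite /slotwise ltnn eqxx.
  - move=> i il; rewrite /slotwise /w (negPf il); case: ifP => // _; by rewrite sgK.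
  rewrite (LE (fun i => slotwise _ _ l (slotwise _ _ l (v i))) (kp (dl (v l)))); first last.
  - by rewrite /slotwise ltnn eqxx.
  - move=> i il; rewrite /slotwise /w (negPf il); case: ifP => // _; by rewrite sg_p sgK.
  rewrite (LE (w l) (v l)) //; last by rewrite /w ltnn.
  rewrite (LE (w l.+1) (p (v l))) //; last by rewrite /w ltnSn.
    by rewrite -(linD Ll) dk (linB Ll).
  by move=> i il; rewrite /w ltnS leq_eqVlt val_eqE (negPf il).
rewrite -(big_mkord xpredT (fun k => pure (w k) - pure (w k.+1))).
under eq_bigr => k _ do rewrite -opprB.
rewrite sumrN telescope_sumr // opprB tensor_map_pure //; congr (pure _ - pure _).
by apply: functional_extensionality_dep => i; rewrite /w ltn_ord.
Qed.
End Homotopy.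

Section SquareHomotopy.
Variables (K : fieldType) (V : lmodType K) (sg dl kp : V -> V).
Hypotheses (sgl : linear sg) (dll : linear dl) (kpl : linear kp).
Hypothesis sgd : forall x, sg (dl x) = - dl (sg x).
Hypothesis dd : forall x, dl (dl x) = 0.
Hypothesis sgk : forall x, sg (kp x) = - kp (sg x).

Definition defect x := x - (dl (kp x) + kp (dl x)).
(* The defect of this homotopy is the square of that of kp; where the complex   *)
(* is exact, defect maps into boundaries, which a second application kills.     *)
Definition kp2 x := kp (x + defect x).

Lemma defect_linear : linear defect.
Proof.
move=> c x y; have hl : linear (fun z => dl (kp z) + kp (dl z)).
  by move=> a u v; rewrite !(dll, kpl) scalerDr addrACA.
by rewrite /defect hl opprD scalerBr addrACA.
Qed.

Lemma kp2_linear : linear kp2.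
Proof. by move=> c x y; rewrite /kp2 defect_linear addrACA -scalerDr kpl. Qed.

Lemma defect_dl x : defect (dl x) = dl (defect x).
Proof. by rewrite /defect (linB dll) (linD dll) !dd (lin0 kpl) addr0 add0r. Qed.

Lemma sg_defect x : sg (defect x) = defect (sg x).
Proof.
by rewrite /defect (linB sgl) (linD sgl) sgd !sgk sgd (linN dll) (linN kpl) !opprK.
Qed.

Lemma sgk2 x : sg (kp2 x) = - kp2 (sg x).
Proof. by rewrite /kp2 sgk (linD sgl) sg_defect. Qed.

Lemma dk2 x : dl (kp2 x) + kp2 (dl x) = x - defect (defect x).
Proof.
rewrite /kp2 defect_dl -(linD dll).
have e y : dl (kp y) + kp (dl y) = y - defect y by rewrite /defect subKr.
by rewrite e (linD defect_linear) opprD addrACA addrA subrK.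
Qed.
End SquareHomotopy.

Lemma partial_inverse (K : fieldType) (V W : lmodType K) (f : V -> W) : linear f ->
  exists2 k : W -> V, linear k & forall x, f (k (f x)) = f x.
Proof.
move=> fl; pose hI := lin_image_closed fl.
have eI x : f x \in (fun y => `[< exists x, y = f x >]) by apply/asboolP; exists x.
pose e x : subm hI := Subm hI (eI x).
have el : linear e by move=> c x y; apply: val_inj; rewrite subm_val_linear /= fl.
have es v : exists u, e u = v.
  by have /asboolP[u vu] := submP v; exists u; apply: val_inj.
have [s sl sK] := lin_section el es.
have [k kl kE] := lin_extend (@subm_val_linear _ _ _ hI) val_inj sl.
by exists k => // x; rewrite -[f x]/(val (e x)) kE -[LHS]/(val (e (s (e x)))) sK.
Qed.

(** * A complex as one module, and its contraction *)

Section Total.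
Variables (K : fieldType) (A : galg K) (N : gmod A) (D : nat -> gmod A).
Variables (io : ghom N (D 0%N)) (d : forall j, ghom (D j) (D j.+1)).
Hypothesis dio : forall j n x, d j n (aug_map io d j n x) = 0.
Local Notation G := (gprod D).

(** All positions are gathered in one product, so that differential and parity sign become
    endomorphisms to be tensored; [weight] remembers the position. *)
Definition total_sign : ghom G G :=
  gtuple (fun j => if odd j then gopp (gproj D j) else gproj D j).
Definition total_diff : ghom G G :=
  gtuple (fun j => if j is j'.+1 then gcompo (d j') (gproj D j') else gzero G (D 0%N)).
Definition total_aug : ghom N G :=
  gtuple (fun j => match j return ghom N (D j) with 0 => io | j'.+1 => gzero N (D j'.+1) end).

Lemma total_signE n (x : G n) j : total_sign n x j = if odd j then - x j else x j.
Proof. by rewrite /total_sign /=; case: ifP. Qed.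

Lemma total_diff0 n (x : G n) : total_diff n x 0%N = 0. Proof. by []. Qed.
Lemma total_diffS n (x : G n) j : total_diff n x j.+1 = d j n (x j). Proof. by []. Qed.
Lemma total_augS n (x : N n) j : total_aug n x j.+1 = 0. Proof. by []. Qed.

Lemma total_signK n (x : G n) : total_sign n (total_sign n x) = x.
Proof.
apply: functional_extensionality_dep => j; rewrite !total_signE.
by case: (odd j); rewrite ?opprK.
Qed.

Lemma total_sign_diff n (x : G n) : total_sign n (total_diff n x) = - total_diff n (total_sign n x).
Proof.
apply: functional_extensionality_dep => -[|j]; rewrite dprodE.
  by rewrite total_signE !total_diff0 oppr0.
by rewrite total_signE !total_diffS total_signE /=; case: (odd j); rewrite //= linearN opprK.
Qed.

Lemma total_diffK n (x : G n) : total_diff n (total_diff n x) = 0.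
Proof.
apply: functional_extensionality_dep => -[|[|j]]; rewrite dprodE //.
  by rewrite total_diffS total_diff0 linear0.
exact: (@dio j.+1 n (x j)).
Qed.

Lemma total_diff_aug n (x : N n) : total_diff n (total_aug n x) = 0.
Proof.
apply: functional_extensionality_dep => -[|[|j]]; rewrite dprodE //.
  exact: (@dio 0%N n x).
by rewrite total_diffS total_augS linear0.
Qed.

Definition weight w n (x : G n) : Prop := forall j, j != w -> x j = 0.

Lemma weight_act w i n m (e : n + i%:Z = m) (a : A i) (x : G n) :
  weight w x -> weight w (gact e a x).
Proof. by move=> hx j jw; rewrite /= hx // gact0. Qed.

Lemma weight_total_sign w n (x : G n) : weight w x -> weight w (total_sign n x).
Proof. by move=> hx j jw; rewrite total_signE hx // oppr0 if_same. Qed.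

Lemma weight_total_diff w n (x : G n) : weight w x -> weight w.+1 (total_diff n x).
Proof. by move=> hx [|j] jw //; rewrite total_diffS hx ?linear0. Qed.

Lemma weight_total_aug n (x : N n) : weight 0 (total_aug n x).
Proof. by case. Qed.

Definition single w n (x : D w n) : G n := dfwith (0 : G n) x.

Lemma single_in w n (x : D w n) : single x w = x.
Proof. exact: dfwith_in. Qed.

Lemma weight_single w n (x : D w n) : weight w (single x).
Proof. by move=> j jw; rewrite /single dfwith_out // eq_sym. Qed.

Lemma weight_eq w n (x y : G n) : weight w x -> weight w y -> x w = y w -> x = y.
Proof.
move=> hx hy e; apply: functional_extensionality_dep => j.
by have [->|jw] := eqVneq j w; rewrite // hx // hy.
Qed.

(** Choose [k] with [d k d = d]. Its defect [p0 = 1 - (d k + k d)] takes values in cocycles and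
    kills boundaries. So its square vanishes at positive positions where the complex is exact, and
    at position 0, when exact there, it takes values in the image of the augmentation. *)
Lemma contraction n : exists kp p : G n -> G n, [/\ linear kp, linear p,
    forall x, total_sign n (kp x) = - kp (total_sign n x),
    forall x, total_diff n (kp x) + kp (total_diff n x) = x - p x &
    [/\ forall w x, weight w x -> weight w (p x),
      forall w x, weight w.+1 x -> weight w (kp x), forall x, weight 0 x -> kp x = 0,
      forall w x, (0 < w)%N -> weight w x -> exact_at (aug_map io d w) (d w) n -> p x = 0 &
      forall x, weight 0 x -> exact_at (aug_map io d 0) (d 0) n -> exists y, p x = total_aug n y]].
Proof.
pose k j : D j.+1 n -> D j n := s2val (cid2 (partial_inverse (@ghom_linear _ _ _ _ (d j) n))).
have kl j : linear (k j) by exact: s2valP.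
have dkd j x : d j n (k j (d j n x)) = d j n x.
  exact: (s2valP' (cid2 (partial_inverse (@ghom_linear _ _ _ _ (d j) n)))).
pose kp (x : G n) : G n := fun j => k j (x j.+1).
have kpl : linear kp.
  by move=> c x y; apply: functional_extensionality_dep => j; rewrite !dprodE /kp !dprodE kl.
have sgk x : total_sign n (kp x) = - kp (total_sign n x).
  apply: functional_extensionality_dep => j; rewrite dprodE total_signE /kp total_signE /=.
  by case: (odd j); rewrite //= (linN (kl j)) opprK.
have sgl := @ghom_linear _ _ _ _ total_sign n; have dll := @ghom_linear _ _ _ _ total_diff n.
have w1 w x : weight w.+1 x -> weight w (kp x).
  by move=> hx j jw; rewrite /kp hx // (lin0 (kl j)).
have w0 x : weight 0 x -> kp x = 0.
  by move=> hx; apply: functional_extensionality_dep => j; rewrite /kp hx // (lin0 (kl j)).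
pose p0 := defect (total_diff n) kp.
have wd w x : weight w x -> weight w (p0 x).
  move=> hx j jw; rewrite /p0 /defect !dprodE hx // add0r; apply/eqP; rewrite oppr_eq0; apply/eqP.
  case: w hx jw => [|w] hx jw.
    rewrite w0 // linear0 dprodE add0r; apply: (w1 0%N) => //; exact: weight_total_diff.
  rewrite (weight_total_diff (w1 _ _ hx)) // add0r; apply: (w1 w.+1) => //; exact: weight_total_diff.
have p00 x : p0 x 0%N = x 0%N - (0 + k 0%N (d 0%N n (x 0%N))) by [].
have p0S x j : p0 x j.+1 = x j.+1 - (d j n (k j (x j.+1)) + k j.+1 (d j.+1 n (x j.+1))) by [].
have dd j m z : d j.+1 m (d j m z) = 0 := @dio j.+1 m z.
have dp0 w x : d w n (p0 x w) = 0.
  case: w => [|w]; first by rewrite p00 add0r linearB dkd subrr.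
  by rewrite p0S linearB linearD dkd dd add0r subrr.
exists (kp2 (total_diff n) kp), (fun x => p0 (p0 x)); split.
- exact: kp2_linear.
- by move=> c x y; rewrite /p0 !defect_linear.
- by move=> x; apply: (sgk2 sgl dll kpl); [exact: total_sign_diff | exact: sgk].
- by move=> x; apply: (dk2 dll kpl); exact: total_diffK.
split.
- by move=> w x hx; exact: (wd _ _ (wd _ _ hx)).
- by move=> w x hx; apply: w1 => j jw; rewrite dprodE hx // add0r; apply: (wd _ _ hx).
- by move=> x hx; apply: w0 => j jw; rewrite dprodE hx // add0r; apply: (wd _ _ hx).
- move=> [//|w] x _ hx ex; apply: (weight_eq (w := w.+1)) => //; first exact: (wd _ _ (wd _ _ hx)).
  by have [y yE] := ex _ (dp0 w.+1 x); rewrite p0S dp0 (lin0 (kl w.+1)) yE /= dkd addr0 subrr.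
move=> x hx ex; have [y yE] := ex _ (dp0 0%N x); exists y.
apply: (weight_eq (w := 0%N)); [exact: (wd _ _ (wd _ _ hx)) | exact: weight_total_aug |].
by rewrite p00 dp0 (lin0 (kl 0%N)) add0r subr0 yE.
Qed.
End Total.

(** * Segre products *)

Lemma tensor_map_act (K : fieldType) s (A : 'I_s -> galg K) (M N : forall l, gmod (A l))
    i n m (e : n + i%:Z = m) (f : forall l, M l n -> N l n) (f' : forall l, M l m -> N l m) :
  (forall l, linear (f l)) -> (forall l, linear (f' l)) ->
  (forall l a x, f' l (gact e a x) = gact e a (f l x)) ->
  forall (a : segreAlg A i) (x : segre M n), tensor_map f' (gact e a x) = gact e a (tensor_map f x : segre N n).
Proof.
move=> fl fl' fe a x.
have L := gact_linearl (g := segre M) e; have R := gact_linearr (g := segre M) e.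
have L' := gact_linearl (g := segre N) e; have R' := gact_linearr (g := segre N) e.
move: a; apply: tensor_ext => [c u v|c u v|a]; rewrite ?L ?L' ?(tensor_map_linear fl') //.
move: x; apply: tensor_ext => [c u v|c u v|x].
- by rewrite R (tensor_map_linear fl').
- by rewrite (tensor_map_linear fl) R'.
rewrite /= segre_act_pure !tensor_map_pure // segre_act_pure; congr pure.
by apply: functional_extensionality_dep => l; exact: fe.
Qed.

Lemma gsub_restrict (K : fieldType) (A : galg K) (M N : gmod A) (f : ghom M N) P Q
    (hP : gsubmodule (M := M) P) (hQ : gsubmodule (M := N) Q) :
  (forall n x, x \in P n -> f n x \in Q n) ->
  exists g : ghom (gsub hP) (gsub hQ), forall n x, gincl hQ n (g n x) = f n (gincl hP n x).
Proof.
move=> h; have [|n x|g gE] := glift (i := gincl hQ) (g := gcompo f (gincl hP)).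
- exact: gincl_inj.
- by have [y yE] := gincl_surj hQ (h _ _ (gincl_in x)); exists y.
by exists g => n x; rewrite gE.
Qed.

Lemma lin_sub_sum (K : fieldType) (V : lmodType K) (C : finType) (f : C -> V -> V) :
  (forall c, linear (f c)) -> linear (fun z => z - \sum_c f c z).
Proof.
move=> fl a y z; under eq_bigr => c _ do rewrite fl.
by rewrite big_split -scaler_sumr /= opprD scalerBr addrACA.
Qed.

Section SegreComplex.
Variables (K : fieldType) (s : nat) (A : 'I_s -> galg K) (N : forall l, gmod (A l)).
Variables (D : forall l, nat -> gmod (A l)) (io : forall l, ghom (N l) (D l 0%N)).
Variable d : forall l j, ghom (D l j) (D l j.+1).
Hypothesis mio : forall l, gmono (io l).
Hypothesis dio : forall l j n x, d l j n (aug_map (io l) (d l) j n x) = 0.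
Hypothesis pD : forall l j, has_partition (D l j).
Implicit Types (l : 'I_s) (n : int).

Let G l := gprod (D l).
Let SG := segre G.
Let sg n l : G l n -> G l n := total_sign (D l) n.
Let dl n l : G l n -> G l n := total_diff (d l) n.
Let sgl n l : linear (@sg n l). Proof. exact: ghom_linear. Qed.
Let dll n l : linear (@dl n l). Proof. exact: ghom_linear. Qed.
Let sgd n l x : sg (dl x) = - dl (sg x) :> G l n. Proof. exact: total_sign_diff. Qed.
Let sgK n l x : sg (sg x) = x :> G l n. Proof. exact: total_signK. Qed.
Let dlK n l x : dl (dl x) = 0 :> G l n. Proof. exact: (total_diffK (@dio l)). Qed.

Let delta_act i n m (e : n + i%:Z = m) (a : segreAlg A i) (x : SG n) :
  tensor_diff (@sg m) (@dl m) (gact e a x) = gact e a (tensor_diff (@sg n) (@dl n) x : SG n).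
Proof.
rewrite /tensor_diff (linS (gact_linearr (g := SG) e a)); apply: eq_bigr => l _.
apply: tensor_map_act => [k|k|k b y]; try exact: slotwise_linear.
rewrite /slotwise; case: ifP => _; first exact: (ghom_act (total_sign (D k))).
by case: ifP => _ //; exact: (ghom_act (total_diff (d k))).
Qed.

Definition delta : ghom SG SG :=
  @mkhom _ _ SG SG (fun n => tensor_diff (@sg n) (@dl n)) (fun n => tensor_diff_linear (@sgl n) (@dll n)) delta_act.

(** Generators of position [j] of the total tensor product, restricted to the diagonal: all factors
    have the same internal degree [n]. *)
Definition wgen j n (t : SG n) : Prop := exists (v : forall l, G l n) (w : 'I_s -> nat),
  [/\ t = pure v, forall l, weight (w l) (v l) & (\sum_l w l)%N = j].

Definition wspan j n : {pred SG n} := Defs.span (@wgen j n).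

Lemma wspan_sub j : gsubmodule (@wspan j).
Proof.
split=> [n|i n m e a x]; first exact: span_closed.
apply: span_lin; [exact: (gact_linearr (g := SG) e a) | exact: span_closed |].
move=> _ [v [w [-> wv wj]]].
have [S0 SP] : submod_closed (@wspan j m) by exact: span_closed.
move: a; apply: (tensor_ind (P := fun a => gact (g := SG) e a (pure v) \in @wspan j m)).
- by move=> c t u ht hu; rewrite (gact_linearl (g := SG) e); exact: SP.
- move=> a; apply: Defs.mem_span; exists (fun l => gact e (a l) (v l)), w.
  by split=> // [|l]; [exact: segre_act_pure | apply: weight_act; exact: wv].
- by constructor=> l; exact: 0.
Qed.

Definition segre_cx j : gmod (segreAlg A) := gsub (wspan_sub j).
Let inc j : ghom (segre_cx j) SG := gincl (wspan_sub j).

Lemma wspan_delta j n x : x \in @wspan j n -> delta n x \in @wspan j.+1 n.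
Proof.
have [S0 SP] : submod_closed (@wspan j.+1 n) by exact: span_closed.
apply: span_lin; [exact: ghom_linear | by [] |] => _ [v [w [-> wv wj]]].
rewrite /= /tensor_diff; elim/big_ind: _ => // [u z hu hz|l _].
  by have := SP 1 _ _ hu hz; rewrite scale1r.
rewrite tensor_map_pure => [|i]; last exact: (@slotwise_linear K s (fun l => G l n) _ _ _ _ (@sgl n) (@dll n)).
apply: Defs.mem_span; exists (fun i => slotwise (@sg n) (@dl n) l (v i)).
exists (fun i => w i + (i == l))%N; split=> // [i|].
  rewrite /slotwise; case: ifP => [il|_].
    by rewrite -val_eqE ltn_eqF // addn0; apply: weight_total_sign; exact: wv.
  by case: eqP => _; rewrite ?addn1 ?addn0; [apply: weight_total_diff|]; exact: wv.
by rewrite big_split /= wj (bigD1 l) //= eqxx big1 ?addn0 ?addn1 // => i /negPf ->.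
Qed.

Definition segre_d j : ghom (segre_cx j) (segre_cx j.+1) :=
  sval (cid (gsub_restrict (wspan_sub j) (wspan_sub j.+1) (@wspan_delta j))).

Lemma segre_dE j n x : inc j.+1 n (segre_d j n x) = delta n (inc j n x).
Proof. exact: (svalP (cid (gsub_restrict (wspan_sub j) (wspan_sub j.+1) (@wspan_delta j)))). Qed.

Lemma delta_delta n x : delta n (delta n x) = 0.
Proof. exact: (tensor_diffK (@sgl n) (@dll n) (@sgd n) (@dlK n)). Qed.

Let ti n l : N l n -> G l n := total_aug (io l) n.
Let til n l : linear (@ti n l). Proof. exact: ghom_linear. Qed.

Let inj_act i n m (e : n + i%:Z = m) (a : segreAlg A i) (x : segre N n) :
  tensor_map (@ti m) (gact e a x) = gact e a (tensor_map (@ti n) x : SG n).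
Proof. by apply: tensor_map_act => // l b y; exact: (ghom_act (total_aug (io l))). Qed.

Let tin : ghom (segre N) SG :=
  @mkhom _ _ (segre N) SG (fun n => tensor_map (@ti n)) (fun n => tensor_map_linear (@til n)) inj_act.

Lemma wspan_tin n x : tin n x \in @wspan 0 n.
Proof.
have [S0 SP] : submod_closed (@wspan 0 n) by exact: span_closed.
move: x; apply: tensor_ind => [c t u ht hu|v|].
- by rewrite linearP; exact: SP.
- rewrite /= tensor_map_pure //; apply: Defs.mem_span; exists (fun l => ti (v l)), (fun=> 0%N).
  by split=> // [l|]; [exact: weight_total_aug | rewrite big1].
- by constructor=> l; exact: 0.
Qed.

Lemma segre_aug_ex : exists g : ghom (segre N) (segre_cx 0), forall n x, inc 0 n (g n x) = tin n x.
Proof.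
apply: glift => [|n x]; first exact: gincl_inj.
by have [y yE] := gincl_surj (wspan_sub 0) (wspan_tin x); exists y.
Qed.

Definition segre_aug : ghom (segre N) (segre_cx 0) := sval (cid segre_aug_ex).
Lemma segre_augE n x : inc 0 n (segre_aug n x) = tin n x.
Proof. exact: (svalP (cid segre_aug_ex)). Qed.

Lemma segre_aug_mono : gmono segre_aug.
Proof.
move=> n x y /(congr1 (inc 0 n)); rewrite !segre_augE.
have r l : exists r : G l n -> N l n, linear r /\ forall x, r (ti x) = x.
  have [r rl rK] := lin_retract (@ghom_linear _ _ _ _ (io l) n) (@mio l n).
  exists (fun z => r (z 0%N)); split=> [c u v|z]; last exact: rK.
  by rewrite !dprodE rl.
pose q l := sval (cid (r l)).
have ql l : linear (@q l) by case: (svalP (cid (r l))).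
have qK l z : q l (ti z) = z by case: (svalP (cid (r l))) => _; apply.
apply: (can_inj (g := tensor_map q)).
apply: (tensor_ext (f := fun x => tensor_map q (tensor_map (@ti n) x)) (g := id)) => // [|v].
  exact: (comp_linear (tensor_map_linear ql) (tensor_map_linear (@til n))).
rewrite !tensor_map_pure //; congr pure.
by apply: functional_extensionality_dep => l; exact: qK.
Qed.

Lemma segre_dK j n x : segre_d j n (aug_map segre_aug segre_d j n x) = 0.
Proof.
apply: (@gincl_inj _ _ _ _ (wspan_sub j.+1)); rewrite segre_dE linear0.
case: j x => [|j] x; last by rewrite segre_dE delta_delta.
rewrite segre_augE; move: x.
apply: (tensor_ext (f := fun x => tensor_diff (@sg n) (@dl n) (tensor_map (@ti n) x)) (g := fun=> 0)).
- exact: (comp_linear (tensor_diff_linear (@sgl n) (@dll n)) (tensor_map_linear (@til n))).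
- by move=> c u v; rewrite scaler0 addr0.
move=> v; rewrite tensor_map_pure // /tensor_diff big1 // => l _.
rewrite tensor_map_pure => [|i]; last exact: (@slotwise_linear K s (fun l => G l n) _ _ _ _ (@sgl n) (@dll n)).
apply: (pure_slot0 (l := l)); rewrite /slotwise ltnn eqxx; exact: (total_diff_aug (@dio l)).
Qed.

(** Apply in each slot the partition of the term at its position and expand the product of sums: the
    coefficients are pure tensors of linear forms, which are linear forms of the Segre ring. *)
Lemma partition_segre_cx j : has_partition (segre_cx j).
Proof.
pose t l k := sval (cid (pD l k)).
pose f l k := sval (cid (svalP (cid (pD l k)))).
pose g l k := sval (cid (svalP (cid (svalP (cid (pD l k)))))).
have gE l k n (x : D l k n) : x = \sum_(c < t l k) gmulhom (f l k c) (g l k c) x.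
  exact: (svalP (cid (svalP (cid (svalP (cid (pD l k))))))).
(* Positions occurring in total position [j] are at most [j], so [T] bounds all the partitions used;
   shorter ones are padded with zero forms. The successor makes the index set nonempty for
   [pure_expand]. *)
pose T := (\sum_l \sum_(k < j.+1) t l k).+1.
have tT l k : (k <= j)%N -> (t l k <= T)%N.
  move=> kj; apply: leqW; rewrite (bigD1 l) //= (bigD1 (Ordinal (kj : (k < j.+1)%N))) //=.
  by rewrite -addnA leq_addr.
pose C := ('I_j.+1 * 'I_T)%type.
pose F l (c : C) : A l 1%N := if (c.2 < t l c.1)%N then f l c.1 c.2 else 0.
pose H l (c : C) n (x : G l n) : G l (n - 1) :=
  fun k => if k == c.1 then g l k c.2 n (x k) else 0.
have Hl l c n : linear (@H l c n).
  move=> a x y; apply: functional_extensionality_dep => k; rewrite !dprodE /H.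
  by case: eqP => _; rewrite ?dprodE ?linearP // scaler0 addr0.
have Ha l c i n m (e : n + i%:Z = m) (a : A l i) (x : G l n) :
    H l c m (gact e a x) = gact (shift_deg (- 1) e) a (H l c n x).
  apply: functional_extensionality_dep => k; rewrite /H /=.
  by case: eqP => _; [exact: (ghom_act (g l k c.2)) | rewrite gact0].
have Hw l c w n (x : G l n) : weight w x -> weight w (H l c n x).
  by move=> hx k kw; rewrite /H hx // linear0 if_same.
have HF l w n (x : G l n) : weight w x -> (w <= j)%N ->
    x = \sum_c gact (subrK 1 n) (F l c) (H l c n x).
  move=> hx wj; apply: functional_extensionality_dep => k.
  have -> : (\sum_c gact (subrK 1 n) (F l c) (H l c n x)) k =
      \sum_c gact (subrK 1 n) (F l c) (H l c n x k).
    by apply: (big_morph (fun y : G l n => y k)).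
  have [->|kw] := eqVneq k w; last first.
    by rewrite hx // big1 // => c _; rewrite (Hw l c w n x hx k kw) gact0.
  rewrite -(pair_bigA _ (fun (c1 : 'I_j.+1) (c2 : 'I_T) =>
    gact (subrK 1 n) (F l (c1, c2)) (H l (c1, c2) n x w))) /=.
  rewrite (bigD1 (Ordinal (wj : (w < j.+1)%N))) //= [X in _ + X]big1 => [|c1 c1w]; last first.
    rewrite big1 // => c2 _; rewrite /H /= ifN ?gact0 //.
    by apply: contraNneq c1w => e; apply/eqP/val_inj.
  rewrite addr0 [LHS]gE (big_ord_widen _ (fun c => gmulhom (f l w c) (g l w c) (x w)) (tT l w wj)).
  rewrite big_mkcond; apply: eq_bigr => c2 _; rewrite /F /H /= eqxx.
  by case: ifP => // _; rewrite gact0l.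
pose th phi n : SG n -> shift SG (- 1) n := tensor_map (fun l => @H l (phi l) n).
have thl phi n : linear (th phi n) by exact: tensor_map_linear.
have tha phi i n m (e : n + i%:Z = m) (a : segreAlg A i) (x : SG n) :
    th phi m (gact e a x) = gact e a (th phi n x).
  apply: (tensor_map_act (N := fun l => shift (G l) (- 1))) => // l b y.
  by rewrite Ha.
have hex phi : exists h : ghom (segre_cx j) (shift (segre_cx j) (- 1)),
    forall n x, inc j (n - 1) (h n x) = th phi n (inc j n x).
  have [|n x|h hE] := glift (i := gshift (inc j) (- 1))
      (g := gcompo (mkhom (thl phi) (tha phi)) (inc j)).
  - exact: (fun n => @gincl_inj _ _ _ _ (wspan_sub j) (n - 1)).
  - have [|y yE] := @gincl_surj _ _ _ _ (wspan_sub j) (n - 1) (th phi n (inc j n x)); last by exists y.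
    apply: (span_lin (thl phi n)) (gincl_in x); first exact: span_closed.
    move=> _ [v [w [-> wv wj]]]; rewrite /th tensor_map_pure //; apply: Defs.mem_span.
    by exists (fun l => H l (phi l) n (v l)), w; split=> // l; apply: Hw.
  by exists h => n x; exact: (hE n x).
pose h phi := sval (cid (hex phi)).
have hE phi n x : inc j (n - 1) (h phi n x) = th phi n (inc j n x) := svalP (cid (hex phi)) n x.
have [C' [phi phiE]] := @pure_expand K 'I_s C (ord0, ord0) _ (enum_uniq 'I_s).
apply: (partition_fin (f := fun c' : C' => pure (fun l => F l (phi c' l)) : segreAlg A 1)
  (g := fun c' => h (phi c'))) => n x.
apply: (@gincl_inj _ _ _ _ (wspan_sub j)); rewrite linear_sum.
transitivity (\sum_c' gact (g := SG) (subrK 1 n) (pure (fun l => F l (phi c' l)) : segreAlg A 1)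
    (th (phi c') n (inc j n x))); last first.
  by apply: eq_bigr => c' _; rewrite -hE -ghom_act.
apply/eqP; rewrite -subr_eq0; apply/eqP; move: (gincl_in x).
apply: (@span_eq0 _ _ _ (fun z => z - \sum_c' gact (g := SG) (subrK 1 n)
  (pure (fun l => F l (phi c' l)) : segreAlg A 1) (th (phi c') n z))).
  apply: lin_sub_sum => c'.
  exact: (comp_linear (gact_linearr (g := SG) (subrK 1 n) _) (thl (phi c') n)).
move=> _ [v [w [-> wv wj]]]; apply/eqP; rewrite subr_eq0; apply/eqP.
transitivity (pure (fun l => if l \in enum 'I_s then
    \sum_c gact (subrK 1 n) (F l c) (H l c n (v l)) else v l)).
  congr pure; apply: functional_extensionality_dep => l; rewrite mem_enum /=.
  by apply: HF (wv l) _; rewrite -wj (bigD1 l) //= leq_addr.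
rewrite (phiE _ (fun l c => gact (subrK 1 n) (F l c) (H l c n (v l)))).
apply: eq_bigr => c' _; rewrite /th tensor_map_pure // [RHS]segre_act_pure; congr pure.
by apply: functional_extensionality_dep => l; rewrite mem_enum.
Qed.

Lemma segre_d_ker j n x : segre_d j n x = 0 -> delta n (inc j n x) = 0.
Proof. by move=> h; rewrite -segre_dE h linear0. Qed.

(** For a cocycle [y] the homotopy gives [y = d (h y) + p y], with [p] the tensor product of the
    projections of [contraction]. For [j > 0] an exact slot at positive position kills [p y]; for
    [j = 0] the part [h y] is zero and [p y] comes from the augmentation. *)
Lemma exact_segre_cx j n : (forall w : 'I_s -> nat, (\sum_l w l)%N = j ->
    (exists l, (0 < w l)%N /\ exact_at (aug_map (io l) (d l) (w l)) (d l (w l)) n) \/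
    (j = 0%N /\ forall l, exact_at (aug_map (io l) (d l) 0) (d l 0%N) n)) ->
  exact_at (aug_map segre_aug segre_d j) (segre_d j) n.
Proof.
move=> hw x /segre_d_ker; set y := inc j n x => dy.
have ct l := contraction (@dio l) n.
pose kp l := sval (cid (ct l)); pose p l := sval (cid (svalP (cid (ct l)))).
have cP l : [/\ linear (kp l), linear (p l),
    forall x, sg (kp l x) = - kp l (sg x),
    forall x, dl (kp l x) + kp l (dl x) = x - p l x &
    [/\ forall w x, weight w x -> weight w (p l x),
      forall w x, weight w.+1 x -> weight w (kp l x), forall x, weight 0 x -> kp l x = 0,
      forall w x, (0 < w)%N -> weight w x -> exact_at (aug_map (io l) (d l) w) (d l w) n -> p l x = 0 &
      forall x, weight 0 x -> exact_at (aug_map (io l) (d l) 0) (d l 0%N) n -> exists y, p l x = ti y]].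
  exact: (svalP (cid (svalP (cid (ct l))))).
have kpl l : linear (kp l) by case: (cP l).
have pl l : linear (p l) by case: (cP l).
have sgk l z : sg (kp l z) = - kp l (sg z) by case: (cP l).
have dk l z : dl (kp l z) + kp l (dl z) = z - p l z by case: (cP l).
have yin : y \in @wspan j n by exact: gincl_in.
have thl := tensor_homotopy_linear (@sgl n) kpl pl.
have yE : y = tensor_diff (@sg n) (@dl n) (tensor_homotopy (@sg n) kp p y) + tensor_map p y.
  have := tensor_homotopyP (@sgl n) (@dll n) kpl pl (@sgK n) (@sgd n) (@dlK n) sgk dk y.
  by rewrite [tensor_diff _ _ y]dy (lin0 thl) addr0 => ->; rewrite subrK.
(* Each summand of the homotopy lowers the total position by one, and vanishes when its slot is at
   position 0. *)
have term l (v : forall l, G l n) (w : 'I_s -> nat) : (forall l, weight (w l) (v l)) ->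
    tensor_map (slotwise (fun i (x : G i n) => sg (p i x) : G i n) kp l) (pure v) = 0 \/
    (0 < w l)%N /\ tensor_map (slotwise (fun i (x : G i n) => sg (p i x) : G i n) kp l) (pure v)
      \in @wspan (\sum_l w l).-1 n.
  move=> wv; rewrite tensor_map_pure => [|i]; last first.
    apply: (@slotwise_linear K s (fun l => G l n)) => // k c u z.
    by rewrite pl; exact: sgl.
  case E : (w l) => [|w'].
    left; apply: (pure_slot0 (l := l)); rewrite /slotwise ltnn eqxx.
    by case: (cP l) => _ _ _ _ [_ _ k0 _ _]; have := wv l; rewrite E; exact: k0.
  right; split=> //; apply: Defs.mem_span.
  exists (fun i => slotwise (fun i (x : G i n) => sg (p i x) : G i n) kp l (v i)).
  exists (fun i => w i - (i == l))%N; split=> // [i|].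
    case: (cP i) => _ _ _ _ [pw kw _ _ _]; rewrite /slotwise; case: ifP => [il|_].
      by rewrite -val_eqE ltn_eqF // subn0; apply: weight_total_sign; apply: pw.
    case: eqP => [il|_]; rewrite ?subn0 //.
    by subst i; have := wv l; rewrite E subn1; exact: kw.
  rewrite [in LHS](bigD1 l) //= [in RHS](bigD1 l) //= eqxx E subn1 addSn /=.
  by congr (_ + _)%N; apply: eq_bigr => i /negPf ->; rewrite subn0.
case: j hw x @y dy yin yE => [|j] hw x y dy yin yE.
  have hx l : exact_at (aug_map (io l) (d l) 0) (d l 0%N) n.
    have [|[k [//]]|[_ //]] := hw (fun=> 0%N); by rewrite big1.
  have th0 : tensor_homotopy (@sg n) kp p y = 0.
    apply: span_eq0 thl _ yin => _ [v [w [-> wv wj]]]; rewrite /tensor_homotopy big1 // => l _.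
    have [//|[w0 _]] := term l v w wv.
    by move: wj w0; rewrite (bigD1 l) //=; case: (w l).
  have /asboolP[z zE] : tensor_map p y \in (fun y => `[< exists z, y = tensor_map (@ti n) z >]).
    apply: span_lin (tensor_map_linear pl) (lin_image_closed (tensor_map_linear (@til n))) _ yin.
    move=> _ [v [w [-> wv wj]]]; apply/asboolP.
    have h l : exists y, p l (v l) = ti y.
      case: (cP l) => _ _ _ _ [_ _ _ _]; apply=> //.
      by have := wv l; rewrite (_ : w l = 0%N) //; move: wj; rewrite (bigD1 l) //=; case: (w l).
    exists (pure (fun l => sval (cid (h l)))); rewrite !tensor_map_pure //; congr pure.
    by apply: functional_extensionality_dep => l; case: cid.
  exists z; apply: (@gincl_inj _ _ _ _ (wspan_sub 0)); rewrite segre_augE.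
  by rewrite -[LHS]/y yE th0 (lin0 (tensor_diff_linear (@sgl n) (@dll n))) add0r.
have p0 : tensor_map p y = 0.
  apply: span_eq0 (tensor_map_linear pl) _ yin => _ [v [w [-> wv wj]]]; rewrite tensor_map_pure //.
  have [[l [w0 ex]]|[//]] := hw w wj; apply: (pure_slot0 (l := l)).
  by case: (cP l) => _ _ _ _ [_ _ _ h _]; apply: (h (w l)).
have [S0 SP] : submod_closed (@wspan j n) by exact: span_closed.
have tin' : tensor_homotopy (@sg n) kp p y \in @wspan j n.
  apply: (span_lin thl) yin => // _ [v [w [-> wv wj]]]; rewrite /tensor_homotopy.
  elim/big_ind: _ => // [u z hu hz|l _]; first by have := SP 1 _ _ hu hz; rewrite scale1r.
  by have [->|[_]] := term l v w wv; rewrite // wj.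
have [z zE] := gincl_surj (wspan_sub j) tin'; exists z.
apply: (@gincl_inj _ _ _ _ (wspan_sub j.+1)); rewrite [RHS]segre_dE -[LHS]/y yE p0 addr0.
by rewrite -[inc j n z]/(gincl (wspan_sub j) n z) zE.
Qed.

(** Take in each slot a cocycle [v l] and a functional [f l] that kills boundaries and has value [1]
    at [v l]. The product functional kills all boundaries, and slot [l0] makes it kill the
    augmentation, yet it has value [1] on the cocycle [pure v]. *)
Lemma nonexact_segre_cx n (w : 'I_s -> nat) l0 :
    (forall l, ~ exact_at (aug_map (io l) (d l) (w l)) (d l (w l)) n \/
       w l = 0%N /\ nonzero (N l n)) ->
    ~ exact_at (aug_map (io l0) (d l0) (w l0)) (d l0 (w l0)) n ->
  ~ exact_at (aug_map segre_aug segre_d (\sum_l w l)) (segre_d (\sum_l w l)) n.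
Proof.
move=> hw hl0.
have lc_vanish l : exists (v : G l n) (f : G l n -> K^o), [/\ weight (w l) v, dl v = 0, linear f, f v = 1 &
    (forall y, f (dl y) = 0) /\
    (~ exact_at (aug_map (io l) (d l) (w l)) (d l (w l)) n -> forall y, f (ti y) = 0)].
  case: (pselect (exact_at (aug_map (io l) (d l) (w l)) (d l (w l)) n)) => ex.
    have [//|[w0 [x x0]]] := hw l.
    have hP : submod_closed (fun y : G l n => y 0%N == 0).
      by apply: (lin_ker_closed (i := fun y : G l n => y 0%N)).
    have [|f fl [f1 f0]] := functional (v := ti x) hP.
      rewrite unfold_in; apply: contra x0 => /eqP h; apply/eqP.
      exact: (gmono_eq0 (@mio l) h).
    exists (ti x), f; split=> //; first by rewrite w0; exact: weight_total_aug.
      exact: (total_diff_aug (@dio l)).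
    by split=> // y; apply: f0; rewrite unfold_in.
  have [u [du nu]] : exists u, d l (w l) n u = 0 /\ ~ exists y, u = aug_map (io l) (d l) (w l) n y.
    by apply: contrapT => h; apply: ex => u du; apply: contrapT => nu; apply: h; exists u.
  pose P (x : G l n) := `[< exists y, x (w l) = aug_map (io l) (d l) (w l) n y >].
  have hP : submod_closed P.
    split; first by apply/asboolP; exists 0; rewrite linear0.
    move=> c x y /asboolP[x' hx] /asboolP[y' hy]; apply/asboolP; exists (c *: x' + y').
    by rewrite linearP -hx -hy.
  have [|f fl [f1 f0]] := functional (v := single u) hP.
    by apply/asboolP; rewrite single_in.
  exists (single u), f; split=> //; first exact: weight_single.
    apply: (weight_eq (w := (w l).+1)) => //; first by apply: weight_total_diff; exact: weight_single.
    by rewrite /dl total_diffS single_in.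
  split=> [y|_ y]; apply: f0; apply/asboolP.
    by case: (w l) => [|k]; [exists 0; rewrite linear0 | exists (y k)].
  by case: (w l) => [|k]; [exists y | exists 0; rewrite linear0].
pose v l := sval (cid (lc_vanish l)); pose f l := sval (cid (svalP (cid (lc_vanish l)))).
have fP l : [/\ weight (w l) (v l), dl (v l) = 0, linear (f l), f l (v l) = 1 &
    (forall y, f l (dl y) = 0) /\
    (~ exact_at (aug_map (io l) (d l) (w l)) (d l (w l)) n -> forall y, f l (ti y) = 0)].
  exact: (svalP (cid (svalP (cid (lc_vanish l))))).
have fl l : linear (f l) by case: (fP l).
have f1 l : f l (v l) = 1 by case: (fP l).
have fdl l y : f l (dl y) = 0 by case: (fP l) => _ _ _ _ [].
have tf1 : tfun f (pure v) = 1 by rewrite tfun_pure // big1.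
have ten (W : 'I_s -> lmodType K) (g : tensor W -> K^o) : linear g -> (forall v, g (pure v) = 0) -> forall z, g z = 0.
  move=> gl g0; apply: (tensor_ext (g := fun=> 0)) => // c x y; by rewrite scaler0 addr0.
have tfd z : tfun f (tensor_diff (@sg n) (@dl n) z) = 0.
  move: z; apply: (ten _ (fun z => tfun f (tensor_diff (@sg n) (@dl n) z))).
    exact: (comp_linear (tfun_linear fl) (tensor_diff_linear (@sgl n) (@dll n))).
  move=> u; rewrite /tensor_diff (linS (tfun_linear fl)) big1 // => l _.
  rewrite tensor_map_pure => [|i]; last exact: (@slotwise_linear K s (fun l => G l n) _ _ _ _ (@sgl n) (@dll n)).
  by rewrite tfun_pure // (bigD1 l) //= /slotwise ltnn eqxx fdl mul0r.
have tfi z : tfun f (tensor_map (@ti n) z) = 0.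
  move: z; apply: (ten _ (fun z => tfun f (tensor_map (@ti n) z))).
    exact: (comp_linear (tfun_linear fl) (tensor_map_linear (@til n))).
  move=> u; rewrite tensor_map_pure // tfun_pure // (bigD1 l0) //=.
  by case: (fP l0) => _ _ _ _ [_ /(_ hl0) ->]; rewrite mul0r.
set j := (\sum_l w l)%N.
have vin : pure v \in @wspan j n.
  by apply: Defs.mem_span; exists v, w; split=> // l; case: (fP l).
have [x xE] := gincl_surj (wspan_sub j) vin => ex.
have dx : segre_d j n x = 0.
  apply: (@gincl_inj _ _ _ _ (wspan_sub j.+1)); rewrite segre_dE linear0 [inc _ _ _]xE.
  rewrite /= /tensor_diff big1 // => l _.
  rewrite tensor_map_pure => [|i]; last exact: (@slotwise_linear K s (fun l => G l n) _ _ _ _ (@sgl n) (@dll n)).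
  by apply: (pure_slot0 (l := l)); rewrite /slotwise ltnn eqxx; case: (fP l).
have [y yE] := ex x dx; move/eqP: (oner_neq0 K); apply.
rewrite -tf1 -xE yE; case: (j) y {yE} => [|k] y.
  by rewrite [gincl _ _ _]segre_augE; exact: tfi.
by rewrite [gincl _ _ _]segre_dE; exact: tfd.
Qed.
End SegreComplex.

Lemma killed_mod_bounded (K : fieldType) (A : galg K) (L M N : gmod A) (f : ghom L M) (g : ghom M N) c :
  (forall n, c < n -> exact_at f g n) ->
  forall k n x, g n x = 0 -> c < n + k%:Z -> killed_mod f k x.
Proof.
move=> ex; elim=> [|k IH] n x gx nk /=; first by apply: (ex n) gx; lia.
by move=> i m e a i0; apply: IH; [rewrite ghom_act gx gact0 | lia].
Qed.

Section SegreCohomology.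
Variables (K : fieldType) (s : nat) (A : 'I_s -> galg K) (N : forall l, gmod (A l)).
Variables (b : 'I_s -> nat) (e : 'I_s -> int).
Hypothesis N_cmres : forall l, cmres (N l) (b l) (e l).
Variable F : injres (segre N).

(** Künneth count in degree [n]: slot [l] contributes either its cohomology at [b l], present when
    [n <= e l], or position 0. Taking [b l] in every slot with [n <= e l] gives the largest
    total. *)
Lemma segre_complex : exists (Y : nat -> gmod (segreAlg A)) (io : ghom (segre N) (Y 0%N))
    (d : forall j, ghom (Y j) (Y j.+1)),
  [/\ gmono io, forall j n x, d j n (aug_map io d j n x) = 0, forall j, has_partition (Y j),
     forall j n, ~ exact_at (aug_map io d j) (d j) n ->
       (exists l, n <= e l) /\ (j <= \sum_(l | (n <= e l)%R) b l)%N &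
     forall n, (exists l, n <= e l) -> (forall l, e l < n -> nonzero (N l n)) ->
       ~ exact_at (aug_map io d (\sum_(l | (n <= e l)%R) b l)) (d (\sum_(l | (n <= e l)%R) b l)%N) n].
Proof.
pose D l := sval (cid (N_cmres l)).
pose io l := sval (cid (svalP (cid (N_cmres l)))).
pose d l := sval (cid (svalP (cid (svalP (cid (N_cmres l)))))).
have P l : [/\ gmono (io l), forall j n x, d l j n (aug_map (io l) (d l) j n x) = 0,
    forall j, has_partition (D l j),
    forall j n, exact_at (aug_map (io l) (d l) j) (d l j) n <-> ~ (j = b l /\ n <= e l) &
    forall n, nonzero (N l n) \/ n - (b l)%:Z <= e l].
  exact: (svalP (cid (svalP (cid (svalP (cid (N_cmres l))))))).
have mio l : gmono (io l) by case: (P l).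
have dio l j n x : d l j n (aug_map (io l) (d l) j n x) = 0 by case: (P l).
have pD l j : has_partition (D l j) by case: (P l).
have ex l j n : exact_at (aug_map (io l) (d l) j) (d l j) n <-> ~ (j = b l /\ n <= e l).
  by case: (P l).
exists (segre_cx D), (segre_aug io), (segre_d d); split.
- exact: segre_aug_mono.
- exact: segre_dK.
- exact: partition_segre_cx.
- move=> j n nex; apply: contrapT => h; apply: nex; apply: exact_segre_cx => // w wj.
  case: (pselect (exists l, (0 < w l)%N /\ ~ (w l = b l /\ n <= e l))) => [[l [w0 wl]]|nw].
    by left; exists l; split=> //; apply/ex.
  have wE l : w l = 0%N \/ w l = b l /\ n <= e l.
    have [->|w0] := posnP (w l); [by left | right; apply: contrapT => wl].
    by apply: nw; exists l.
  case: (pselect (exists l, n <= e l)) => [hl|hl].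
    case: h; split=> //; rewrite -wj [X in (_ <= X)%N]big_mkcond /=; apply: leq_sum => l _.
    by have [->|[-> ->]] := wE l.
  right; split=> [|l]; last by apply/ex => -[_ h']; apply: hl; exists l.
  by rewrite -wj big1 // => l _; have [//|[_ h']] := wE l; case: hl; exists l.
- move=> n [l0 hl0] hN; rewrite big_mkcond /=.
  apply: (@nonexact_segre_cx _ _ _ _ _ _ _ mio dio n (fun l => if n <= e l then b l else 0%N) l0).
    move=> l; case: ifP => nl; first by left; rewrite ex; apply.
    by right; split=> //; apply: hN; rewrite ltNge nl.
  by rewrite hl0 ex; apply.
Qed.

Lemma segre_local_cohomology :
  (forall j n, nonzero (local_cohomology F j n) ->
     (exists l, n <= e l) /\ (j <= (\sum_(l | (n <= e l)%R) b l).+1)%N) /\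
  (forall n, (exists l, n <= e l) -> (forall l, e l < n -> nonzero (N l n)) ->
     nonzero (local_cohomology F (\sum_(l | (n <= e l)%R) b l).+1 n)).
Proof.
have [Y [io [d [mio dd pY up low]]]] := segre_complex.
(* [c] bounds every [e l], so the complex is exact above degree [c]; this gives the boundedness and
   torsion conditions of [lc_vanish_complex]. *)
pose c : int := \sum_l `|e l|.
have ec l : e l <= c.
  apply: le_trans (ler_norm _) _; rewrite /c (bigD1 l) //= lerDl.
  by apply: sumr_ge0 => *; exact: normr_ge0.
have ex j n : c < n -> exact_at (aug_map io d j) (d j) n.
  move=> cn; apply: contrapT => /up[[l nl] _]; have := ec l.
  by rewrite leNgt (lt_le_trans cn nl).
have hvE i n : lc_vanish i (segre N) n <-> exact_at (aug_map io d i) (d i) n.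
  apply: lc_vanish_complex => //.
    move=> j m x _ dx; exists (`|(c - m)%R|.+1)%N; apply: (killed_mod_bounded (c := c)) dx _; last by clearbody c; lia.
    exact: ex.
  by move=> j _; exists c; exact: ex.
split=> [[|i] n|n hl hN].
- rewrite local_cohomology0 => -[x tx /eqP[]]; apply: (gmono_eq0 mio).
  by apply: partition_torsion_free => //; exact: tors_hom.
- by rewrite local_cohomologyS hvE => /up[].
- by rewrite local_cohomologyS hvE; exact: low.
Qed.
End SegreCohomology.

(** * Regularity *)

Section SegreRegularity.
Variables (K : fieldType) (s : nat) (A : 'I_s -> galg K) (N : forall l, gmod (A l)).
Variables (b : 'I_s -> nat) (e : 'I_s -> int).
Hypothesis s_gt0 : (0 < s)%N.
Hypothesis N_cmres : forall l, cmres (N l) (b l) (e l).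

(** Degree plus top cohomological position of the Segre product at degree [n = e l]. *)
Definition score (b : 'I_s -> nat) (e : 'I_s -> int) l : int :=
  e l + 1 + (\sum_(i | (e l <= e i)%R) b i)%N%:Z.

(** The tie is broken towards the least [e], so that any competitor of equal score in a lower degree
    contradicts the choice. *)
Lemma score_best : exists l0, (forall l, score b e l <= score b e l0) /\
  forall l, score b e l = score b e l0 -> e l0 <= e l.
Proof.
have [l1 _ l1P] := @arg_maxP _ _ _ (Ordinal s_gt0) xpredT (score b e) isT.
have [l0 /eqP l0E l0P] := @arg_minP _ _ _ l1 (fun l => score b e l == score b e l1) e (eqxx _).
exists l0; split=> l; first by rewrite l0E; exact: l1P.
by rewrite l0E => /eqP; exact: l0P.
Qed.

Lemma leq_sum_sub (P Q : pred 'I_s) : (forall i, P i -> Q i) ->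
  (\sum_(i | P i) b i <= \sum_(i | Q i) b i)%N.
Proof.
move=> PQ; rewrite big_mkcond [X in (_ <= X)%N]big_mkcond; apply: leq_sum => i _.
by case: ifP => // /PQ ->.
Qed.

(* A module that vanishes in degree n := e l0, and whose index is not counted *)
(* in the score of l0, would have a score at least as good in a lower degree. *)
Lemma segre_reg (F : injres (segre N)) l0 : (forall l, score b e l <= score b e l0) ->
  (forall l, score b e l = score b e l0 -> e l0 <= e l) -> is_reg F (score b e l0).
Proof.
move=> best small; have [up low] := segre_local_cohomology N_cmres F.
split=> [|_ [j [n [/up[[l1 nl1] jle] ->]]]].
  exists (\sum_(i | (e l0 <= e i)%R) b i).+1, (e l0); split; last by rewrite /score; lia.
  apply: low => [|l ll0]; first by exists l0.
  have [//|h] : nonzero (N l (e l0)) \/ e l0 - (b l)%:Z <= e l.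
    by have [D [io [d [_ _ _ _ h]]]] := N_cmres l; exact: h.
  have sc : score b e l0 <= score b e l.
    have hs : (b l + \sum_(i | (e l0 <= e i)%R) b i <= \sum_(i | (e l <= e i)%R) b i)%N.
      rewrite [X in (_ <= X)%N](bigD1 l) //= leq_add2l; apply: leq_sum_sub => i il0.
      rewrite (le_trans (ltW ll0) il0) /=.
      by apply: contraTneq il0 => ->; rewrite -ltNge.
    by rewrite /score; lia.
  have := small l (le_anti _); rewrite (best l) sc => /(_ isT).
  by rewrite leNgt ll0.
(* Upper bound: raising [n] to the least [e l2] above it loses none of the indices counted in degree
   [n]. *)
have [l2 nl2 l2P] := @arg_minP _ _ _ l1 (fun l => n <= e l) e nl1.
apply: le_trans (best l2); rewrite /score.
have hs : (\sum_(i | (n <= e i)%R) b i <= \sum_(i | (e l2 <= e i)%R) b i)%N.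
  exact: leq_sum_sub.
by lia.
Qed.
End SegreRegularity.

(** * The maximum over C_2 *)

Section Values.
Variables (K : fieldType) (s : nat) (r : 'I_s -> nat) (M : forall i, gmod (polyAlg K (r i))).
Variables (E : forall i, injres (M i)) (d : 'I_s -> nat) (rho : 'I_s -> int).
Hypothesis d_ge1 : forall i, (1 <= d i)%N.
Hypothesis lcE : forall i j n,
  nonzero (local_cohomology (E i) j n) <-> j = d i /\ n <= rho i - (d i)%:Z.

(** Each [M i] has local cohomology only in position [d i], and there in all sufficiently negative
    degrees, so finitely many factors have a common nonzero degree. *)
Lemma C2E (u : forall i, 'I_(d i).+1) :
  C2 E u <-> (exists i, i \in supp u) /\ forall i, i \in supp u -> u i = d i :> nat.
Proof.
split=> [[hs [n /tensor_nonzero h]]|[hs h]]; split=> //.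
  by move=> i iu; have /lcE[] := h (exist _ i iu).
(* A degree at or below every [rho i - d i]. *)
exists (- \sum_i `|rho i - (d i)%:Z|); apply/tensor_nonzero => -[i iu] /=.
apply/lcE; split; first exact: h.
rewrite (bigD1 i) //= opprD -[leRHS]addr0 lerD //; first by rewrite lerNl -normrN ler_norm.
by rewrite oppr_le0; apply: sumr_ge0 => *; exact: normr_ge0.
Qed.

(** The value at [u] is [1 + \sum_(supp u) b] plus the minimum of [e] on the support. If [l] attains
    this minimum, the support lies in the set where [e] is at least [e l], so the value is at most
    the score of [l]. Taking that whole set for [l0] as support gives equality. *)
Lemma score_max (e c : 'I_s -> int) l0 : (forall l, c l = - e l) ->
  (forall l, score (fun i => (d i).-1) e l <= score (fun i => (d i).-1) e l0) ->
  is_max (fun w => exists2 u : forall i, 'I_(d i).+1,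
    C2 E u & is_value u (fun i => (d i)%:Z - 1) c w) (score (fun i => (d i).-1) e l0).
Proof.
move=> cE best.
have sumE (P : pred 'I_s) : \sum_(i | P i) ((d i)%:Z - 1) = (\sum_(i | P i) (d i).-1)%N%:Z.
  rewrite -natz natr_sum; apply: eq_bigr => i _; rewrite natz; have := d_ge1 i; lia.
split=> [|w [u _ [a [[l lu al] amax] ->]]]; last first.
  apply: le_trans (best l); rewrite sumE /score.
  have hs : (\sum_(i in supp u) (d i).-1 <= \sum_(i | (e l <= e i)%R) (d i).-1)%N.
    apply: leq_sum_sub => i iu; have : (c i <= a)%O by apply: amax; exists i.
    by rewrite al !cE lerN2.
  by have := cE l; lia.
pose u i : 'I_(d i).+1 := if e l0 <= e i then ord_max else ord0.
have uE i : (i \in supp u) = (e l0 <= e i).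
  rewrite /supp inE /u; case: ifP => //= _; have := d_ge1 i; by case: (d i).
exists u.
  apply/C2E; split=> [|i]; first by exists l0; rewrite uE.
  by rewrite uE /u => ->.
exists (c l0); first split.
- by exists l0; rewrite ?uE.
- by move=> _ [l + ->]; rewrite uE !cE lerN2.
rewrite /score [in RHS](eq_bigl (fun i => e l0 <= e i)) // sumE cE; lia.
Qed.
End Values.

Theorem theorem2p10 (K : fieldType) (s : nat) (s_gt0 : (0 < s)%N)
    (r : 'I_s -> nat) (M : forall i, gmod (polyAlg K (r i)))
    (M_fg : forall i, finitely_generated (M i))
    (M_CM : forall i, cohen_macaulay (M i))
    (d : 'I_s -> nat) (M_dim : forall i, is_dim (M i) (d i))
    (d_ge1 : forall i, (1 <= d i)%N)
    (E : forall i, injres (M i))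
    (rho : 'I_s -> int) (M_reg : forall i, is_reg (E i) (rho i)) :
  let b i : int := (d i)%:Z - 1 in
  let alpha i : int := (d i)%:Z - rho i in
  (forall F : injres (segre M),
     exists2 v, is_reg F v &
       is_max (fun w => exists2 u : forall i, 'I_(d i).+1,
                 C2 E u & is_value u b alpha w) v)
  /\
  (forall (n : 'I_s -> nat) (tau : 'I_s -> int), (forall i, (0 < n i)%N) ->
     forall F : injres (segre (fun i => veronese (n i) (M i) (tau i))),
     exists2 v, is_reg F v &
       is_max (fun w => exists2 u : forall i, 'I_(d i).+1,
                 C2 E u &
                 is_value u b
                   (fun l => Num.ceil ((alpha l + tau l)%:~R / (n l)%:R : rat))
                   w) v).
Proof.
move=> b alpha.
have VM i j : j != d i -> koszul_vanish (M i) j := cohen_macaulay_koszul_vanish (M_CM i) (M_dim i).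
have lcE i j n := cohen_macaulay_local_cohomology (d_ge1 i) (VM i) (M_reg i) j n.
have cM i : cmres (M i) (d i).-1 (rho i - (d i)%:Z) := cohen_macaulay_cmres (d_ge1 i) (VM i) (M_reg i).
(* Both parts are instances of one statement, differing only in the cutoffs [- c i] of the factors;
   [C2] refers to the original modules in both. *)
have reg (A : 'I_s -> galg K) (N : forall l, gmod (A l)) (c : 'I_s -> int) (F : injres (segre N)) :
    (forall i, cmres (N i) (d i).-1 (- c i)) -> exists2 v, is_reg F v &
    is_max (fun w => exists2 u : forall i, 'I_(d i).+1, C2 E u & is_value u b c w) v.
  move=> cN; have [l0 [best small]] := score_best (fun i => (d i).-1) (fun i => - c i) s_gt0.
  exists (score (fun i => (d i).-1) (fun i => - c i) l0); first exact: segre_reg.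
  by apply: (score_max d_ge1 lcE) => // l; rewrite opprK.
split=> [F|n tau n0 F]; apply: reg => i.
  by rewrite /alpha opprB; exact: cM.
apply: cmres_veronese (cM i) => // k.
have n0' : 0 < (n i)%:R :> rat by rewrite ltr0n.
(* The Veronese cutoff: [n k + tau <= - alpha] holds exactly when [k] is at most minus the ceiling
   of [(alpha + tau) / n]. *)
rewrite lerNr ceil_le_int ler_pdivrMr // -[(n i)%:R]/((n i)%:Z%:~R) -intrM ler_int /alpha.
by split=> h; lia.
Qed.
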